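(* Let $s=t$ and $F=Z+W\mathbf j$ with $Z,W\in L^\infty(\mathbb T^d;\mathbb C_{\mathbf i}^{s\times s})$. Let $\tau\in\{L,R,(S_L,S_R)\}$ and suppose the spectral essential range $\mathcal R(G_\tau)$ has empty interior and $\mathbb C\setminus\mathcal R(G_\tau)$ is connected. Then $\{T^{(\tau)}_{\boldsymbol n}(F)\}_{\boldsymbol n}\sim_\lambda G_\tau$.
   Context: $\mathbb H$ is the quaternion algebra with units $\mathbf i,\mathbf j,\mathbf k=\mathbf i\mathbf j$; $\mathbb C_{\mathbf i}=\operatorname{span}_{\mathbb R}\{1,\mathbf i\}\cong\mathbb C$. For $A=Z+W\mathbf j$, $\Phi(A)=\begin{bmatrix}Z&W\\-\overline W&\overline Z\end{bmatrix}$. $\mathbb T^d=[-\pi,\pi)^d$; $\langle\boldsymbol k,\boldsymbol\theta\rangle_S=\sum_{j\in S}k_j\theta_j$; $S_L\dot\cup S_R=\{1,\dots,d\}$ is an ordered partition, $\tau=L$ means $S_L=\{1,\dots,d\}$, $\tau=R$ means $S_R=\{1,\dots,d\}$. Sandwich Fourier coefficients $\widehat F^{(S_L,S_R)}(\boldsymbol k)=(2\pi)^{-d}\int e^{-\mathbf i\langle\boldsymbol k,\boldsymbol\theta\rangle_{S_L}}F(\boldsymbol\theta)e^{-\mathbf i\langle\boldsymbol k,\boldsymbol\theta\rangle_{S_R}}d\boldsymbol\theta$, $T^{(\tau)}_{\boldsymbol n}(F)=[\widehat F^{(\tau)}(\alpha-\beta)]_{\alpha,\beta\in\Lambda_{\boldsymbol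 n}}$, $\Lambda_{\boldsymbol n}=\prod_\ell\{0,\dots,n_\ell-1\}$ (lexicographic), $N_{\boldsymbol n}=\prod n_\ell$. With $r_{S_L}(\boldsymbol\theta)_j=-\theta_j$ for $j\in S_L$ and $\theta_j$ for $j\in S_R$, $G_{(S_L,S_R)}(\boldsymbol\theta)=\begin{pmatrix}Z(\boldsymbol\theta)&W(r_{S_L}(-\boldsymbol\theta))\\-\overline{W(r_{S_L}(\boldsymbol\theta))}&\overline{Z(-\boldsymbol\theta)}\end{pmatrix}$. Spectral essential range: for measurable $H:\mathbb T^d\to\mathbb C^{m\times m}$, $\mathcal R(H)=\bigcup_{j=1}^m\mathcal R(\lambda_j(H))$, where $\mathcal R(\lambda_j(H))$ is the essential range of $\boldsymbol\theta\mapsto\lambda_j(H(\boldsymbol\theta))$ for a measurable labeling of eigenvalues. $\{A_{\boldsymbol n}\}\sim_\lambda G$ (for $A_{\boldsymbol n}\in\mathbb H^{d_{\boldsymbol n}\times d_{\boldsymbol n}}$, $G:\mathbb T^d\to\mathbb C^{q\times q}$) means: for all $\Psi\in C_c(\mathbb C)$, $\lim_{\boldsymbol n\to\infty}\frac1{2d_{\boldsymbol n}}\sum_{j=1}^{2d_{\boldsymbol n}}\Psi(\lambda_j(\Phi(A_{\boldsymbol n})))=\frac1{(2\pi)^d}\int_{\mathbb T^d}\frac1q\sum_{i=1}^q\Psi(\lambda_i(G(\boldsymbol\theta)))d\boldsymbol\theta$, limit as $\min_jn_j\to\infty$. *)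

(* Defs.v *)
From mathcomp Require Import all_boot all_algebra.
From mathcomp Require Import all_classical all_reals all_analysis.
From mathcomp Require Import complex.
Import numFieldNormedType.Exports.
Set Implicit Arguments.
Unset Strict Implicit.
Unset Printing Implicit Defensive.
Import GRing.Theory Num.Theory.
Local Open Scope ring_scope.
Local Open Scope classical_set_scope.
Local Open Scope complex_scope.

(* C_i ≅ C, with its norm topology (numFieldNormedType). *)
Definition Cx (R : realType) : numClosedFieldType := R[i].

Section Defs.
Variable R : realType.
Local Notation C := (Cx R).

(** Quaternions: (z, w) represents z + w j, with z, w in C_i. *)
Definition quat := (C * C)%type.

(* (z1 + w1 j)(z2 + w2 j) = (z1 z2 - w1 conj w2) + (z1 w2 + w1 conj z2) j,
   using j z = conj(z) j and j^2 = -1. *)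
Definition qmul (a b : quat) : quat :=
  (a.1 * b.1 - a.2 * conjc b.2, a.1 * b.2 + a.2 * conjc b.1).

Definition expi (x : R) : C := (cos x +i* sin x).
Definition qexpi (x : R) : quat := (expi x, 0).

Definition inT d (t : d.-tuple R) : Prop := forall j, -pi <= tnth t j < pi.

Fixpoint iint (n : nat) : (n.-tuple R -> R) -> R :=
  match n return (n.-tuple R -> R) -> R with
  | 0 => fun f => f [tuple]
  | n'.+1 => fun f =>
      Rintegral (@lebesgue_measure R) [set x : R | -pi <= x < pi]
        (fun x => iint (fun t : n'.-tuple R => f [tuple of x :: t]))
  end.

Definition cint d (f : d.-tuple R -> C) : C :=
  (iint (fun t => complex.Re (f t))) +i* (iint (fun t => complex.Im (f t))).

Definition torus_null d (A : set (d.-tuple R)) : Prop :=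
  exists B : set (d.-tuple R),
    [/\ measurable B, A `<=` B & iint (\1_B : d.-tuple R -> R) = 0].

Definition shift2pi d (t : d.-tuple R) (j : 'I_d) : d.-tuple R :=
  [tuple (if k == j then tnth t k + 2 * pi else tnth t k) | k < d].
Definition tor_periodic d m (Z : d.-tuple R -> 'M[C]_m) : Prop :=
  forall t j, Z (shift2pi t j) = Z t.

Definition Linf_mx d m (Z : d.-tuple R -> 'M[C]_m) : Prop :=
  (forall i j, measurable_fun [set: d.-tuple R] (fun t => complex.Re (Z t i j))
            /\ measurable_fun [set: d.-tuple R] (fun t => complex.Im (Z t i j)))
  /\ exists M : R,
       torus_null [set t | inT t /\ exists i j, M < Normc.normc (Z t i j)].

Definition eigs m (M : 'M[C]_m) : seq C :=
  projT1 (closed_field_poly_normal (char_poly M)).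

(** Spectral essential range of H : T^d -> C^{m x m}: union of the essential
    ranges of the eigenvalue functions (labeling-free form). *)
Definition specRange d m (H : d.-tuple R -> 'M[C]_m) : set C :=
  [set z | forall e : R, 0 < e ->
     ~ torus_null [set t | inT t /\ exists2 l, l \in eigs (H t) & Normc.normc (l - z) < e]].

(** The symbol G_{(S_L,S_R)}; S_R is the complement of S_L. *)
Definition tneg d (t : d.-tuple R) : d.-tuple R := [tuple - tnth t j | j < d].
Definition rS d (SL : {set 'I_d}) (t : d.-tuple R) : d.-tuple R :=
  [tuple (if j \in SL then - tnth t j else tnth t j) | j < d].
Definition Gsym d s (SL : {set 'I_d}) (Z W : d.-tuple R -> 'M[C]_s)
  (t : d.-tuple R) : 'M[C]_(s + s) :=
  block_mx (Z t) (W (rS SL (tneg t)))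
           (- map_mx conjc (W (rS SL t))) (map_mx conjc (Z (tneg t))).

Definition Phi n (A : 'M[quat]_n) : 'M[C]_(n + n) :=
  block_mx (map_mx (fun q : quat => q.1) A) (map_mx (fun q : quat => q.2) A)
           (- map_mx (fun q : quat => conjc q.2) A)
           (map_mx (fun q : quat => conjc q.1) A).

Definition Fq d s (Z W : d.-tuple R -> 'M[C]_s) (t : d.-tuple R) : 'M[quat]_s :=
  \matrix_(p, q) (Z t p q, W t p q).

Definition ipS d (S : {set 'I_d}) (k : 'I_d -> int) (t : d.-tuple R) : R :=
  \sum_(j in S) (k j)%:~R * tnth t j.

Definition sandwich d s (SL : {set 'I_d}) (F : d.-tuple R -> 'M[quat]_s)
  (k : 'I_d -> int) : 'M[quat]_s :=
  \matrix_(p, q)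
    let g := fun t => qmul (qmul (qexpi (- ipS SL k t)) (F t p q))
                           (qexpi (- ipS (~: SL) k t)) in
    (((2 * pi) ^- d)%:C * cint (fun t => (g t).1),
     ((2 * pi) ^- d)%:C * cint (fun t => (g t).2)).

Definition NN d (n : 'I_d -> nat) : nat := \prod_(l < d) n l.
(* l-th coordinate of the i-th multi-index of Lambda_n (lexicographic order) *)
Definition alpha d (n : 'I_d -> nat) (i : nat) (l : 'I_d) : nat :=
  (i %/ \prod_(l' < d | (l < l')%N) n l') %% n l.

Definition Toeplitz d s (SL : {set 'I_d}) (n : 'I_d -> nat)
  (F : d.-tuple R -> 'M[quat]_s) : 'M[quat]_(\sum_(i < NN n) s) :=
  \mxblock_(i < NN n, j < NN n)
    sandwich SL F (fun l => (alpha n i l)%:Z - (alpha n j l)%:Z).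

Definition Cc (Psi : C -> C) : Prop :=
  continuous Psi /\ compact (closure [set z | Psi z != 0]).

Definition eig_avg m (M : 'M[C]_m) (Psi : C -> C) : C :=
  (m%:R)^-1 * \sum_(l <- eigs M) Psi l.

Definition multi_lim d (a : ('I_d -> nat) -> C) (L : C) : Prop :=
  forall e : R, 0 < e -> exists N : nat, forall n : 'I_d -> nat,
    (forall l, (N <= n l)%N) -> Normc.normc (a n - L) < e.

Definition lambda_dist d q (dim : ('I_d -> nat) -> nat)
  (A : forall n : 'I_d -> nat, 'M[quat]_(dim n)) (G : d.-tuple R -> 'M[C]_q) : Prop :=
  forall Psi : C -> C, Cc Psi ->
    multi_lim (fun n => eig_avg (Phi (A n)) Psi)
              (((2 * pi) ^- d)%:C * cint (fun t => eig_avg (G t) Psi)).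

End Defs.

(* Main.v *)
(* Up to a permutation of indices [Phi (Toeplitz SL n F)] is the block Toeplitz matrix with symbol
   [G = Gsym SL Z W].  By density of trigonometric polynomials in L2, a product of block Toeplitz matrices
   with bounded symbols is the block Toeplitz matrix of the product symbol up to an error whose squared
   Hilbert-Schmidt norm is o(dimension).  Hence normalized traces of polynomials converge to the integrals
   of the traces of the same polynomials in G, and the eigenvalues cluster at the spectral range S of G: for z
   outside S there is a polynomial Q with Q(z) = 1 and |Q| small on S, and the number of eigenvalues near z is
   controlled by the Hilbert-Schmidt norm of a power of Q of the matrix.  Since S is compact with empty interior
   and connected complement, real parts of polynomials are uniformly dense in C(S) (Lavrentiev), which
   upgrades convergence on polynomials to convergence on all continuous functions. *)
From HB Require Import structures.
Require Import Defs.
From mathcomp Require Import all_boot all_order all_algebra.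
From mathcomp Require Import all_classical all_reals all_analysis.
From mathcomp Require Import measurable_realfun complex spectral.
From mathcomp Require Import ring lra zify.
Import numFieldNormedType.Exports.
Set Implicit Arguments.
Unset Strict Implicit.
Unset Printing Implicit Defensive.
Import Order.TTheory GRing.Theory Num.Theory.
Local Open Scope ring_scope.
Local Open Scope classical_set_scope.
Local Open Scope complex_scope.

(** The matrices need not be normal, so only holomorphic moments, the traces of polynomials, carry
    information on eigenvalues. This is why the topology of [S] matters and why Lavrentiev's theorem
    takes the place of Weierstrass's. Positivity of the counting functionals makes approximation on
    [S] alone sufficient, once the mass off [S] is known to vanish. Non-normality also makes powers
    of [Q(G)] larger than their eigenvalues suggest. Triangularization followed by a diagonal
    rescaling bounds them by a constant times (2r)^k for spectral radius r; this loss, together with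
    a loss 4^k in counting, dictates the bound 1/8 for [Q] on [S]. Lavrentiev's theorem is proved
    constructively, without duality. Logarithms with poles off [S] are averaged into potentials of
    circles, even of circles that meet [S]; differences of concentric circle potentials are bumps; a
    grid of bumps lowers the sup norm of a continuous function by a fixed factor, and this is
    iterated. The symbol is bounded only almost everywhere and iterated integrals carry no
    measurability, so null sets are handled explicitly. *)

Notation nrm := Normc.normc.

(** * The real-valued modulus on the complex numbers *)

Section ComplexNorm.
Variable R : realType.
Local Notation C := (Cx R).
Implicit Types (z w : C).

Lemma nrmE z : nrm z = Num.sqrt (complex.Re z ^+ 2 + complex.Im z ^+ 2).
Proof. by case: z. Qed.

Lemma normCE z : `|z| = (nrm z)%:C.
Proof. by rewrite normc_def nrmE. Qed.

Lemma nrm_ge0 z : 0 <= nrm z.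
Proof. by rewrite nrmE sqrtr_ge0. Qed.

Lemma sqr_nrm z : nrm z ^+ 2 = complex.Re z ^+ 2 + complex.Im z ^+ 2.
Proof. by rewrite nrmE sqr_sqrtr// addr_ge0// sqr_ge0. Qed.

Lemma nrm0 : nrm (0 : C) = 0. Proof. exact: Normc.normc0. Qed.
Lemma nrm1 : nrm (1 : C) = 1. Proof. exact: Normc.normc1. Qed.
Lemma nrmM z w : nrm (z * w) = nrm z * nrm w. Proof. exact: Normc.normcM. Qed.
Lemma nrmV z : nrm (z^-1) = (nrm z)^-1. Proof. exact: Normc.normcV. Qed.
Lemma nrm_div z w : nrm (z / w) = nrm z / nrm w. Proof. by rewrite nrmM nrmV. Qed.
Lemma nrmN z : nrm (- z) = nrm z. Proof. exact: normcN. Qed.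
Lemma nrmBC z w : nrm (z - w) = nrm (w - z). Proof. by rewrite -nrmN opprB. Qed.
Lemma ler_nrmD z w : nrm (z + w) <= nrm z + nrm w. Proof. exact: le_normcD. Qed.
Lemma ler_nrmB z w : nrm (z - w) <= nrm z + nrm w.
Proof. by rewrite -[nrm w]nrmN; exact: ler_nrmD. Qed.

Lemma nrm_eq0 z : (nrm z == 0) = (z == 0).
Proof. by apply/eqP/eqP => [/Normc.eq0_normc//|->]; rewrite nrm0. Qed.

Lemma nrm_gt0 z : (0 < nrm z) = (z != 0).
Proof. by rewrite lt_def nrm_ge0 andbT nrm_eq0. Qed.

Lemma nrmX z n : nrm (z ^+ n) = nrm z ^+ n.
Proof. by elim: n => [|n IH]; rewrite ?expr0 ?nrm1// !exprS nrmM IH. Qed.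

Lemma nrm_prod (I : Type) (r : seq I) (P : pred I) (F : I -> C) :
  nrm (\prod_(i <- r | P i) F i) = \prod_(i <- r | P i) nrm (F i).
Proof. exact: (big_morph _ nrmM nrm1). Qed.

Lemma ler_nrm_sum (I : Type) (r : seq I) (P : pred I) (F : I -> C) :
  nrm (\sum_(i <- r | P i) F i) <= \sum_(i <- r | P i) nrm (F i).
Proof.
elim/big_rec2: _ => [|i y x _ le]; first by rewrite nrm0.
by apply: le_trans (ler_nrmD _ _) _; rewrite lerD2l.
Qed.

Lemma nrm_real (x : R) : nrm (x%:C : C) = `|x|.
Proof. by rewrite nrmE /= expr0n addr0 sqrtr_sqr. Qed.

Lemma nrmJ z : nrm (conjc z : C) = nrm z.
Proof. by rewrite !nrmE; case: z => a b /=; rewrite sqrrN. Qed.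

Lemma ler_Re z : `|complex.Re z| <= nrm z.
Proof. by rewrite -sqrtr_sqr nrmE ler_wsqrtr// lerDl sqr_ge0. Qed.

Lemma ler_Im z : `|complex.Im z| <= nrm z.
Proof. by rewrite -sqrtr_sqr nrmE ler_wsqrtr// lerDr sqr_ge0. Qed.

Lemma ler_nrm_ReIm z : nrm z <= `|complex.Re z| + `|complex.Im z|.
Proof.
rewrite nrmE -[leRHS]ger0_norm ?addr_ge0// -[leRHS]sqrtr_sqr ler_wsqrtr//.
rewrite sqrrD !real_normK ?num_real// -addrA lerD2l lerDr mulrn_wge0//.
Qed.

Lemma ler_dist_nrm z w : `|nrm z - nrm w| <= nrm (z - w).
Proof.
rewrite ler_norml; apply/andP; split.
  have := ler_nrmD (w - z) z; rewrite subrK (nrmBC w) => ?; lra.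
by have := ler_nrmD (z - w) w; rewrite subrK => ?; lra.
Qed.

Lemma nrm_le_dist z w u : nrm (z - w) <= nrm (z - u) + nrm (u - w).
Proof. by apply: le_trans (ler_nrmD _ _); rewrite addrA subrK. Qed.

Lemma cReD z w : complex.Re (z + w) = complex.Re z + complex.Re w.
Proof. by case: z w => [a b] [c d]. Qed.
Lemma cImD z w : complex.Im (z + w) = complex.Im z + complex.Im w.
Proof. by case: z w => [a b] [c d]. Qed.
Lemma cReN z : complex.Re (- z) = - complex.Re z. Proof. by case: z. Qed.
Lemma cImN z : complex.Im (- z) = - complex.Im z. Proof. by case: z. Qed.
Lemma cReB z w : complex.Re (z - w) = complex.Re z - complex.Re w.
Proof. by rewrite cReD cReN. Qed.
Lemma cImB z w : complex.Im (z - w) = complex.Im z - complex.Im w.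
Proof. by rewrite cImD cImN. Qed.
Lemma cReM z w :
  complex.Re (z * w) = complex.Re z * complex.Re w - complex.Im z * complex.Im w.
Proof. by case: z w => [a b] [c d]. Qed.
Lemma cImM z w :
  complex.Im (z * w) = complex.Re z * complex.Im w + complex.Im z * complex.Re w.
Proof. by case: z w => [a b] [c d]. Qed.

Lemma cRe_sum (I : Type) (r : seq I) (P : pred I) (F : I -> C) :
  complex.Re (\sum_(i <- r | P i) F i) = \sum_(i <- r | P i) complex.Re (F i).
Proof. exact: (big_morph _ cReD erefl). Qed.
Lemma cIm_sum (I : Type) (r : seq I) (P : pred I) (F : I -> C) :
  complex.Im (\sum_(i <- r | P i) F i) = \sum_(i <- r | P i) complex.Im (F i).
Proof. exact: (big_morph _ cImD erefl). Qed.

Lemma Cext z w : complex.Re z = complex.Re w -> complex.Im z = complex.Im w -> z = w.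
Proof. by case: z w => [a b] [c d] /= -> ->. Qed.

Lemma cReZ (x : R) z : complex.Re ((x%:C : C) * z) = x * complex.Re z.
Proof. by case: z => a b /=; rewrite mul0r subr0. Qed.
Lemma cImZ (x : R) z : complex.Im ((x%:C : C) * z) = x * complex.Im z.
Proof. by case: z => a b /=; rewrite mul0r addr0. Qed.

End ComplexNorm.

(** * Connectedness and compactness in the plane *)

Section PlaneTopology.
Variable R : realType.
Local Notation C := (Cx R).

Lemma nbhs_nrmP (z : C) (U : set C) :
  nbhs z U <-> exists2 r : R, 0 < r & forall w, nrm (w - z) < r -> U w.
Proof.
split.
  move/nbhs_normP => [e /= e0 H].
  have [eR eI] : 0 < complex.Re e /\ complex.Im e = 0.
    by move: e0; rewrite ltcE /= => /andP[/eqP -> ->].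
  exists (complex.Re e) => // w wz; apply: H => /=.
  rewrite -[e]RRe_real ?gtr0_real// distrC normCE.
  by rewrite ltcR.
move=> [r r0 H]; apply/nbhs_normP; exists (r%:C : C) => /=.
  by rewrite ltcR.
move=> w /=; rewrite distrC normCE => wz; apply: H.
by rewrite -ltcR.
Qed.

Lemma open_nrmP (U : set C) :
  open U <-> forall z, U z -> exists2 r : R, 0 < r & forall w, nrm (w - z) < r -> U w.
Proof.
split=> [oU z Uz|H].
  by apply/nbhs_nrmP; rewrite nbhsE; exists U.
by rewrite openE => z /H /nbhs_nrmP.
Qed.

(** Connectedness as an induction principle: the parts of [A] where [Q] holds and where it fails are
    both relatively open. It serves to propagate approximability along the complement of [S]. *)
Lemma connected_nrm_ind (A : set C) (Q : C -> Prop) : connected A ->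
  (exists2 z, A z & Q z) ->
  (forall z, A z -> Q z -> exists2 r : R, 0 < r & forall w, A w -> nrm (w - z) < r -> Q w) ->
  (forall z, A z -> ~ Q z -> exists2 r : R, 0 < r & forall w, A w -> nrm (w - z) < r -> ~ Q w) ->
  forall z, A z -> Q z.
Proof.
move=> cA [z0 Az0 Qz0] HQ HN.
pose U := [set w : C | exists z r, [/\ 0 < r, nrm (w - z) < r &
   forall w, A w -> nrm (w - z) < r -> Q w]].
pose V := [set w : C | exists z r, [/\ 0 < r, nrm (w - z) < r &
   forall w, A w -> nrm (w - z) < r -> ~ Q w]].
have opn (T : C -> Prop) : open [set w : C | exists z r, [/\ 0 < r, nrm (w - z) < r &
   forall w, A w -> nrm (w - z) < r -> T w]].
  apply/open_nrmP => w [z [r [r0 wz H]]]; exists (r - nrm (w - z)); first by rewrite subr_gt0.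
  move=> v vw; exists z, r; split=> //.
  by apply: le_lt_trans (nrm_le_dist v z w) _; rewrite -ltrBrDr.
have E : A `&` [set w | Q w] = A.
  apply: cA.
  - by exists z0.
  - exists U; first exact: opn.
    apply/seteqP; split => w /=.
      move=> [Aw Qw]; split=> //; have [r r0 H] := HQ w Aw Qw.
      by exists w, r; rewrite subrr nrm0.
    by move=> [Aw [z [r [r0 wz H]]]]; split=> //; exact: H.
  - exists (~` V); first exact/open_closedC/opn.
    apply/seteqP; split => w /=.
      by move=> [Aw Qw]; split=> // -[z [r [r0 wz H]]]; exact: (H w).
    move=> [Aw nV]; split=> //; apply: contrapT => nQ; apply: nV.
    have [r r0 H] := HN w Aw nQ.
    by exists w, r; rewrite subrr nrm0.
by move=> z; rewrite -E => -[].
Qed.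

Lemma big_min_le (I : eqType) (r : seq I) (F : I -> R) (x : R) i : i \in r ->
  \big[Num.min/x]_(j <- r) F j <= F i.
Proof.
elim: r => // j r IH; rewrite inE big_cons ge_min => /orP[/eqP ->|/IH ->].
  by rewrite lexx.
by rewrite orbT.
Qed.

Lemma gauge_cover_segment (M : R) (g : R -> R) : (forall x, 0 < g x) ->
  exists xs : seq R, forall x, `|x| <= M -> exists2 y, y \in xs & `|x - y| < g y.
Proof.
move=> g0; have cK : cover_compact `[(- M)%R, M]%classic.
  by rewrite -compact_cover; exact: segment_compact.
have [|x _|D _ cov] := cK R setT (fun x => ball x (g x)).
- by move=> x _; exact: ball_open.
- by exists x => //; exact: ballxx.
exists (finmap.enum_fset D) => x xM.
have [|y yD] := cov x; first by rewrite /= in_itv /= -ler_norml.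
by rewrite /ball /= distrC => H; exists y.
Qed.

(** The tube lemma by hand: each vertical line has a finite cover, the least radius in it gives a
    width for a strip, and finitely many strips suffice. The gauge is halved because the two
    coordinate errors are added. *)
Lemma gauge_cover (M : R) (g : C -> R) : (forall z, 0 < g z) ->
  exists zs : seq C, forall w, nrm w <= M -> exists2 z, z \in zs & nrm (w - z) < g z.
Proof.
move=> g0.
have g20 x y : 0 < g (x +i* y) / 2 by rewrite divr_gt0.
pose ys x := sval (cid (gauge_cover_segment M (g20 x))).
pose h x := \big[Num.min/1]_(y <- ys x) (g (x +i* y) / 2).
have h0 x : 0 < h x by rewrite /h; elim/big_ind: _ => // a b a0 b0; rewrite lt_min a0.
have [xs Hxs] := gauge_cover_segment M h0.
exists (flatten [seq [seq (x +i* y : C) | y <- ys x] | x <- xs]) => w wM.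
have [x xxs Hx] := Hxs (complex.Re w) (le_trans (ler_Re w) wM).
have [y yys Hy] : exists2 y, y \in ys x & `|complex.Im w - y| < g (x +i* y) / 2.
  by rewrite /ys; case: cid => /= l Hl; exact: Hl (le_trans (ler_Im w) wM).
exists (x +i* y : C).
  by apply/flattenP; exists [seq (x +i* y : C) | y <- ys x]; apply/mapP; [exists x|exists y].
apply: le_lt_trans (ler_nrm_ReIm _) _; rewrite cReB cImB /= (splitr (g _)).
apply: ltrD Hy; apply: lt_le_trans Hx _.
exact: big_min_le.
Qed.

End PlaneTopology.

(** * Continuity of real functions on the plane *)

Section PlaneContinuity.
Variable R : realType.
Local Notation C := (Cx R).

(** Continuity in terms of [nrm], because the library norm of [C] takes its values in [C]; radii and
    errors stay real. *)
Definition ccont (f : C -> R) := forall z (e : R), 0 < e ->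
  exists2 r : R, 0 < r & forall w, nrm (w - z) < r -> `|f w - f z| < e.

Lemma ccont_cst a : ccont (fun=> a).
Proof. by move=> z e e0; exists 1 => // w _; rewrite subrr normr0. Qed.

Lemma ccont_lip (k : R) (f : C -> R) :
  (forall z w, `|f w - f z| <= k * nrm (w - z)) -> ccont f.
Proof.
move=> H z e e0; exists (e / (`|k| + 1)).
  by rewrite divr_gt0// ltr_pwDr.
move=> w; rewrite ltr_pdivlMr ?ltr_pwDr// => Hw; apply: le_lt_trans (H _ _) _.
apply: le_lt_trans Hw; rewrite mulrC ler_wpM2l ?nrm_ge0//.
by rewrite (le_trans (ler_norm _))// lerDl.
Qed.

Lemma eq_ccont f g : f =1 g -> ccont f -> ccont g.
Proof. by move=> /funext ->. Qed.

Lemma ccontD f g : ccont f -> ccont g -> ccont (fun w => f w + g w).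
Proof.
move=> cf cg z e e0; have e2 : 0 < e / 2 by rewrite divr_gt0.
have [r r0 Hr] := cf z _ e2; have [s s0 Hs] := cg z _ e2.
exists (Num.min r s); first by rewrite lt_min r0.
move=> w; rewrite lt_min => /andP[/Hr wr /Hs ws].
rewrite opprD addrACA (splitr e); apply: le_lt_trans (ler_normD _ _) _.
exact: ltrD.
Qed.

Lemma ccontZ a f : ccont f -> ccont (fun w => a * f w).
Proof.
move=> cf z e e0; have [|r r0 Hr] := cf z (e / (`|a| + 1)).
  by rewrite divr_gt0// ltr_pwDr.
exists r => // w /Hr; rewrite ltr_pdivlMr ?ltr_pwDr// -mulrBr normrM.
apply: le_lt_trans; rewrite mulrC ler_wpM2l// lerDl//.
Qed.

Lemma ccontN f : ccont f -> ccont (fun w => - f w).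
Proof. by move=> /(ccontZ (-1)); apply: eq_ccont => w; rewrite mulN1r. Qed.

Lemma ccontB f g : ccont f -> ccont g -> ccont (fun w => f w - g w).
Proof. by move=> cf cg; apply: ccontD => //; exact: ccontN. Qed.

Lemma ccont_sum (I : Type) (r : seq I) (P : pred I) (F : I -> C -> R) :
  (forall i, P i -> ccont (F i)) -> ccont (fun w => \sum_(i <- r | P i) F i w).
Proof.
move=> cF; elim: r => [|i r IH].
  by apply: eq_ccont (ccont_cst 0) => w; rewrite big_nil.
case Pi : (P i); last by apply: eq_ccont IH => w; rewrite big_cons Pi.
by apply: eq_ccont (ccontD (cF _ Pi) IH) => w; rewrite big_cons Pi.
Qed.

(* Continuous functions of one real variable enter only through an
   epsilon-delta hypothesis, so that no topology on R is needed below. *)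
Lemma ccont_comp (phi : R -> R) f :
  (forall x (e : R), 0 < e -> exists2 d : R, 0 < d & forall y, `|y - x| < d -> `|phi y - phi x| < e) ->
  ccont f -> ccont (fun w => phi (f w)).
Proof.
move=> cphi cf z e e0; have [d d0 Hd] := cphi (f z) e e0.
by have [r r0 Hr] := cf z d d0; exists r => // w /Hr /Hd.
Qed.

Lemma ccont_lip_comp (phi : R -> R) f :
  (forall x y, `|phi y - phi x| <= `|y - x|) -> ccont f -> ccont (fun w => phi (f w)).
Proof.
move=> H; apply: ccont_comp => x e e0; exists e => // y.
exact: le_lt_trans.
Qed.

Lemma ler_dist_max (a x y : R) : `|Num.max a y - Num.max a x| <= `|y - x|.
Proof.
wlog xy : x y / x <= y.
  move=> H; have /orP[xy|yx] := le_total x y; first exact: H.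
  by rewrite distrC (distrC y); exact: H.
rewrite (ger0_norm (_ : 0 <= y - x)) ?subr_ge0// /Num.max.
by case: ltP => ?; case: ltP => ?; rewrite ger0_norm; lra.
Qed.

Lemma ccont_max a f : ccont f -> ccont (fun w => Num.max a (f w)).
Proof. by apply: ccont_lip_comp => x y; exact: ler_dist_max. Qed.

Lemma ccont_min a f : ccont f -> ccont (fun w => Num.min a (f w)).
Proof.
move=> cf; have := ccontN (ccont_max (- a) (ccontN cf)).
by apply: eq_ccont => w; rewrite -oppr_min opprK.
Qed.

Lemma ccont_nrm z : ccont (fun w => nrm (w - z)).
Proof.
apply: (@ccont_lip 1) => u w; rewrite mul1r (le_trans (ler_dist_nrm _ _))//.
by rewrite opprB addrA subrK.
Qed.

Lemma ccont_Re : ccont (fun w => complex.Re w).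
Proof. by apply: (@ccont_lip 1) => z w; rewrite mul1r -cReB ler_Re. Qed.

Lemma ccont_Im : ccont (fun w => complex.Im w).
Proof. by apply: (@ccont_lip 1) => z w; rewrite mul1r -cImB ler_Im. Qed.

Lemma ccontM f g : ccont f -> ccont g -> ccont (fun w => f w * g w).
Proof.
move=> cf cg z e e0.
pose k := `|f z| + `|g z| + 1.
have k0 : 0 < k by rewrite ltr_pwDr// addr_ge0.
pose d := Num.min 1 (e / k / 2).
have d0 : 0 < d by rewrite lt_min ltr01 !divr_gt0.
have [r r0 Hr] := cf z d d0; have [s s0 Hs] := cg z d d0.
exists (Num.min r s); first by rewrite lt_min r0.
move=> w; rewrite lt_min => /andP[/Hr wr /Hs ws].
have -> : f w * g w - f z * g z = (f w - f z) * (g w - g z)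
   + (f z * (g w - g z) + g z * (f w - f z)) by ring.
have dk : d * k <= e / 2.
  by rewrite -ler_pdivlMr// mulrAC ge_min lexx orbT.
apply: le_lt_trans (ler_normD _ _) _.
apply: (@le_lt_trans _ _ (d * d + (`|f z| * d + `|g z| * d))).
  apply: lerD; first by rewrite normrM ler_pM// ltW.
  apply: le_trans (ler_normD _ _) _.
  by apply: lerD; rewrite normrM ler_wpM2l// ltW.
apply: (@le_lt_trans _ _ (d * k)).
  rewrite /k; have : d * d <= d by rewrite ger_pMr// ge_min lexx.
  nra.
by apply: le_lt_trans dk _; rewrite ltr_pdivrMr// ltr_pMr// ltr1n.
Qed.

Lemma ccont_poly_ReIm (p : {poly C}) :
  ccont (fun w => complex.Re p.[w]) /\ ccont (fun w => complex.Im p.[w]).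
Proof.
elim/poly_ind: p => [|p c [IHr IHi]].
  by split; apply: eq_ccont (ccont_cst 0) => w; rewrite horner0.
split.
  have := ccontD (ccontB (ccontM IHr ccont_Re) (ccontM IHi ccont_Im)) (ccont_cst (complex.Re c)).
  by apply: eq_ccont => w; rewrite hornerMXaddC cReD cReM.
have := ccontD (ccontD (ccontM IHr ccont_Im) (ccontM IHi ccont_Re)) (ccont_cst (complex.Im c)).
by apply: eq_ccont => w; rewrite hornerMXaddC cImD cImM.
Qed.

Lemma ccont_nrm_poly (p : {poly C}) : ccont (fun w => nrm p.[w]).
Proof.
move=> z e e0; have [cr ci] := ccont_poly_ReIm p.
have e2 : 0 < e / 2 by rewrite divr_gt0.
have [r r0 Hr] := cr z _ e2; have [s s0 Hs] := ci z _ e2.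
exists (Num.min r s); first by rewrite lt_min r0.
move=> w; rewrite lt_min => /andP[/Hr wr /Hs ws].
apply: le_lt_trans (ler_dist_nrm _ _) _; apply: le_lt_trans (ler_nrm_ReIm _) _.
by rewrite cReB cImB (splitr e) ltrD.
Qed.

Lemma ln_lip (d x y : R) : 0 < d -> d <= x -> d <= y -> `|ln y - ln x| <= `|y - x| / d.
Proof.
move=> d0; wlog xy : x y / x <= y.
  move=> H dx dy; have /orP[xy|yx] := le_total x y; first exact: H.
  by rewrite distrC (distrC y); exact: H.
move=> dx dy; have x0 : 0 < x by exact: lt_le_trans dx.
have y0 : 0 < y by exact: lt_le_trans dy.
rewrite ger0_norm ?subr_ge0 ?ler_ln ?posrE// ger0_norm ?subr_ge0//.
rewrite -ln_div ?posrE//.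
have -> : y / x = 1 + (y - x) / x by rewrite mulrBl divff ?gt_eqF// addrC subrK.
apply: le_trans (le_ln1Dx _) _.
  by rewrite (@lt_le_trans _ _ 0)// divr_ge0 ?subr_ge0// ltW.
by rewrite ler_wpM2l ?subr_ge0// lef_pV2 ?posrE.
Qed.

Lemma ccont_ln_max (d : R) f : 0 < d -> ccont f -> ccont (fun w => ln (Num.max d (f w))).
Proof.
move=> d0 /(ccont_max d) cf z e e0.
have [r r0 Hr] := cf z (e * d) (mulr_gt0 e0 d0).
exists r => // w /Hr H; apply: le_lt_trans (ln_lip d0 _ _) _.
- by rewrite le_max lexx.
- by rewrite le_max lexx.
- by rewrite ltr_pdivrMr.
Qed.

Lemma ccont_bounded (M : R) f : ccont f -> exists2 B : R, 0 < B & forall w, nrm w <= M -> `|f w| <= B.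
Proof.
move=> cf.
pose g (z : C) := sval (cid2 (cf z 1 ltr01)).
have [z|zs Hz] := @gauge_cover R M g; first by rewrite /g; case: cid2.
exists (1 + \sum_(z <- zs) (`|f z| + 1)).
  by rewrite ltr_pwDl// sumr_ge0// => z _; rewrite addr_ge0.
move=> w /Hz[z zzs]; rewrite /g; case: cid2 => /= r r0 H /H wz.
apply: (@le_trans _ _ (`|f z| + 1)).
  rewrite -[f w](subrK (f z)) addrC; apply: le_trans (ler_normD _ _) _.
  by rewrite lerD2l ltW.
rewrite (big_rem z)//= ler_wpDl// lerDl sumr_ge0//.
Qed.

(** A Lebesgue number: the radii of the cover are halved, so that a [v] close to [w] stays in the
    ball chosen for [w], even when [v] leaves the disc. *)
Lemma ccont_unif (M : R) f (e : R) : ccont f -> 0 < e -> exists2 d : R, 0 < d &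
  forall w v, nrm w <= M -> nrm (v - w) < d -> `|f v - f w| < e.
Proof.
move=> cf e0; have e2 : 0 < e / 2 by rewrite divr_gt0.
pose g (z : C) := sval (cid2 (cf z _ e2)) / 2.
have g0 z : 0 < g z by rewrite /g; case: cid2 => /= r r0 H; rewrite divr_gt0.
have [zs Hz] := @gauge_cover R M g g0.
exists (\big[Num.min/1]_(z <- zs) g z).
  by elim/big_ind: _ => // x y x0 y0; rewrite lt_min x0.
move=> w v /Hz[z zzs wz] vw.
have vw' : nrm (v - w) < g z.
  by apply: lt_le_trans vw _; exact: big_min_le.
move: wz vw'; rewrite /g; case: cid2 => /= r r0 H wz vw'.
rewrite -[f v](subrK (f z)) -addrA (splitr e).
apply: le_lt_trans (ler_normD _ _) _; apply: ltrD.
  by apply: H; have := nrm_le_dist v z w; lra.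
by rewrite distrC; apply: H; lra.
Qed.

End PlaneContinuity.

(** * Real inequalities, mostly for the logarithm *)

Section RealBounds.
Variable R : realType.

Lemma exists_expr_lt (t e : R) : 0 <= t < 1 -> 0 < e -> exists k, t ^+ k < e.
Proof.
move=> /andP[t0 t1] e0.
have : (t ^+ n @[n --> \oo] --> (0 : R))%classic by apply: cvg_expr; rewrite ger0_norm.
move=> /cvgrPdist_lt /(_ e e0) [k _ Hk]; exists k.
have := Hk k (leqnn k); rewrite /= sub0r normrN ger0_norm//.
exact: exprn_ge0.
Qed.

Lemma exists_natr_gt (x : R) : exists k : nat, x < k.+1%:R.
Proof.
have [x0|x0] := ltP x 0; first by exists 0%N; rewrite (lt_trans x0).
by exists (Num.truncn x); have /andP[] := truncn_itv x0.
Qed.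

Lemma ln_le_subr1 (x : R) : 0 < x -> ln x <= x - 1.
Proof. by move=> x0; have := @le_ln1Dx R (x - 1); rewrite addrCA subrr addr0; apply; lra. Qed.

Lemma ln_ge_1subV (x : R) : 0 < x -> 1 - x^-1 <= ln x.
Proof.
move=> x0; have := @ln_le_subr1 x^-1; rewrite invr_gt0 x0 lnV ?posrE// => /(_ isT).
by move=> ?; lra.
Qed.

(** The lower half of Stirling's formula for ln m!; the induction step is m ln((m+1)/m) <= 1. *)
Lemma sum_ln_ge m : m%:R * ln m%:R - m%:R <= \sum_(0 <= i < m) ln (i.+1%:R : R).
Proof.
elim: m => [|m IH]; first by rewrite big_geq// mul0r subr0.
rewrite big_nat_recr//=; apply: le_trans (lerD IH (lexx _)).
case: m {IH} => [|m]; first by rewrite !mul0r ln1; lra.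
set N : R := m.+1%:R.
have N0 : 0 < N by rewrite /N.
have -> : m.+2%:R = N + 1 by rewrite /N -natr1.
have : N * (ln (N + 1) - ln N) <= 1.
  rewrite -ln_div ?posrE ?addr_gt0//.
  have := @ln_le_subr1 ((N + 1) / N); rewrite divr_gt0 ?addr_gt0// => /(_ isT).
  rewrite mulrDl divff ?gt_eqF// addrAC subrr add0r mul1r => H.
  by rewrite -ler_pdivlMl// mulr1.
lra.
Qed.

(* The values [a j] behave like [ln (|x - j| / m)], except that the possible
   singularity near [x] is cut off at [- K]. *)
Lemma sum_ln_lattice (a : nat -> R) m x K : (0 < m)%N ->
  (forall j, (j < m)%N -> - K <= a j) ->
  (forall j, (j < m)%N -> 0 < `|x - j%:R| -> ln (`|x - j%:R| / m%:R) <= a j) ->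
  - K - 4 * m%:R <= \sum_(0 <= j < m) a j.
Proof.
case: m => // m _ aK aln.
set N : R := m.+1%:R.
have N0 : 0 < N by rewrite /N.
pose psi (i : nat) : R := ln (i.+1%:R / (2 * N)).
have psi_le0 i : (i < m.+1)%N -> psi i <= 0.
  move=> im; apply: ln_le0; rewrite ler_pdivrMr ?mulr_gt0// mul1r.
  have : i.+1%:R <= N by rewrite ler_nat.
  lra.
have psi_sum k : (k <= m.+1)%N -> - (2 * N) <= \sum_(0 <= i < k) psi i.
  move=> km; apply: (@le_trans _ _ (\sum_(0 <= i < m.+1) psi i)); last first.
    rewrite (@big_cat_nat _ _ _ k)//= gerDl big_nat; apply: sumr_le0 => i /andP[_ im].
    exact: psi_le0.
  have -> : \sum_(0 <= i < m.+1) psi i = \sum_(0 <= i < m.+1) ln (i.+1%:R : R) - N * ln (2 * N).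
    have -> : N * ln (2 * N) = \sum_(0 <= i < m.+1) ln (2 * N).
      by rewrite sumr_const_nat subn0 -[RHS]mulr_natl.
    rewrite -sumrB.
    by apply: eq_bigr => i _; rewrite /psi ln_div ?posrE ?mulr_gt0.
  have := sum_ln_ge m.+1; rewrite -/N lnM ?posrE//.
  have : N * ln 2 <= N by rewrite ger_pMr// (le_trans (ln_le_subr1 _))//; lra.
  lra.
(* [j0] is the index nearest to [x]; only there is the bound [- K] used. For other [j] minimality
   gives |j - j0| <= 2 |x - j|, whence the factor 2 in [psi], and Stirling charges at most [2 * N]
   to each side of [j0]. *)
case: (@arg_minP _ _ _ (@ord0 m) xpredT (fun j : 'I_m.+1 => `|x - j%:R|) isT) => j0 _ Hj0.
have near j : (j < m.+1)%N -> j != j0 :> nat -> ln (`|j%:R - j0%:R| / (2 * N)) <= a j.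
  move=> jm jj0.
  have d0 : 0 < `|j%:R - j0%:R : R| by rewrite normr_gt0 subr_eq0 eqr_nat.
  have d2 : `|j%:R - j0%:R| <= 2 * `|x - j%:R|.
    have := Hj0 (Ordinal jm) isT => /= H.
    have -> : j%:R - j0%:R = (x - j0%:R) - (x - j%:R) :> R by ring.
    by apply: le_trans (ler_normB _ _) _; lra.
  have xj0 : 0 < `|x - j%:R| by lra.
  apply: le_trans (aln j jm xj0).
  rewrite ler_ln ?posrE ?divr_gt0 ?mulr_gt0// -/N.
  by rewrite invfM mulrA ler_pM2r ?invr_gt0// ler_pdivrMr// mulrC.
have j0m := ltn_ord j0.
rewrite (@big_cat_nat _ _ _ j0)//= ?(ltnW j0m)// (big_ltn j0m).
have s1 : - (2 * N) <= \sum_(0 <= j < j0) a j.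
  apply: le_trans (psi_sum j0 (ltnW j0m)) _; rewrite big_nat_rev /= add0n.
  rewrite !big_nat; apply: ler_sum => j /andP[_ jj0].
  apply: le_trans (near j (ltn_trans jj0 j0m) (negbT (ltn_eqF jj0))).
  have -> : `|j%:R - j0%:R| = (j0 - j.+1).+1%:R :> R.
    by rewrite distrC -natrB ?(ltnW jj0)// normr_nat subnSK.
  exact: lexx.
have s2 : - (2 * N) <= \sum_(j0.+1 <= j < m.+1) a j.
  apply: le_trans (psi_sum (m.+1 - j0.+1)%N (leq_subr _ _)) _.
  rewrite -{2}[j0.+1]add0n big_addn !big_nat; apply: ler_sum => i /andP[_ ij].
  have im : (i + j0.+1 < m.+1)%N by lia.
  apply: le_trans (near _ im _); last by lia.
  have -> : `|(i + j0.+1)%N%:R - j0%:R| = i.+1%:R :> R.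
    rewrite -natrB; last by lia.
    by rewrite normr_nat; congr (_%:R); lia.
  exact: lexx.
have := aK j0 j0m; lra.
Qed.

Lemma ln_sub_ratio (x y d : R) : 0 < x -> 0 < y -> `|y - x| <= d * x -> d <= 1 / 2 ->
  `|ln y - ln x| <= 2 * d.
Proof.
move=> x0 y0 yx d2; have d0 : 0 <= d by rewrite -(pmulr_lge0 _ x0) (le_trans _ yx).
have : (1 - d) * x <= y by move: yx; rewrite ler_norml; lra.
have : y <= (1 + d) * x by move: yx; rewrite ler_norml; lra.
move=> yu yl.
have r0 : 0 < y / x by rewrite divr_gt0.
have up : ln (y / x) <= y / x - 1 := ln_le_subr1 r0.
have lo := ln_ge_1subV r0.
have e1 : y / x <= 1 + d by rewrite ler_pdivrMr.
have e2 : (y / x)^-1 <= 1 + 2 * d.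
  by rewrite invf_div ler_pdivrMr//; nra.
rewrite -ln_div ?posrE// ler_norml; lra.
Qed.

Lemma ln_prod (I : finType) (F : I -> R) : (forall i, 0 < F i) ->
  ln (\prod_i F i) = \sum_i ln (F i).
Proof.
move=> F0; suff [] : 0 < \prod_i F i /\ ln (\prod_i F i) = \sum_i ln (F i) by [].
elim/big_rec2: _ => [|i y x _ [x0 <-]]; first by rewrite ln1.
by rewrite mulr_gt0// lnM ?posrE.
Qed.

End RealBounds.

(** * Roots of unity on the circle *)

Section UnitCircle.
Variable R : realType.
Local Notation C := (Cx R).

Lemma expiD (x y : R) : expi (x + y) = expi x * expi y.
Proof. by apply: Cext; rewrite /expi /= ?cosD ?sinD// addrC mulrC [X in _ + X]mulrC. Qed.

Lemma expi0 : expi (0 : R) = 1.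
Proof. by apply: Cext; rewrite /= ?cos0 ?sin0. Qed.

Lemma expiX (x : R) n : expi x ^+ n = expi (x *+ n).
Proof. by elim: n => [|n IH]; rewrite ?expr0 ?mulr0n ?expi0// exprS IH -expiD mulrS. Qed.

Lemma nrm_expi (x : R) : nrm (expi x) = 1.
Proof. by rewrite nrmE /= cos2Dsin2 sqrtr1. Qed.

Lemma conjc_expi (x : R) : conjc (expi x) = expi (- x).
Proof. by rewrite /expi cosN sinN. Qed.

Lemma expi_neq1 (x : R) : 0 < x < 2 * pi -> expi x != 1.
Proof.
move=> /andP[x0 x2]; apply/eqP => /(congr1 (@complex.Re _)) /=.
have s0 : 0 < sin (x / 2) by apply: sin_gt0_pi; apply/andP; split; lra.
have -> : x = (x / 2) *+ 2 by rewrite mulr2n -splitr.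
by rewrite cos_mulr2n cos2sin2 mulr2n; nra.
Qed.

Lemma expi_prim n : (0 < n)%N -> n.-primitive_root (expi (2 * pi / n%:R) : C).
Proof.
move=> n0; rewrite /primitive_root_of_unity n0 /=; apply/forallP => i.
have nR : 0 < n%:R :> R by rewrite ltr0n.
rewrite unity_rootE expiX; apply/eqP; have [->|ni] := eqVneq i.+1 n.
  have -> : (2 * pi / n%:R) *+ n = pi *+ 2 :> R.
    by rewrite -[LHS]mulr_natr divfK ?gt_eqF// mulr_natl.
  by rewrite /expi cos2pi sin2pi !eqxx.
apply/negbTE/expi_neq1.
have lt_in : (i.+1 < n)%N by rewrite ltn_neqAle ni ltn_ord.
rewrite -[_ *+ i.+1]mulr_natr mulrAC ltr_pdivrMr// divr_gt0 ?mulr_gt0 ?pi_gt0//=.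
by rewrite ltr_pM2l ?mulr_gt0 ?pi_gt0// ltr_nat.
Qed.

(** Gives a closed form for the average of ln |w - u| over equally spaced points u of a circle. *)
Lemma prod_expi (n : nat) (x y : C) : (0 < n)%N ->
  \prod_(k < n) (x - y * expi (2 * pi / n%:R) ^+ k) = x ^+ n - y ^+ n.
Proof.
move=> n0; have [->|y0] := eqVneq y 0.
  under eq_bigr do rewrite mul0r subr0.
  by rewrite prodr_const card_ord expr0n eqn0Ngt n0 subr0.
have H : \prod_(k < n) (x / y - expi (2 * pi / n%:R) ^+ k) = (x / y) ^+ n - 1.
  transitivity (('X^n - 1 : {poly C}).[x / y]); last by rewrite hornerD hornerN hornerC hornerXn.
  rewrite -(factor_Xn_sub_1 (expi_prim n0)) big_mkord horner_prod.
  by apply: eq_bigr => k _; rewrite hornerXsubC.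
have -> : x ^+ n - y ^+ n = y ^+ n * ((x / y) ^+ n - 1).
  by rewrite mulrBr mulr1 -exprMn mulrC divfK.
rewrite -H -[X in y ^+ X](card_ord n) -prodr_const -big_split /=.
by apply: eq_bigr => k _; rewrite mulrBr [y * (x / y)]mulrC divfK.
Qed.

End UnitCircle.

(** * Lavrentiev's theorem *)

Section Lavrentiev.
Variables (R : realType).
Local Notation C := (Cx R).
Variables (S : set C) (M : R).
Hypothesis S_bounded : forall w, S w -> nrm w <= M.
Hypothesis S_closed : forall z, ~ S z -> exists2 r : R, 0 < r & forall w, S w -> r <= nrm (w - z).
Hypothesis S_nowhere_dense : forall z (r : R), 0 < r -> exists2 w, ~ S w & nrm (w - z) < r.
Hypothesis S_connC : connected (~` S).

(** [p] approximates the Cauchy kernel 1/(z - w) with relative error [e]; relative errors multiply,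
    which absolute ones do not. *)
Definition pole_approx z (e : R) :=
  exists p : {poly C}, forall w, S w -> nrm (1 - (z - w) * p.[w]) <= e.

(** Any relative error below 1 can be improved at will: with q = 1 - (z - w) p, the geometric sum of
    the powers of q times p has relative error exactly q^k. *)
Lemma pole_approx_lt z t e : t < 1 -> 0 < e -> pole_approx z t -> pole_approx z e.
Proof.
move=> t1 e0 [p Hp].
have [k Hk] : exists k, (Num.max 0 t) ^+ k < e.
  by apply: exists_expr_lt => //; rewrite le_max lexx/= gt_max ltr01.
pose q := 1 - (z%:P - 'X) * p.
exists (p * \sum_(i < k) q ^+ i) => w Sw.
have -> : 1 - (z - w) * (p * \sum_(i < k) q ^+ i).[w] = (q ^+ k).[w].
  have E : 1 - (z%:P - 'X) * (p * \sum_(i < k) q ^+ i) = q ^+ k.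
    have q1 : q - 1 = - ((z%:P - 'X) * p) by rewrite /q addrC addKr.
    have := subrX1 q k; rewrite q1 mulNr -mulrA => E.
    by rewrite -[q ^+ k](subrK 1) E addrC.
  by rewrite -E !hornerE.
rewrite horner_exp nrmX; apply: ltW; apply: le_lt_trans Hk.
apply: lerXn2r; rewrite ?nnegrE ?nrm_ge0// ?le_max ?lexx//.
by have := Hp w Sw; rewrite /q !hornerE => ->; rewrite orbT.
Qed.

(** Runge's pole pushing. By the previous lemma it suffices to reach some error below 1, and this
    condition on the pole is locally constant off [S]. *)
Lemma pole_approx_all z e : ~ S z -> 0 < e -> pole_approx z e.
Proof.
move=> nS e0; suff : exists2 t, t < 1 & pole_approx z t.
  by move=> [t t1]; exact: pole_approx_lt.
move: z nS; apply: (connected_nrm_ind S_connC).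
(* The starting pole lies outside the disc containing [S]; there the constant polynomial 1/T already
   has relative error |w|/T < 1. *)
- pose T := `|M| + 1.
  have T0 : 0 < T by rewrite ltr_pwDr.
  exists (T%:C : C).
    by move=> /S_bounded; rewrite nrm_real gtr0_norm// /T; have := ler_norm M; lra.
  exists (`|M| / T); first by rewrite ltr_pdivrMr// mul1r /T; lra.
  exists ((T%:C : C)^-1)%:P => w Sw; rewrite hornerC mulrBl divff; last first.
    by rewrite -nrm_eq0 nrm_real gt_eqF// gtr0_norm.
  rewrite opprB addrC subrK nrm_div nrm_real (gtr0_norm T0) ler_pM2r ?invr_gt0//.
  exact: le_trans (S_bounded Sw) (ler_norm M).
- move=> z _ [t t1 /(pole_approx_lt t1 (_ : 0 < 1 / 4)) []]; first by lra.
  move=> p Hp; have [B B0 HB] := ccont_bounded M (ccont_nrm_poly p).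
  exists (1 / 4 / B); first by rewrite !divr_gt0.
  move=> w _ wz; exists (1 / 2); first by lra.
  exists p => v Sv.
  have -> : 1 - (w - v) * p.[v] = 1 - (z - v) * p.[v] - (w - z) * p.[v] by ring.
  apply: le_trans (ler_nrmB _ _) _.
  have -> : (1 / 2 : R) = 1 / 4 + 1 / 4 / B * B by rewrite divfK ?gt_eqF//; lra.
  apply: lerD; first exact: Hp.
  rewrite nrmM ler_pM ?nrm_ge0 ?(ltW wz)//.
  by have := HB v (S_bounded Sv); rewrite ger0_norm ?nrm_ge0.
(* The radius may not depend on the polynomial of the nearby pole [w]. It depends on [d] only: error
   1/4 and |w - v| >= d/2 force |p| <= 5/(2d) on [S], so moving the pole by d/10 costs at most
   1/4. *)
- move=> z nSz nQ; have [d d0 Hd] := S_closed nSz.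
  exists (d / 10); first by rewrite divr_gt0.
  move=> w nSw wz [t t1 /(pole_approx_lt t1 (_ : 0 < 1 / 4)) []]; first by lra.
  move=> p Hp; apply: nQ; exists (1 / 2); first by lra.
  exists p => v Sv.
  have -> : 1 - (z - v) * p.[v] = 1 - (w - v) * p.[v] + (w - z) * p.[v] by ring.
  apply: le_trans (ler_nrmD _ _) _.
  have wv : d / 2 <= nrm (w - v).
    have := nrm_le_dist v z w; have := Hd v Sv; rewrite (nrmBC v w); lra.
  have pv : nrm p.[v] * (d / 2) <= 5 / 4.
    apply: (@le_trans _ _ (nrm ((w - v) * p.[v]))).
      by rewrite nrmM mulrC ler_wpM2r ?nrm_ge0.
    have -> : (w - v) * p.[v] = 1 - (1 - (w - v) * p.[v]) by ring.
    by apply: le_trans (ler_nrmB _ _) _; rewrite nrm1; have := Hp v Sv; lra.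
  have := Hp v Sv; rewrite nrmM.
  have : nrm (w - z) * nrm p.[v] <= d / 10 * nrm p.[v].
    by rewrite ler_wpM2r ?nrm_ge0// ltW.
  lra.
Qed.

Definition approx (f : C -> R) := forall e : R, 0 < e ->
  exists P : {poly C}, forall w, S w -> `|f w - complex.Re P.[w]| <= e.

Lemma approx_lim f : (forall e : R, 0 < e -> exists2 g, approx g &
  forall w, S w -> `|f w - g w| <= e) -> approx f.
Proof.
move=> H e e0; have e2 : 0 < e / 2 by rewrite divr_gt0.
have [g ag Hg] := H _ e2; have [P HP] := ag _ e2.
exists P => w Sw; rewrite (splitr e); apply: le_trans (lerD (Hg w Sw) (HP w Sw)).
by apply: le_trans (ler_normD _ _); rewrite addrA subrK.
Qed.

Lemma eq_approx f g : (forall w, S w -> f w = g w) -> approx f -> approx g.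
Proof.
by move=> fg af e /af [P HP]; exists P => w Sw; rewrite -fg ?HP.
Qed.

Lemma approx_poly P : approx (fun w => complex.Re P.[w]).
Proof. by move=> e e0; exists P => w _; rewrite subrr normr0 ltW. Qed.

Lemma approx_cst a : approx (fun=> a).
Proof. by apply: eq_approx (approx_poly (a%:C)%:P) => w _; rewrite hornerC. Qed.

Lemma approxD f g : approx f -> approx g -> approx (fun w => f w + g w).
Proof.
move=> af ag e e0; have e2 : 0 < e / 2 by rewrite divr_gt0.
have [P HP] := af _ e2; have [Q HQ] := ag _ e2.
exists (P + Q) => w Sw; rewrite hornerD cReD (splitr e).
by rewrite opprD addrACA; apply: le_trans (ler_normD _ _) (lerD (HP w Sw) (HQ w Sw)).
Qed.

Lemma approxZ a f : approx f -> approx (fun w => a * f w).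
Proof.
move=> af e e0; have a1 : 0 < `|a| + 1 by rewrite ltr_pwDr.
have [|P HP] := af (e / (`|a| + 1)); first by rewrite divr_gt0.
exists ((a%:C : C) *: P) => w Sw; rewrite hornerZ cReZ -mulrBr normrM.
have := HP w Sw; rewrite ler_pdivlMr// => H; apply: le_trans H.
by rewrite mulrC ler_wpM2l// lerDl.
Qed.

Lemma approxN f : approx f -> approx (fun w => - f w).
Proof. by move=> /(approxZ (-1)); apply: eq_approx => w _; rewrite mulN1r. Qed.

Lemma approxB f g : approx f -> approx g -> approx (fun w => f w - g w).
Proof. by move=> af ag; apply: approxD => //; exact: approxN. Qed.

Lemma approx_sum (I : Type) (r : seq I) (P : pred I) (F : I -> C -> R) :
  (forall i, P i -> approx (F i)) -> approx (fun w => \sum_(i <- r | P i) F i w).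
Proof.
move=> aF; elim: r => [|i r IH].
  by apply: eq_approx (approx_cst 0) => w _; rewrite big_nil.
case Pi : (P i); last by apply: eq_approx IH => w _; rewrite big_cons Pi.
by apply: eq_approx (approxD (aF _ Pi) IH) => w _; rewrite big_cons Pi.
Qed.

Lemma approx_pole z (c : C) : ~ S z -> approx (fun w => complex.Re (c / (z - w))).
Proof.
move=> nS; have [d d0 Hd] := S_closed nS.
move=> e e0; have c1 : 0 < nrm c + 1 by rewrite ltr_pwDr ?nrm_ge0.
have [|p Hp] := pole_approx_all nS (_ : 0 < e * d / (nrm c + 1)).
  by rewrite divr_gt0// mulr_gt0.
exists (c *: p) => w Sw.
have zw : z - w != 0 by rewrite -nrm_gt0 nrmBC (lt_le_trans d0)// Hd.
rewrite -cReB; apply: le_trans (ler_Re _) _.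
have -> : c / (z - w) - (c *: p).[w] = c / (z - w) * (1 - (z - w) * p.[w]).
  by rewrite hornerZ; field.
rewrite nrmM nrm_div.
have := Hp w Sw; set x := nrm (1 - _) => Hx.
have dz : d <= nrm (z - w) by rewrite nrmBC Hd.
have x0 : 0 <= x by exact: nrm_ge0.
move: Hx; rewrite ler_pdivlMr// => Hx.
have nz : 0 < nrm (z - w) by exact: lt_le_trans dz.
rewrite mulrAC ler_pdivrMr//.
apply: (@le_trans _ _ (x * (nrm c + 1))); first by have := nrm_ge0 c; nra.
by apply: le_trans Hx _; rewrite ler_pM2l.
Qed.

(** |1 + x|^2 = 1 + y with y = 2 Re x + |x|^2, and y - y^2/(1+y) <= ln(1+y) <= y leaves a quadratic
    remainder. The constant 16 is generous. *)
Lemma ln_nrm1D (x : C) : nrm x <= 1 / 2 -> `|ln (nrm (1 + x)) - complex.Re x| <= 16 * nrm x ^+ 2.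
Proof.
move=> Hx.
pose y := complex.Re x *+ 2 + nrm x ^+ 2.
have E : nrm (1 + x) ^+ 2 = 1 + y.
  by rewrite sqr_nrm /y sqr_nrm cReD cImD /=; ring.
have n1 : 1 / 2 <= nrm (1 + x).
  by have := ler_nrmB (1 + x) x; rewrite addrK nrm1; lra.
have y0 : 0 < 1 + y by rewrite -E exprn_gt0//; lra.
have lnE : ln (nrm (1 + x)) = ln (1 + y) / 2.
  by rewrite -E lnXn; [field|lra].
have n0 := nrm_ge0 x.
have up := ln_le_subr1 y0.
have lo : y - y ^+ 2 / (1 + y) <= ln (1 + y).
  apply: le_trans (ln_ge_1subV y0); rewrite le_eqVlt; apply/orP; left; apply/eqP.
  by field; rewrite gt_eqF.
have y14 : 1 / 4 <= 1 + y by rewrite -E; nra.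
have y2 : y ^+ 2 / (1 + y) <= 25 * nrm x ^+ 2.
  rewrite ler_pdivrMr//; apply: (@le_trans _ _ (25 / 4 * nrm x ^+ 2)).
    have -> : 25 / 4 * nrm x ^+ 2 = (5 / 2 * nrm x) ^+ 2 by field.
    rewrite -[leLHS]real_normK ?num_real//; apply: lerXn2r; rewrite ?nnegrE//.
      by rewrite mulr_ge0.
    rewrite /y mulr2n; have := ler_Re x; rewrite !ler_norml => /andP[? ?].
    apply/andP; split; nra.
  have := sqr_ge0 (nrm x); nra.
rewrite lnE ler_norml; have := sqr_ge0 (nrm x); rewrite /y mulr2n in up lo y2 *.
move=> ?; apply/andP; split; lra.
Qed.

(** The difference of logarithms is a limit of Riemann sums along the segment from [z] to [z']; each
    summand is the real part of a simple pole off [S], hence approximable. *)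
Lemma approx_ln_step z z' d : 0 < d -> (forall w, S w -> 2 * d <= nrm (w - z)) ->
  nrm (z' - z) <= d -> approx (fun w => ln (nrm (w - z')) - ln (nrm (w - z))).
Proof.
move=> d0 Hd zz; apply: approx_lim => e e0.
(* N steps with quadratic error 16/N^2 each add up to 16/N <= e; the summand 2 keeps every increment
   h/(u - w) below 1/2, where [ln_nrm1D] applies. *)
have [n Hn] := exists_natr_gt (16 / e + 2).
set N : R := n.+1%:R in Hn.
have N0 : 0 < N by rewrite /N.
pose h : C := (z' - z) * (N^-1)%:C.
pose u (i : nat) : C := z + h *+ i.
have hN : nrm h * N <= d.
  by rewrite nrmM nrm_real gtr0_norm ?invr_gt0// divfK ?gt_eqF.
have ud i w : (i <= n.+1)%N -> S w -> d <= nrm (w - u i).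
  move=> iN Sw; have := Hd w Sw.
  have : nrm (u i - z) <= d.
    rewrite /u addrAC subrr add0r -mulr_natr nrmM.
    apply: le_trans hN; rewrite ler_wpM2l ?nrm_ge0//.
    by rewrite -[i%:R](rmorph_nat (real_complex R)) nrm_real ger0_norm ?ler0n// ler_nat.
  by have := nrm_le_dist w z (u i); rewrite (nrmBC w (u i)); lra.
exists (fun w => \sum_(i < n.+1) complex.Re (h / (u i - w))).
  apply: approx_sum => i _; apply: approx_pole => Su.
  by have := ud i _ (ltnW (ltn_ord i)) Su; rewrite subrr nrm0 leNgt d0.
move=> w Sw.
have uE : z' = u n.+1.
  rewrite /u /h -mulr_natr -mulrA -[n.+1%:R](rmorph_nat (real_complex R)) -rmorphM /=.
  by rewrite mulVf ?gt_eqF// rmorph1 mulr1 addrC subrK.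
have zE : z = u 0%N by rewrite /u mulr0n addr0.
rewrite uE zE -[X in `|X - _|](telescope_sumr (fun i => ln (nrm (w - u i))))//.
rewrite -(big_mkord predT (fun i => complex.Re (h / (u i - w)))) -sumrB; apply: le_trans (ler_norm_sum _ _ _) _.
apply: (@le_trans _ _ (\sum_(0 <= i < n.+1) (16 / N ^+ 2))); last first.
  rewrite sumr_const_nat subn0 -[_ *+ n.+1]mulr_natr -/N.
  have -> : 16 / N ^+ 2 * N = 16 / N by field; rewrite gt_eqF.
  rewrite ler_pdivrMr// mulrC -ler_pdivrMr//; lra.
rewrite !big_nat; apply: ler_sum => i /andP[_ iN].
have u0 : u i - w != 0 by rewrite -nrm_gt0 nrmBC (lt_le_trans d0)// ud// ltnW.
have E : nrm (w - u i.+1) = nrm (1 + h / (u i - w)) * nrm (w - u i).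
  rewrite -nrmM; congr nrm.
  have -> : u i.+1 = u i + h by rewrite /u mulrS; ring.
  by field.
have hd : nrm (h / (u i - w)) <= N^-1.
  rewrite nrm_div ler_pdivrMr ?nrm_gt0// -ler_pdivrMl ?invr_gt0// invrK mulrC.
  by apply: le_trans hN _; rewrite nrmBC ud// ltnW.
have N2 : N^-1 <= 1 / 2.
  rewrite div1r lef_pV2 ?posrE//.
  have : 0 < 16 / e by rewrite divr_gt0.
  lra.
have n0 : 0 < nrm (1 + h / (u i - w)).
  have := ler_nrmB (1 + h / (u i - w)) (h / (u i - w)); have := le_trans hd N2.
  by rewrite addrK nrm1; move: (nrm _) (nrm _) => a b; lra.
rewrite E lnM ?posrE//; last by rewrite (lt_le_trans d0)// ud// ltnW.
rewrite addrK; apply: le_trans (ln_nrm1D _) _; first exact: le_trans hd N2.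
by rewrite -exprVn ler_pM2l// lerXn2r ?nnegrE ?nrm_ge0// invr_ge0 ltW.
Qed.

(** Differences of logarithms are approximable along the connected complement, and for a pole T far
    away ln |w - T| is uniformly close to the constant ln T on [S]. *)
Lemma approx_ln z : ~ S z -> approx (fun w => ln (nrm (w - z))).
Proof.
move=> nSz; apply: approx_lim => e e0.
pose T := 2 * `|M| / e + 2 * `|M| + 1.
have eT : 0 <= 2 * `|M| / e by rewrite divr_ge0 ?mulr_ge0// ltW.
have M0 := normr_ge0 M.
have T0 : 0 < T by rewrite /T; lra.
have nST : ~ S (T%:C : C).
  by move=> /S_bounded; rewrite nrm_real gtr0_norm// /T; have := ler_norm M; lra.
suff aT : approx (fun w => ln (nrm (w - (T%:C : C))) - ln (nrm (w - z))).
  exists (fun w => ln T - (ln (nrm (w - (T%:C : C))) - ln (nrm (w - z)))).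
    by apply: approxB => //; exact: approx_cst.
  move=> w Sw.
  have -> : forall x y t : R, x - (t - (y - x)) = y - t by move=> x y t; ring.
  have nw := S_bounded Sw; have nwM := le_trans nw (ler_norm M).
  have lb : T / 2 <= nrm (w - (T%:C : C)).
    have := ler_nrmB (w - (T%:C : C)) w; rewrite addrC addKr nrmN nrm_real gtr0_norm//.
    rewrite /T; lra.
  apply: le_trans (ln_lip (_ : 0 < T / 2) _ _) _ => //; try by rewrite ?divr_gt0//; lra.
  rewrite ler_pdivrMr ?divr_gt0//.
  have : `|nrm (w - (T%:C : C)) - T| <= nrm w.
    have := ler_dist_nrm (w - (T%:C : C)) (- (T%:C : C)).
    by rewrite opprK subrK nrmN nrm_real (gtr0_norm T0).
  move=> H; apply: le_trans H _; apply: le_trans nwM _.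
  have : 2 * `|M| / e * e = 2 * `|M| by rewrite divfK ?gt_eqF.
  rewrite /T; nra.
(* The far pole is now moved through the complement of [S], starting from [z] itself, where the
   difference is zero. *)
move: (T%:C : C) nST; apply: (connected_nrm_ind S_connC).
- by exists z => //; apply: eq_approx (approx_cst 0) => w _; rewrite subrr.
- move=> u nSu au; have [d d0 Hd] := S_closed nSu.
  have d2 : 0 < d / 2 by rewrite divr_gt0.
  exists (d / 2) => // v nSv /ltW uv.
  have := approxD (approx_ln_step d2 _ uv) au.
  move=> H; apply: eq_approx (H _) => [w _|w Sw]; first ring.
  by have := Hd w Sw; lra.
- move=> u nSu nau; have [d d0 Hd] := S_closed nSu.
  have d2 : 0 < d / 2 by rewrite divr_gt0.
  exists (d / 2) => // v nSv /ltW uv av; apply: nau.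
  have := approxB av (approx_ln_step d2 _ uv).
  move=> H; apply: eq_approx (H _) => [w _|w Sw]; first ring.
  by have := Hd w Sw; lra.
Qed.

(** A circle inside [S] would separate its complement: empty interior puts points of the complement
    inside the circle, boundedness puts some outside. *)
Lemma circle_avoid z t : 0 < t -> exists2 x, ~ S x & nrm (x - z) = t.
Proof.
move=> t0; apply: contrapT => H.
have neq x : ~ S x -> nrm (x - z) != t by move=> nS; apply/eqP => E; apply: H; exists x.
have all_in : forall x, (~` S) x -> nrm (x - z) < t.
  apply: (connected_nrm_ind S_connC); first exact: S_nowhere_dense.
  - move=> x _ xt; exists (t - nrm (x - z)); first by rewrite subr_gt0.
    by move=> w _ wx; have := nrm_le_dist w z x; lra.
  - move=> x nSx /negP; rewrite -leNgt le_eqVlt eq_sym (negbTE (neq x nSx)) /= => xt.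
    exists (nrm (x - z) - t); first by rewrite subr_gt0.
    by move=> w _ wx; have := nrm_le_dist x z w; rewrite (nrmBC x w); lra.
pose T := `|M| + nrm z + t + 1.
have M0 := ler_norm M; have z0 := nrm_ge0 z.
have T0 : 0 < T by rewrite /T; have := normr_ge0 M; lra.
have := all_in (T%:C : C).
have nST : ~ S (T%:C : C).
  by move=> /S_bounded; rewrite nrm_real gtr0_norm// /T; lra.
move=> /(_ nST).
have := ler_nrmD ((T%:C : C) - z) z; rewrite subrK nrm_real gtr0_norm// /T.
have := normr_ge0 M; lra.
Qed.

(** Compactness in the radius: a point off [S] on one circle is scaled radially onto nearby circles,
    losing at most half of its distance to [S]. *)
Lemma circle_avoid_unif z t : 0 < t -> exists d : R, [/\ 0 < d, d <= t &
  forall x, t <= x <= 2 * t -> exists2 u, nrm (u - z) = x & forall w, S w -> d <= nrm (w - u)].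
Proof.
move=> t0.
have ch x : exists r : R, [/\ 0 < r, x <= 0 -> r = t & 0 < x ->
    exists2 u, nrm (u - z) = x & forall w, S w -> 2 * r <= nrm (w - u)].
  (* The gauge must also be defined at radii [x <= 0]; with the default [t] such a center never
     covers a radius in [t, 2t]. *)
  have [x0|x0] := leP x 0; first by exists t; split.
  have [u nSu ux] := circle_avoid z x0; have [r r0 Hr] := S_closed nSu.
  exists (r / 2); split => //; first by rewrite divr_gt0.
  by move=> _; exists u => // w Sw; have := Hr w Sw; lra.
pose g x := sval (cid (ch x)).
have gP x : [/\ 0 < g x, x <= 0 -> g x = t & 0 < x ->
    exists2 u, nrm (u - z) = x & forall w, S w -> 2 * g x <= nrm (w - u)].
  by rewrite /g; case: cid.
have [x|xs Hxs] := @gauge_cover_segment R (2 * t) g; first by have [] := gP x.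
pose d := \big[Num.min/t]_(x <- xs) g x.
have d0 : 0 < d.
  by rewrite /d; elim/big_ind: _ => // [x y x0 y0|x _]; [rewrite lt_min x0|have [] := gP x].
exists d; split => //.
  by rewrite /d; elim: (xs) => [|a l IH]; rewrite ?big_nil// big_cons ge_min IH orbT.
move=> x /andP[tx x2t].
have x0 : 0 < x by exact: lt_le_trans tx.
have [|y yxs yx] := Hxs x; first by rewrite gtr0_norm.
have dg : d <= g y by exact: big_min_le.
have [_ gt gu] := gP y.
have [y0|y0] := leP y 0.
  by move: yx; rewrite gt//; have := ler_norm (x - y); lra.
have [u uy Hu] := gu y0.
exists (z + (u - z) * ((x / y)%:C)).
  by rewrite addrAC subrr add0r nrmM uy nrm_real gtr0_norm ?divr_gt0// mulrC divfK ?gt_eqF.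
move=> w Sw; have := Hu w Sw.
set v := z + _.
have : nrm (v - u) = `|x - y|.
  have -> : v - u = (u - z) * ((x / y - 1)%:C : C) by rewrite /v rmorphB rmorph1 /=; ring.
  rewrite nrmM nrm_real uy -{1}(gtr0_norm y0) -normrM; congr `|_|.
  by rewrite mulrBr mulr1 mulrC divfK ?gt_eqF.
by have := nrm_le_dist w u v; lra.
Qed.

(* Carleson's averaging argument: the logarithmic poles are placed on
   circles around [z] at points off [S], one on each of [m] circles. *)
Lemma approx_smoothed_ln z t : 0 < t -> exists2 g, approx g & forall w, S w ->
  (nrm (w - z) <= 4 * t -> `|g w - ln t| <= 5) /\
  (4 * t <= nrm (w - z) -> `|g w - ln (nrm (w - z))| <= 4 * t / nrm (w - z)).
Proof.
move=> t0; have [d [d0 dt Hd]] := circle_avoid_unif z t0.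
(* Each term is at least ln(d/t) after normalization. With more than ln(t/d) circles the one term
   without a better bound costs at most 1 in the average, so the final constant 5 does not depend on
   [d]. *)
have [m' Hm] := exists_natr_gt (ln (t / d)).
set m := m'.+1 in Hm; pose N : R := m%:R.
have N0 : 0 < N by rewrite /N.
(* Equally spaced radii between t and 2t: the distance of |w - z| to them, divided by t, is a
   lattice distance divided by [m], as [sum_ln_lattice] requires. *)
pose x j := t * (1 + j%:R / N).
have ch (j : nat) : exists u : C, (j < m)%N -> nrm (u - z) = x j /\ forall w, S w -> d <= nrm (w - u).
  have [jm|_] := ltnP j m; last by exists 0.
  have [|u ux Hu] := Hd (x j); last by exists u.
  have : j%:R <= N by rewrite ler_nat ltnW.
  rewrite -{1}(mul1r N) -ler_pdivrMr// => j1; rewrite /x.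
  have : 0 <= j%:R / N by rewrite divr_ge0// ltW.
  by move: (j%:R / N) j1 => a *; apply/andP; split; nra.
pose u j := sval (cid (ch j)).
have uP j : (j < m)%N -> nrm (u j - z) = x j /\ forall w, S w -> d <= nrm (w - u j).
  by rewrite /u; case: cid.
have x2t j : (j < m)%N -> 0 <= x j <= 2 * t.
  move=> jm; have : j%:R <= N by rewrite ler_nat ltnW.
  rewrite -{1}(mul1r N) -ler_pdivrMr// => j1; rewrite /x.
  have : 0 <= j%:R / N by rewrite divr_ge0// ltW.
  by move: (j%:R / N) j1 => a *; apply/andP; split; nra.
exists (fun w => N^-1 * \sum_(j < m) ln (nrm (w - u j))).
  apply: approxZ; apply: approx_sum => j _; apply: approx_ln => Su.
  by have [_ /(_ _ Su)] := uP j (ltn_ord j); rewrite subrr nrm0 leNgt d0.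
move=> w Sw; split=> wz.
  pose b j := ln (nrm (w - u j) / t).
  have -> : N^-1 * (\sum_(j < m) ln (nrm (w - u j))) - ln t = N^-1 * \sum_(0 <= j < m) b j.
    have -> : ln t = N^-1 * \sum_(j < m) ln t.
      by rewrite sumr_const card_ord -[_ *+ m]mulr_natl -/N mulKf// gt_eqF.
    rewrite -mulrBr big_mkord -sumrB; congr (_ * _); apply: eq_bigr => j _.
    rewrite /b ln_div ?posrE//; have [_ /(_ _ Sw)] := uP j (ltn_ord j).
    exact: lt_le_trans.
  have wu j : (j < m)%N -> 0 < nrm (w - u j).
    by move=> /uP[_ /(_ _ Sw)]; exact: lt_le_trans.
  (* Here |w - u j| <= 4t + 2t, so each term is at most ln 6 <= 5; below, 5 is the sum of 1 for the
     singular term and 4 for the lattice sum. *)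
  have up : \sum_(0 <= j < m) b j <= 5 * N.
    have -> : 5 * N = \sum_(0 <= j < m) 5 by rewrite sumr_const_nat subn0 -[RHS]mulr_natr.
    rewrite !big_nat; apply: ler_sum => j /andP[_ jm].
    apply: le_trans (ln_le_subr1 _) _; first by rewrite divr_gt0 ?wu.
    rewrite lerBlDr ler_pdivrMr//.
    have [uz _] := uP j jm; have := nrm_le_dist w (u j) z.
    rewrite (nrmBC z) uz; have := x2t j jm; lra.
  have lo : - N - 4 * N <= \sum_(0 <= j < m) b j.
    apply: (@sum_ln_lattice _ _ _ ((nrm (w - z) - t) * N / t)) => //.
      move=> j jm; apply: (@le_trans _ _ (ln (d / t))).
        by rewrite -[d / t]invf_div lnV ?posrE ?divr_gt0// lerN2 ltW.
      rewrite ler_ln ?posrE ?divr_gt0 ?wu// ler_pM2r ?invr_gt0//.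
      by have [_ ->] := uP j jm.
    move=> j jm xj; have [uz _] := uP j jm.
    rewrite ler_ln ?posrE ?divr_gt0 ?wu//.
    apply: (@le_trans _ _ (`|nrm (w - z) - x j| / t)).
      rewrite -[X in _ / X <= _](gtr0_norm N0) -[X in _ <= _ / X](gtr0_norm t0).
      rewrite -!normf_div le_eqVlt; apply/orP; left; apply/eqP; congr `|_|.
      by rewrite /x; field; rewrite !gt_eqF.
    rewrite ler_pM2r ?invr_gt0// -uz; apply: le_trans (ler_dist_nrm _ _) _.
    by rewrite opprB addrA subrK.
  rewrite ler_norml; apply/andP; split.
    by rewrite ler_pdivlMl//; lra.
  by rewrite ler_pdivrMl// mulrC.
have r0 : 0 < nrm (w - z) by apply: lt_le_trans wz; rewrite mulr_gt0.
have -> : N^-1 * (\sum_(j < m) ln (nrm (w - u j))) - ln (nrm (w - z)) =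
    N^-1 * \sum_(j < m) (ln (nrm (w - u j)) - ln (nrm (w - z))).
  by rewrite sumrB mulrBr sumr_const card_ord -[_ *+ m]mulr_natl -/N mulKf// gt_eqF.
rewrite normrM gtr0_norm ?invr_gt0// ler_pdivrMl//.
apply: le_trans (ler_norm_sum _ _ _) _.
have -> : N * (4 * t / nrm (w - z)) = \sum_(j < m) (2 * (2 * t / nrm (w - z))).
  by rewrite sumr_const card_ord -[_ *+ m]mulr_natl -/N; field; rewrite gt_eqF.
apply: ler_sum => j _; have [uz /(_ _ Sw) uw] := uP j (ltn_ord j).
apply: ln_sub_ratio => //; first exact: lt_le_trans uw.
- rewrite divfK ?gt_eqF//; apply: le_trans (ler_dist_nrm _ _) _.
  have -> : w - u j - (w - z) = z - u j by ring.
  by rewrite nrmBC uz; have := x2t j (ltn_ord j); lra.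
- rewrite ler_pdivrMr//; lra.
Qed.

(** A finite average of logarithms over a circle is uncontrolled at points too close to that circle;
    the comparison is made at a displaced point instead, which need not lie in [S]. *)
Lemma radial_shift (c w : C) (r t : R) : 0 < t -> 2 * t <= r -> exists w' : C,
  nrm (w' - w) <= t /\ t <= `|nrm (w' - c) - r|.
Proof.
move=> t0 tr; set p := nrm (w - c).
have [H|H] := leP t `|p - r|; first by exists w; rewrite subrr nrm0 ltW.
have p0 : 0 < p by move: H; rewrite ltr_norml; lra.
have scal (q : R) : 0 <= q -> nrm (c + (w - c) * ((q / p)%:C) - c) = q /\
    nrm (c + (w - c) * ((q / p)%:C) - w) = `|q - p|.
  move=> q0; split.
    rewrite addrAC subrr add0r nrmM nrm_real ger0_norm ?divr_ge0 ?(ltW p0)//.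
    by rewrite -/p mulrC divfK ?gt_eqF.
  have -> : c + (w - c) * ((q / p)%:C) - w = (w - c) * ((q / p - 1)%:C : C).
    by rewrite rmorphB rmorph1 /=; ring.
  rewrite nrmM nrm_real -/p -{1}(gtr0_norm p0) -normrM; congr `|_|.
  by field; rewrite gt_eqF.
move: H; rewrite ltr_norml => /andP[H1 H2].
have [rp|pr] := leP r p.
  have [E1 E2] := scal (p + t) ltac:(lra).
  exists (c + (w - c) * (((p + t) / p)%:C)); rewrite E1 E2 ger0_norm; last by lra.
  by rewrite ger0_norm; [split; lra|lra].
have [E1 E2] := scal (p - t) ltac:(lra).
exists (c + (w - c) * (((p - t) / p)%:C)); rewrite E1 E2 ler0_norm; last by lra.
by rewrite ler0_norm; [split; lra|lra].
Qed.

(** A discrete Jensen formula: the average is ln |(w-c)^K - r^K| / K, and the larger of the two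
    powers dominates as long as [w] keeps distance r/K from the circle. *)
Lemma ln_circle_prod (c w : C) (r : R) K : (0 < K)%N -> 0 < r ->
  r / K%:R <= `|nrm (w - c) - r| ->
  `|K%:R^-1 * (\sum_(k < K) ln (nrm (w - (c + (r%:C : C) * expi (2 * pi / K%:R) ^+ k))))
     - ln (Num.max r (nrm (w - c)))| <= ln (K%:R + 1) / K%:R.
Proof.
move=> K0 r0 Hr; set q := nrm (w - c) in Hr *; set N : R := K%:R in Hr *.
have N1 : 1 <= N by rewrite /N ler1n.
have N0 : 0 < N by lra.
have q0 : 0 <= q by exact: nrm_ge0.
set mx := Num.max r q; pose mn := Num.min r q.
have mx0 : 0 < mx by rewrite lt_max r0.
have mn0 : 0 <= mn by rewrite le_min q0 ltW.
have mn_le : mn * (N + 1) <= mx * N.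
  have e : r / N * N = r by rewrite divfK ?gt_eqF.
  move: Hr; rewrite /mn /mx; case: (leP r q) => rq.
    rewrite ger0_norm ?subr_ge0// => H; nra.
  rewrite ltr0_norm ?subr_lt0// opprB => H.
  have := mulr_ge0 (ltW r0) (ltW N0); nra.
(* The ratio mn/mx is at most N/(N+1), so the K-th powers cannot cancel by more than a factor N+1,
   which is harmless after taking ln and dividing by N. *)
have pw_lo : mx ^+ K <= (N + 1) * (mx ^+ K - mn ^+ K).
  suff : mn ^+ K * (N + 1) <= mx ^+ K * N by lra.
  case: (K) K0 => // k _; rewrite !exprS -!mulrA.
  have : mn ^+ k <= mx ^+ k.
    by rewrite lerXn2r ?nnegrE ?(ltW mx0)// /mn /mx ge_min !le_max lexx.
  have := exprn_ge0 k mn0; have := exprn_ge0 k (ltW mx0).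
  move: (mn ^+ k) (mx ^+ k) => a b b0 a0 ab.
  have -> : mn * (a * (N + 1)) = (mn * (N + 1)) * a by ring.
  have -> : mx * (b * N) = (mx * N) * b by ring.
  by rewrite ler_pM// mulr_ge0//; lra.
have nz (k : 'I_K) : 0 < nrm (w - (c + (r%:C : C) * expi (2 * pi / N) ^+ k)).
  have : nrm ((r%:C : C) * expi (2 * pi / N) ^+ k) = r.
    by rewrite nrmM nrmX nrm_expi expr1n mulr1 nrm_real gtr0_norm.
  move: ((r%:C : C) * _) => v vr.
  have := ler_dist_nrm (w - c) v; rewrite vr -/q opprD addrA.
  by apply: lt_le_trans; apply: lt_le_trans Hr; rewrite divr_gt0.
have -> : \sum_(k < K) ln (nrm (w - (c + (r%:C : C) * expi (2 * pi / N) ^+ k)))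
    = ln (nrm ((w - c) ^+ K - (r%:C : C) ^+ K)).
  rewrite -(prod_expi _ _ K0) nrm_prod ln_prod; last by move=> k; rewrite -addrA -opprD.
  by apply: eq_bigr => k _; rewrite opprD addrA.
set D := nrm (_ - _).
have rK : nrm ((r%:C : C) ^+ K) = r ^+ K by rewrite nrmX nrm_real gtr0_norm.
have D_up : D <= (N + 1) * mx ^+ K.
  apply: le_trans (ler_nrmB _ _) _; rewrite rK nrmX -/q.
  have : q ^+ K <= mx ^+ K by rewrite lerXn2r ?nnegrE ?(ltW mx0)// le_max lexx orbT.
  have : r ^+ K <= mx ^+ K by rewrite lerXn2r ?nnegrE ?(ltW mx0) ?(ltW r0)// le_max lexx.
  have := exprn_ge0 K (ltW mx0); nra.
have D_lo : mx ^+ K <= (N + 1) * D.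
  apply: le_trans pw_lo _; rewrite ler_pM2l; last by lra.
  apply: le_trans (ler_dist_nrm _ _); rewrite rK nrmX -/q /mx /mn.
  case: (leP r q) => _; first exact: ler_norm.
  by rewrite distrC ler_norm.
have mxK : 0 < mx ^+ K by rewrite exprn_gt0.
have N10 : 0 < N + 1 by lra.
have D0 : 0 < D by rewrite -(pmulr_rgt0 _ N10); apply: lt_le_trans D_lo.
have lnmx : ln mx = N^-1 * ln (mx ^+ K).
  by rewrite lnXn// -[_ *+ K]mulr_natl -/N mulKf ?gt_eqF.
rewrite lnmx -mulrBr normrM gtr0_norm ?invr_gt0// mulrC ler_pM2r ?invr_gt0//.
rewrite ler_norml; apply/andP; split.
  rewrite lerNl opprB lerBlDr -lnM ?posrE//.
  by rewrite ler_ln ?posrE ?mulr_gt0.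
by rewrite lerBlDr -lnM ?posrE// ler_ln ?posrE ?mulr_gt0.
Qed.

(** At most a share 1/J of the points is close to [w]: two points whose indices agree modulo [L]
    differ by a nontrivial J-th root of unity, so their distance is bounded below independently of
    [L]. *)
Lemma roots_sparse (c : C) (r : R) J : 0 < r -> (0 < J)%N -> exists2 d : R, 0 < d &
  forall L (w : C), (0 < L)%N ->
  (#|[set k : 'I_(J * L) | (nrm (w - (c + (r%:C : C) * expi (2 * pi / (J * L)%:R) ^+ k)) < d)%R]%SET| <= L)%N.
Proof.
move=> r0 J0.
pose f (b : nat) := r * nrm (1 - expi (2 * pi / J%:R) ^+ b : C) / 2.
pose d := \big[Num.min/1]_(b <- index_iota 1 J) f b.
have Jr : 0 < J%:R :> R by rewrite ltr0n.
have f0 b : b \in index_iota 1 J -> 0 < f b.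
  rewrite mem_index_iota => /andP[b0 bJ].
  rewrite /f divr_gt0// mulr_gt0// nrm_gt0 subr_eq0 eq_sym expiX.
  apply: expi_neq1; have b0r : 0 < b%:R :> R by rewrite ltr0n.
  rewrite -[_ *+ b]mulr_natr mulrAC ltr_pdivrMr// divr_gt0 ?mulr_gt0 ?pi_gt0//=.
  by rewrite ltr_pM2l ?mulr_gt0 ?pi_gt0// ltr_nat.
exists d.
  rewrite /d big_seq; elim/big_ind: _ => // x y x0 y0; by rewrite lt_min x0.
move=> L w L0.
have Lr : 0 < L%:R :> R by rewrite ltr0n.
set om := expi (2 * pi / (J * L)%:R).
have omL : om ^+ L = expi (2 * pi / J%:R).
  rewrite /om expiX; congr expi; rewrite -[LHS]mulr_natr natrM.
  by field; rewrite !gt_eqF.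
pose g (k : 'I_(J * L)) : 'I_L := Ordinal (ltn_pmod k L0).
rewrite -[leqRHS]card_ord; apply: (@leq_card_in _ _ g).
suff inj (k l : 'I_(J * L)) : (k < l)%N -> g k = g l ->
    nrm (w - (c + (r%:C : C) * om ^+ k)) < d -> nrm (w - (c + (r%:C : C) * om ^+ l)) < d -> False.
  move=> k l; rewrite !inE => Hk Hl gkl; apply/val_inj.
  case: (ltngtP k l) => // kl; first by case: (inj k l kl gkl Hk Hl).
  by case: (inj l k kl (esym gkl) Hl Hk).
move=> kl /(congr1 val) /= kml Hk Hl.
pose b := ((l - k) %/ L)%N.
have lk : (l = k + b * L :> nat)%N.
  rewrite /b divnK ?subnKC ?(ltnW kl)//.
  by rewrite -eqn_mod_dvd ?(ltnW kl)// eq_sym; apply/eqP.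
have b0 : (0 < b)%N by rewrite lt0n; apply: contraTneq kl => b0; rewrite lk b0 mul0n addn0 ltnn.
have bJ : (b < J)%N.
  by rewrite -(ltn_pmul2r L0); apply: leq_ltn_trans (ltn_ord l); rewrite lk leq_addl.
have db : d <= f b by apply: big_min_le; rewrite mem_index_iota b0.
have := nrm_le_dist (c + (r%:C : C) * om ^+ k) (c + (r%:C : C) * om ^+ l) w.
rewrite (nrmBC _ w).
have -> : c + (r%:C : C) * om ^+ k - (c + (r%:C : C) * om ^+ l) =
    (r%:C : C) * om ^+ k * (1 - expi (2 * pi / J%:R) ^+ b).
  by rewrite -omL -exprM lk exprD (mulnC L); ring.
rewrite !nrmM nrmX nrm_expi expr1n mulr1 nrm_real gtr0_norm//.
move: db; rewrite /f; lra.
Qed.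

(** Here [x] is the value at [w] of the smoothed logarithm with pole [z], compared with the true one
    at the displaced point. A pole within [d] costs a bounded amount; any other costs O(t/d). *)
Lemma smoothed_ln_error (z w w' : C) (t d x : R) : 0 < t -> 4 * t < d ->
  nrm (w' - w) <= t -> t <= nrm (w' - z) ->
  (nrm (w - z) <= 4 * t -> `|x - ln t| <= 5) ->
  (4 * t <= nrm (w - z) -> `|x - ln (nrm (w - z))| <= 4 * t / nrm (w - z)) ->
  `|ln (nrm (w' - z)) - x| <= (nrm (w - z) < d)%R%:R * 10 + 8 * t / d.
Proof.
move=> t0 t4d w'w tz near far.
have d0 : 0 < d by lra.
have td0 : 0 <= 8 * t / d by apply: ltW; rewrite divr_gt0// mulr_gt0.
have [wz|wz] := leP (nrm (w - z)) (4 * t).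
  have -> : nrm (w - z) < d by lra.
  have := near wz; rewrite !ler_norml.
  have : ln t <= ln (nrm (w' - z)) by rewrite ler_ln ?posrE//; lra.
  have : ln (nrm (w' - z) / t) <= 4.
    apply: le_trans (ln_le_subr1 _) _; first by rewrite divr_gt0//; lra.
    rewrite lerBlDr ler_pdivrMr//; have := nrm_le_dist w' z w; lra.
  rewrite ln_div ?posrE//; last by lra.
  rewrite mul1r; lra.
have wz0 : 0 < nrm (w - z) by lra.
have f1 := far (ltW wz).
have f2 : `|ln (nrm (w' - z)) - ln (nrm (w - z))| <= 2 * (t / nrm (w - z)).
  apply: ln_sub_ratio => //; first by lra.
    rewrite divfK ?gt_eqF//; apply: le_trans (ler_dist_nrm _ _) _.
    by have -> : w' - z - (w - z) = w' - w by ring.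
  by rewrite ler_pdivrMr//; lra.
apply: (@le_trans _ _ (6 * (t / nrm (w - z)))).
  have -> : ln (nrm (w' - z)) - x = (ln (nrm (w' - z)) - ln (nrm (w - z)))
     - (x - ln (nrm (w - z))) by ring.
  by apply: le_trans (ler_normB _ _) _; lra.
have [wd|dz] := ltP (nrm (w - z)) d.
  have : t / nrm (w - z) <= 1 by rewrite ler_pdivrMr//; lra.
  by rewrite mul1r; lra.
rewrite mul0r add0r -mulrA.
have : t / nrm (w - z) <= t / d by rewrite ler_pM2l// lef_pV2 ?posrE.
have : 0 < t / nrm (w - z) by rewrite divr_gt0.
lra.
Qed.

(** This is the logarithmic potential of the uniform measure on a circle. The circle may meet [S];
    each of its equally spaced points is replaced by a smoothed logarithm whose actual poles avoid
    [S]. *)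
Lemma approx_circle_potential c (r : R) : 0 < r -> approx (fun w => ln (Num.max r (nrm (w - c)))).
Proof.
move=> r0; apply: approx_lim => e e0.
(* Order of choices: at most a share 1/J of the poles is near, at cost 10 each, so 10/J <= e/5 fixes
   [J]. Then [d] depends on [J], and [L] comes last, making t = r/K small against [d]. The five
   errors are at most e/5 each. *)
have [j Hj] := exists_natr_gt (50 / e); set J := j.+1 in Hj.
have [d d0 Hd] := @roots_sparse c r J r0 isT.
(* The slope in ln(N+1) <= (N+1) x - 1 - ln x, which makes ln(N+1)/N at most e/5 for large N. *)
pose x := e / 20.
have x0 : 0 < x by rewrite divr_gt0.
have [l Hl] := exists_natr_gt (10 * `|ln x| / e + 5 / e + 40 * r / (d * e) + 4 * r / d + 2).
set L := l.+1 in Hl; pose K := (J * L)%N; pose N : R := K%:R.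
have K0 : (0 < K)%N by [].
have LN : L%:R <= N by rewrite ler_nat leq_pmull.
have p1 : 0 <= 10 * `|ln x| / e by rewrite divr_ge0 ?mulr_ge0// ltW.
have p2 : 0 < 5 / e by rewrite divr_gt0.
have p3 : 0 < 40 * r / (d * e) by rewrite divr_gt0 ?mulr_gt0.
have p4 : 0 < 4 * r / d by rewrite divr_gt0 ?mulr_gt0.
have N0 : 0 < N by rewrite /N ltr0n.
pose t := r / N.
have t0 : 0 < t by rewrite divr_gt0.
have t2r : 2 * t <= r by rewrite mulrA ler_pdivrMr// mulrC ler_pM2l//; lra.
have t4d : 4 * t < d.
  by rewrite mulrA ltr_pdivrMr// -ltr_pdivrMl// mulrC; lra.
have t8d : 8 * t / d <= e / 5.
  have : 40 * r / (d * e) <= N by lra.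
  rewrite ler_pdivrMr ?mulr_gt0// => H.
  rewrite ler_pdivrMr// /t mulrA ler_pdivrMr//; nra.
have lnN : ln (N + 1) / N <= e / 5.
  rewrite ler_pdivrMr//.
  have : ln ((N + 1) * x) <= (N + 1) * x - 1 by apply: ln_le_subr1; rewrite mulr_gt0//; lra.
  rewrite lnM ?posrE//; last by lra.
  have : 10 * `|ln x| <= e * N by rewrite -ler_pdivrMl// mulrC; lra.
  have : - ln x <= `|ln x| by rewrite -normrN ler_norm.
  rewrite /x; have : e <= e * N by rewrite ler_peMr//; lra.
  lra.
pose z (k : nat) : C := c + (r%:C : C) * expi (2 * pi / N) ^+ k.
pose g k := sval (cid2 (approx_smoothed_ln (z k) t0)).
have gP k : approx (g k) /\ forall w, S w ->
  (nrm (w - z k) <= 4 * t -> `|g k w - ln t| <= 5) /\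
  (4 * t <= nrm (w - z k) -> `|g k w - ln (nrm (w - z k))| <= 4 * t / nrm (w - z k)).
  by rewrite /g; case: cid2.
exists (fun w => N^-1 * \sum_(k < K) g k w).
  by apply: approxZ; apply: approx_sum => k _; have [] := gP k.
move=> w Sw.
have [w' [w'w w'c]] := radial_shift c w t0 t2r.
have main := ln_circle_prod K0 r0 w'c.
have e1 : `|ln (Num.max r (nrm (w - c))) - ln (Num.max r (nrm (w' - c)))| <= e / 5.
  apply: le_trans (ln_lip r0 _ _) _; rewrite ?le_max ?lexx// ler_pdivrMr//.
  apply: (@le_trans _ _ t).
    apply: le_trans w'w; apply: le_trans (ler_dist_max _ _ _) _.
    have -> : w' - w = (w' - c) - (w - c) by ring.
    by rewrite distrC ler_dist_nrm.
  by rewrite /t mulrC ler_pM2r// -[e / 5]invf_div lef_pV2 ?posrE//; lra.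
pose A := [set k : 'I_K | (nrm (w - z k) < d)%R]%SET.
have bnd (k : 'I_K) : `|ln (nrm (w' - z k)) - g k w| <= (k \in A)%:R * 10 + 8 * t / d.
  have [_ /(_ _ Sw) [near far]] := gP k.
  rewrite inE; apply: smoothed_ln_error => //.
  apply: le_trans w'c _.
  have zr : nrm ((r%:C : C) * expi (2 * pi / N) ^+ k) = r.
    by rewrite nrmM nrmX nrm_expi expr1n mulr1 nrm_real gtr0_norm.
  by rewrite -{1}zr /z opprD addrA; exact: ler_dist_nrm.
have e3 : `|N^-1 * (\sum_(k < K) ln (nrm (w' - z k))) - N^-1 * \sum_(k < K) g k w| <= e / 5 + e / 5.
  rewrite -mulrBr -sumrB normrM gtr0_norm ?invr_gt0// ler_pdivrMl//.
  apply: le_trans (ler_norm_sum _ _ _) _.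
  apply: le_trans (ler_sum _ (fun k _ => bnd k)) _.
  rewrite big_split /= sumr_const card_ord -[_ *+ K]mulr_natl -/N mulrDr.
  apply: lerD; last by rewrite ler_pM2l.
  have -> : \sum_(k < K) (k \in A)%:R * 10 = #|A|%:R * 10 :> R.
    by rewrite -mulr_suml -natr_sum -sum1_card [in RHS]big_mkcond.
  have AL : #|A|%:R <= L%:R :> R by rewrite ler_nat; exact: Hd.
  have NJ : N = J%:R * L%:R by rewrite /N natrM.
  have : 50 <= e * J%:R by rewrite -ler_pdivrMl// mulrC ltW.
  have L0 : 0 <= L%:R :> R by [].
  rewrite NJ; nra.
have -> : ln (Num.max r (nrm (w - c))) - N^-1 * (\sum_(k < K) g k w) =
  (ln (Num.max r (nrm (w - c))) - ln (Num.max r (nrm (w' - c))))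
  - (N^-1 * (\sum_(k < K) ln (nrm (w' - z k))) - ln (Num.max r (nrm (w' - c))))
  + (N^-1 * (\sum_(k < K) ln (nrm (w' - z k))) - N^-1 * \sum_(k < K) g k w) by ring.
apply: le_trans (ler_normD _ _) _; apply: le_trans (lerD (ler_normB _ _) (lexx _)) _.
have := le_trans main lnN; lra.
Qed.

(** The potentials of two concentric circles agree outside both and are constant inside both, so
    their difference is a compactly supported plateau of height ln 2. *)
Definition bump (c : C) (r : R) (w : C) :=
  ln (Num.max (2 * r) (nrm (w - c))) - ln (Num.max r (nrm (w - c))).

Lemma approx_bump c r : 0 < r -> approx (bump c r).
Proof.
by move=> r0; apply: approxB; apply: approx_circle_potential => //; rewrite mulr_gt0.
Qed.

Lemma ccont_bump c r : 0 < r -> ccont (bump c r).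
Proof.
move=> r0; apply: ccontB; apply: ccont_ln_max => //; rewrite ?mulr_gt0//; exact: ccont_nrm.
Qed.

Lemma bump_out c r w : 0 < r -> 2 * r <= nrm (w - c) -> bump c r w = 0.
Proof.
move=> r0 H; rewrite /bump !max_r ?subrr//; lra.
Qed.

Lemma bump_in c r w : 0 < r -> nrm (w - c) <= r -> bump c r w = ln 2.
Proof.
move=> r0 H; rewrite /bump !max_l; try lra.
by rewrite lnM ?posrE// addrK.
Qed.

Lemma bump_ge0 c r w : 0 < r -> 0 <= bump c r w.
Proof.
move=> r0; rewrite subr_ge0 ler_ln ?posrE ?lt_max ?r0 ?mulr_gt0//.
by rewrite ge_max !le_max lexx orbT andbT; apply/orP; left; lra.
Qed.

Lemma bump_le c r w : 0 < r -> bump c r w <= ln 2.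
Proof.
move=> r0; rewrite lerBlDr -lnM ?posrE// ?lt_max ?r0//.
rewrite ler_ln ?posrE ?lt_max ?r0 ?mulr_gt0 ?lt_max ?r0//.
rewrite maxr_pMr// ge_max !le_max lexx /=; apply/orP; right.
by have := nrm_ge0 (w - c); lra.
Qed.

Lemma lattice_near_card n (x : R) : (#|[set i : 'I_n | (`|x - i%:R| < 4)%R]%SET| <= 9)%N.
Proof.
rewrite -[9%N]card_ord; apply: (@leq_card_in _ _ (fun i : 'I_n => (inord (i %% 9) : 'I_9))).
move=> i j; rewrite !inE !ltr_norml => /andP[i1 i2] /andP[j1 j2] /(congr1 val) /=.
rewrite !inordK ?ltn_pmod// => E; apply/val_inj => /=.
have ij : (i < j + 8)%N by rewrite -(ltr_nat R) natrD; lra.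
have ji : (j < i + 8)%N by rewrite -(ltr_nat R) natrD; lra.
lia.
Qed.

(** A crude partition of unity over a square grid. At most 9 * 9 bumps are nonzero at a point, so
    dividing by 81 ln 2 keeps the total weight [th] at most 1; some bump is full, so [th] is at
    least 1/81. The error is at most B * 80/81 + B/162 = B * 161/162. *)
Lemma approx_contraction (h : C -> R) (B : R) : ccont h -> 0 < B -> (forall w, `|h w| <= B) ->
  exists g, [/\ ccont g, approx g & forall w, nrm w <= M -> `|h w - g w| <= (161 / 162) * B].
Proof.
move=> ch B0 hB.
have [|d d0 Hd] := @ccont_unif R M h (B / 162) ch; first by rewrite divr_gt0.
(* Bumps have plateau radius 2 eta, enough to reach the nearest grid point with both coordinates off
   by eta, and support radius 4 eta < d, within the modulus of continuity. *)
pose eta := d / 5; have eta0 : 0 < eta by rewrite divr_gt0.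
have eta2 : 0 < 2 * eta by rewrite mulr_gt0.
have [K HK] := exists_natr_gt (`|M| / eta).
set n := (2 * K.+1)%N.
pose ctr (i : 'I_n * 'I_n) : C :=
  (eta * (i.1%:R - K.+1%:R)) +i* (eta * (i.2%:R - K.+1%:R)).
have ln20 : 0 < ln (2 : R) by rewrite ln_gt0// ltr1n.
have c0 : 0 < 81 * ln (2 : R) by rewrite mulr_gt0.
pose g w := \sum_i (h (ctr i) / (81 * ln 2)) * bump (ctr i) (2 * eta) w.
exists g; split.
- by apply: ccont_sum => i _; apply: ccontZ; exact: ccont_bump.
- by apply: approx_sum => i _; apply: approxZ; exact: approx_bump.
move=> w wM.
pose th := (\sum_i bump (ctr i) (2 * eta) w) / (81 * ln 2).
pose x := complex.Re w / eta + K.+1%:R; pose y := complex.Im w / eta + K.+1%:R.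
have ReE i : complex.Re (w - ctr i) = eta * (x - i.1%:R).
  by rewrite cReB /= /x; field; rewrite gt_eqF.
have ImE i : complex.Im (w - ctr i) = eta * (y - i.2%:R).
  by rewrite cImB /= /y; field; rewrite gt_eqF.
have th1 : th <= 1.
  rewrite ler_pdivrMr// mul1r.
  pose X := [set i : 'I_n | (`|x - i%:R| < 4)%R]%SET.
  pose Y := [set i : 'I_n | (`|y - i%:R| < 4)%R]%SET.
  apply: (@le_trans _ _ (\sum_i ((i \in finset.setX X Y)%:R * ln 2))).
    apply: ler_sum => -[i j] _; have [iXY|niXY] := boolP (_ \in _).
      by rewrite mul1r bump_le.
    rewrite mul0r bump_out//; move: niXY; rewrite finset.in_setX !inE negb_and -!leNgt.
    move=> /orP[H|H].
      apply: le_trans (ler_Re _); rewrite ReE normrM gtr0_norm//; nra.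
    apply: le_trans (ler_Im _); rewrite ImE normrM gtr0_norm//; nra.
  rewrite -mulr_suml ler_pM2r// -natr_sum.
  have -> : (\sum_i (i \in finset.setX X Y))%N = (#|X| * #|Y|)%N.
    by rewrite -finset.cardsX -sum1_card [in RHS]big_mkcond.
  by rewrite ler_nat (leq_mul (lattice_near_card _ _) (lattice_near_card _ _)).
have th0 : 1 / 81 <= th.
  have Kx (a : R) : `|a| <= M -> exists i : 'I_n, `|a / eta + K.+1%:R - i%:R| <= 1.
    move=> aM.
    have aK : `|a / eta| < K.+1%:R.
      apply: le_lt_trans HK; rewrite normrM (gtr0_norm (_ : 0 < eta^-1)) ?invr_gt0//.
      by rewrite ler_pM2r ?invr_gt0// (le_trans aM) ?ler_norm.
    move: aK; rewrite ltr_norml => /andP[a1 a2].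
    have [|t0 t1] := andP (@truncn_itv R (a / eta + K.+1%:R) _); first by lra.
    have tn : (Num.truncn (a / eta + K.+1%:R) < n)%N.
      by rewrite -(ltr_nat R); apply: le_lt_trans t0 _; rewrite /n natrM mulr_natl mulr2n ltrD2r.
    exists (Ordinal tn) => /=; move: t0 t1; rewrite -[(Num.truncn _).+1%:R]natr1.
    by move: (a / eta + _) (_%:R) => u v u1 u2; rewrite ler_norml; lra.
  have [i Hi] := Kx _ (le_trans (ler_Re w) wM).
  have [j Hj] := Kx _ (le_trans (ler_Im w) wM).
  rewrite ler_pdivlMr//.
  have -> : 1 / 81 * (81 * ln (2 : R)) = ln 2 by field.
  rewrite (bigD1 (i, j))//= bump_in//; first by rewrite lerDl sumr_ge0// => *; exact: bump_ge0.
  apply: le_trans (ler_nrm_ReIm _) _; rewrite ReE ImE (normrM eta) (normrM eta) (gtr0_norm eta0) /=.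
  move: Hi Hj; rewrite -/x -/y.
  move: `|x - i%:R| `|y - j%:R| => u v Hu Hv; nra.
have -> : h w - g w = h w * (1 - th) +
    \sum_i ((h w - h (ctr i)) * (bump (ctr i) (2 * eta) w / (81 * ln 2))).
  rewrite /g mulrBr mulr1 -addrA; congr (_ + _).
  under [in RHS]eq_bigr do rewrite mulrBl.
  rewrite sumrB -mulr_sumr -mulr_suml -/th addKr; congr (- _).
  by apply: eq_bigr => i _; rewrite mulrAC -mulrA.
apply: le_trans (ler_normD _ _) _.
have b1 : `|h w * (1 - th)| <= B * (80 / 81).
  rewrite normrM ler_pM//; rewrite ger0_norm; lra.
have b2 : `|\sum_i ((h w - h (ctr i)) * (bump (ctr i) (2 * eta) w / (81 * ln 2)))| <= B / 162 * th.
  apply: le_trans (ler_norm_sum _ _ _) _.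
  rewrite /th mulr_suml mulr_sumr; apply: ler_sum => i _.
  have [H|H] := leP (2 * (2 * eta)) (nrm (w - ctr i)).
    by rewrite bump_out// mul0r !mulr0 normr0.
  rewrite normrM (ger0_norm (_ : 0 <= bump _ _ _ / _)); last first.
    by rewrite divr_ge0 ?bump_ge0// ltW.
  rewrite ler_wpM2r ?divr_ge0 ?bump_ge0 ?(ltW c0)// distrC ltW// Hd//.
  by rewrite nrmBC; move: H; rewrite /eta; lra.
have : B / 162 * th <= B / 162 by rewrite ler_piMr// divr_ge0// ltW.
lra.
Qed.

(** Iteration of the contraction on the residual. The residual is bounded only on the disc of radius
    [M], whereas the contraction wants a global bound, so it is clamped first; on the disc clamping
    changes nothing. *)
Theorem lavrentiev (f : C -> R) : ccont f -> approx f.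
Proof.
move=> cf; have [B B0 HB] := ccont_bounded M cf.
have clamp_cont (b : R) k : ccont k -> ccont (fun w => Num.max (- b) (Num.min b (k w))).
  by move=> ck; apply: ccont_max; exact: ccont_min.
have clamp_le (b x : R) : 0 < b -> `|Num.max (- b) (Num.min b x)| <= b.
  move=> b0; rewrite ler_norml le_max lexx /= ge_max; apply/andP; split; first by lra.
  by rewrite ge_min lexx.
have clamp_id (b x : R) : `|x| <= b -> Num.max (- b) (Num.min b x) = x.
  rewrite ler_norml => /andP[bx xb]; rewrite min_r// max_r//.
pose q : R := 161 / 162.
have it n : exists g, [/\ ccont g, approx g & forall w, nrm w <= M -> `|f w - g w| <= q ^+ n * B].
  elim: n => [|n [g [cg ag Hg]]].
    exists (fun=> 0); split; [exact: ccont_cst|exact: approx_cst|].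
    by move=> w wM; rewrite subr0 expr0 mul1r HB.
  have b0 : 0 < q ^+ n * B by rewrite mulr_gt0// exprn_gt0// /q; lra.
  have ck := clamp_cont (q ^+ n * B) _ (ccontB cf cg).
  have [g' [cg' ag' Hg']] := approx_contraction ck b0 (fun w => clamp_le _ _ b0).
  exists (fun w => g w + g' w); split; [exact: ccontD|exact: approxD|].
  move=> w wM; have := Hg' w wM; rewrite clamp_id ?Hg//.
  by rewrite exprS -/q mulrA opprD addrA.
apply: approx_lim => e e0.
have [|n Hn] := @exists_expr_lt R q (e / B) _ (divr_gt0 e0 B0); first by rewrite /q; lra.
have [g [cg ag Hg]] := it n; exists g => // w /S_bounded wM.
apply: le_trans (Hg w wM) _; rewrite -ler_pdivlMr//; exact: ltW.
Qed.

End Lavrentiev.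

(** * From convergence on polynomials to convergence on continuous functions *)

Section PositiveFunctionals.
Variables (R : realType) (I : Type) (F : set_system I).
Context {FF : Filter F}.
Local Notation C := (Cx R).
Implicit Types (f g h : C -> R).

(** Stated for an arbitrary filter, so that ordinary sequences and multi-indices are treated
    alike. *)
Definition tends0 (a : I -> R) := forall e : R, 0 < e -> \forall n \near F, `|a n| <= e.

Lemma tends0_le (a b : I -> R) : (forall n, `|a n| <= b n) -> tends0 b -> tends0 a.
Proof.
move=> ab tb e /tb; apply: filterS => n; apply: le_trans.
exact: le_trans (ab n) (ler_norm _).
Qed.

Lemma tends0D (a b : I -> R) : tends0 a -> tends0 b -> tends0 (fun n => a n + b n).
Proof.
move=> ta tb e e0; have e2 : 0 < e / 2 by rewrite divr_gt0.
apply: filterS2 (ta _ e2) (tb _ e2) => n Ha Hb.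
by rewrite (splitr e); apply: le_trans (ler_normD _ _) (lerD Ha Hb).
Qed.

Lemma tends0Z (k : R) (a : I -> R) : tends0 a -> tends0 (fun n => k * a n).
Proof.
move=> ta e e0; have k1 : 0 < `|k| + 1 by rewrite ltr_pwDr.
have := ta (e / (`|k| + 1)); rewrite divr_gt0// => /(_ isT); apply: filterS => n.
rewrite ler_pdivlMr// normrM mulrC => H; apply: le_trans H.
by rewrite ler_wpM2r// lerDl.
Qed.

Lemma tends0_cst0 : tends0 (fun=> 0).
Proof. by move=> e e0; apply: nearW => n; rewrite normr0 ltW. Qed.

Lemma tends0_sum (T : Type) (r : seq T) (P : pred T) (a : T -> I -> R) :
  (forall i, P i -> tends0 (a i)) -> tends0 (fun n => \sum_(i <- r | P i) a i n).
Proof.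
move=> ta; elim: r => [|i r IH].
  by apply: tends0_le tends0_cst0 => n; rewrite big_nil normr0.
case Pi : (P i).
  have := tends0D (ta _ Pi) IH; rewrite (_ : (fun n => _) = (fun n => \sum_(j <- i :: r | P j) a j n))//.
  by apply/funext => n; rewrite big_cons Pi.
by move: IH; rewrite (_ : (fun n => _) = (fun n => \sum_(j <- i :: r | P j) a j n))//;
  apply/funext => n; rewrite big_cons Pi.
Qed.

(** An average over eigenvalues in the disc of radius [M]. [pos_one] is an inequality because an
    average over no eigenvalues is 0. *)
Record positive_on (M : R) (Phi : (C -> R) -> R) : Prop := PositiveOn {
  pos_add : forall f g, ccont f -> ccont g -> Phi (fun w => f w + g w) = Phi f + Phi g;
  pos_scale : forall a f, ccont f -> Phi (fun w => a * f w) = a * Phi f;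
  pos_ge0 : forall f, ccont f -> (forall w, nrm w <= M -> 0 <= f w) -> 0 <= Phi f;
  pos_one : Phi (fun=> 1) <= 1 }.

Section PositiveOn.
Variables (M : R) (Phi : (C -> R) -> R) (posPhi : positive_on M Phi).

Lemma pos_sub f g : ccont f -> ccont g -> Phi (fun w => f w - g w) = Phi f - Phi g.
Proof.
move=> cf cg; rewrite -mulN1r -(pos_scale posPhi)// -(pos_add posPhi)//.
  by congr Phi; apply/funext => w; rewrite mulN1r.
exact: ccontZ.
Qed.

Lemma pos_le f g : ccont f -> ccont g -> (forall w, nrm w <= M -> f w <= g w) -> Phi f <= Phi g.
Proof.
move=> cf cg fg; rewrite -subr_ge0 -pos_sub//; apply: (pos_ge0 posPhi).
  exact: ccontB.
by move=> w wM; rewrite subr_ge0 fg.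
Qed.

Lemma pos_cst0 : Phi (fun=> 0) = 0.
Proof.
by have := pos_scale posPhi 0 (ccont_cst 0); rewrite !mul0r.
Qed.

Lemma pos_cst (a : R) : 0 <= a -> Phi (fun=> a) <= a.
Proof.
move=> a0; have := pos_scale posPhi a (ccont_cst 1).
rewrite mulr1 => ->; have := pos_one posPhi; nra.
Qed.

Lemma pos_sum (T : Type) (r : seq T) (P : pred T) (G : T -> C -> R) : (forall i, ccont (G i)) ->
  Phi (fun w => \sum_(i <- r | P i) G i w) = \sum_(i <- r | P i) Phi (G i).
Proof.
move=> cG; elim: r => [|i r IH].
  by rewrite big_nil -[RHS]pos_cst0; congr Phi; apply/funext => w; rewrite big_nil.
rewrite big_cons; case Pi : (P i); rewrite -IH.
  rewrite -(pos_add posPhi)//; last exact: ccont_sum.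
  by congr Phi; apply/funext => w; rewrite big_cons Pi.
by congr Phi; apply/funext => w; rewrite big_cons Pi.
Qed.

End PositiveOn.

Definition locally_null (xi : I -> (C -> R) -> R) (z : C) :=
  exists2 r : R, 0 < r & forall f, ccont f -> (forall w, 0 <= f w <= 1) ->
    (forall w, r <= nrm (w - z) -> f w = 0) -> tends0 (fun n => xi n f).

Definition hat (z : C) (r : R) (w : C) : R :=
  Num.max 0 (Num.min 1 (2 - 2 / r * nrm (w - z))).

Lemma ccont_hat z r : ccont (hat z r).
Proof.
apply: ccont_max; apply: ccont_min; apply: ccontB; first exact: ccont_cst.
by apply: ccontZ; exact: ccont_nrm.
Qed.

Lemma hat_bounds z r w : 0 <= hat z r w <= 1.
Proof. by rewrite /hat le_max lexx ge_max ler01 ge_min lexx. Qed.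

Lemma hat_out z r w : 0 < r -> r <= nrm (w - z) -> hat z r w = 0.
Proof.
move=> r0 H; apply: max_l; rewrite ge_min; apply/orP; right.
by rewrite subr_le0 -mulrA ler_peMr// ler_pdivlMl// mulr1.
Qed.

Lemma hat_in z r w : 0 < r -> nrm (w - z) <= r / 2 -> hat z r w = 1.
Proof.
move=> r0 H; rewrite /hat min_l ?max_r//.
by rewrite lerBrDl -lerBrDr mulrAC ler_pdivrMr//; lra.
Qed.

(** Finitely many balls cover the disc. On balls centered in [S] continuity keeps |h| below 2e; the
    other balls carry hats of vanishing mass. Hence |h| <= 2e + H with [xi n H] tending to 0. *)
Lemma small_on_support (S : set C) (M : R) (xi : I -> (C -> R) -> R) h e :
  (forall n, positive_on M (xi n)) -> (forall z, ~ S z -> locally_null xi z) ->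
  ccont h -> 0 < e -> (forall w, S w -> `|h w| <= e) ->
  \forall n \near F, `|xi n h| <= 3 * e.
Proof.
move=> pxi nxi ch e0 hS.
have ch' z : exists r : R * R, [/\ 0 < r.1, 0 < r.2 & (forall w, nrm (w - z) < r.1 -> `|h w - h z| < Num.min 1 e) /\
    (~ S z -> forall f, ccont f -> (forall w, 0 <= f w <= 1) ->
    (forall w, r.2 <= nrm (w - z) -> f w = 0) -> tends0 (fun n => xi n f))].
  have [|r r0 Hr] := ch z (Num.min 1 e); first by rewrite lt_min ltr01.
  have [Sz|nSz] := pselect (S z); first by exists (r, r).
  by have [r' r'0 Hr'] := nxi z nSz; exists (r, r').
pose rr z := sval (cid (ch' z)).
have rrP z : [/\ 0 < (rr z).1, 0 < (rr z).2 & (forall w, nrm (w - z) < (rr z).1 -> `|h w - h z| < Num.min 1 e) /\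
    (~ S z -> forall f, ccont f -> (forall w, 0 <= f w <= 1) ->
    (forall w, (rr z).2 <= nrm (w - z) -> f w = 0) -> tends0 (fun n => xi n f))].
  by rewrite /rr; case: cid.
(* The first radius controls the oscillation of [h]; the second makes the mass vanish, and it is
   halved because [hat] equals 1 only on half of its support. *)
pose g z := Num.min (rr z).1 ((rr z).2 / 2).
have [z|zs Hzs] := @gauge_cover R M g.
  by have [a b _] := rrP z; rewrite lt_min a divr_gt0.
pose b z := `|h z| + 1.
pose H w := \sum_(z <- zs | ~~ `[< S z >]) b z * hat z (rr z).2 w.
have cH : ccont H by apply: ccont_sum => z _; apply: ccontZ; exact: ccont_hat.
have b0 z : 0 < b z by rewrite ltr_pwDr.
have H0 w : 0 <= H w.
  by apply: sumr_ge0 => z _; rewrite mulr_ge0 ?(ltW (b0 z))//; case/andP: (hat_bounds z (rr z).2 w).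
have hH w : nrm w <= M -> `|h w| <= 2 * e + H w.
  move=> /Hzs[z zzs]; rewrite lt_min => /andP[w1 w2].
  have [r1 r2 [Hh _]] := rrP z; have := Hh w w1; rewrite lt_min => /andP[h1 h2].
  have tri : `|h w| <= `|h z| + `|h w - h z|.
    by rewrite -{1}[h w](subrK (h z)) addrC ler_normD.
  have [Sz|nSz] := pselect (S z).
    by have := hS z Sz; have := H0 w; lra.
  apply: (@le_trans _ _ (b z)); first by rewrite /b; lra.
  rewrite ler_wpDl//; first by rewrite mulr_ge0// ltW.
  rewrite /H (big_rem z)//= asboolF// hat_in ?mulr1 ?(ltW w2)//.
  rewrite lerDl; apply: sumr_ge0 => u _; rewrite mulr_ge0 ?(ltW (b0 u))//.
  by case/andP: (hat_bounds u (rr u).2 w).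
have tH : tends0 (fun n => \sum_(z <- zs | ~~ `[< S z >]) (b z * xi n (hat z (rr z).2))).
  apply: tends0_sum => z /asboolPn nSz; apply: tends0Z.
  have [r1 r2 [_ /(_ nSz)]] := rrP z; apply; first exact: ccont_hat.
    by move=> w; exact: hat_bounds.
  by move=> w; exact: hat_out.
have c2 : ccont (fun w => 2 * e + H w) by apply: ccontD => //; exact: ccont_cst.
apply: filterS (tH e e0) => n.
have -> : \sum_(z <- zs | ~~ `[< S z >]) b z * xi n (hat z (rr z).2) = xi n H.
  rewrite (pos_sum (pxi n)); last by move=> z; apply: ccontZ; exact: ccont_hat.
  by apply: eq_bigr => z _; rewrite (pos_scale (pxi n))//; exact: ccont_hat.
move=> /(le_trans (ler_norm _)) xH.
have up : xi n (fun w => 2 * e + H w) <= 3 * e.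
  rewrite (pos_add (pxi n))//; last exact: ccont_cst.
  by have := pos_cst (pxi n) (_ : 0 <= 2 * e); lra.
have u1 := @pos_le _ _ (pxi n) _ _ ch c2 (fun w wM => le_trans (ler_norm _) (hH w wM)).
have u2 := @pos_le _ _ (pxi n) _ _ (ccontZ (-1) ch) c2
  (fun w wM => le_trans (le_trans (ler_norm _) (eq_ind _ (fun x => x <= `|h w|) (lexx _) _ (esym (etrans (congr1 _ (mulN1r _)) (normrN _))))) (hH w wM)).
rewrite (pos_scale (pxi n))// mulN1r in u2.
rewrite ler_norml; apply/andP; split; lra.
Qed.

Theorem functional_convergence (S : set C) (M : R) (xi : I -> (C -> R) -> R) (mu : (C -> R) -> R) :
  (forall w, S w -> nrm w <= M) ->
  (forall z, ~ S z -> exists2 r : R, 0 < r & forall w, S w -> r <= nrm (w - z)) ->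
  (forall z (r : R), 0 < r -> exists2 w, ~ S w & nrm (w - z) < r) ->
  connected (~` S) ->
  (forall n, positive_on M (xi n)) -> positive_on M mu ->
  (forall z, ~ S z -> locally_null xi z) ->
  (forall z, ~ S z -> locally_null (fun=> mu) z) ->
  (forall P : {poly C}, tends0 (fun n => xi n (fun w => complex.Re P.[w]) - mu (fun w => complex.Re P.[w]))) ->
  forall f, ccont f -> tends0 (fun n => xi n f - mu f).
Proof.
move=> Sb Scl Sint Scon pxi pmu nxi nmu mom f cf e e0.
(* The remainder h = f - Re P costs 3d under each of the two functionals, and the moments cost d. *)
pose d := e / 7; have d0 : 0 < d by rewrite divr_gt0.
have [P HP] := lavrentiev Sb Scl Sint Scon cf d0.
have [cP _] := ccont_poly_ReIm P.
have ch := ccontB cf cP.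
have s1 := small_on_support pxi nxi ch d0 HP.
have s2 := small_on_support (fun=> pmu) nmu ch d0 HP.
apply: filterS3 s1 s2 (mom P _ d0) => n.
rewrite (pos_sub (pxi n))// (pos_sub pmu)// !ler_norml /d; lra.
Qed.

End PositiveFunctionals.

(** * Integration on the torus *)

Section TorusMeasure.
Variable R : realType.

Lemma pi_lt : - pi < (pi : R).
Proof. by have := pi_gt0 R; lra. Qed.

Local Notation G := (measurableTypeR R).

Definition circle_prob : probability G R := uniform_prob pi_lt.

Definition tuple_cons n (xt : G * n.-tuple R) : n.+1.-tuple R := [tuple of xt.1 :: xt.2].

Lemma measurable_idG : measurable_fun setT (fun x : G => x : R).
Proof. by move=> _ A mA; rewrite setTI. Qed.

Lemma measurable_tuple_cons n : measurable_fun setT (@tuple_cons n).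
Proof.
apply: (@measurable_cons _ _ _ _ (fun xt : G * n.-tuple R => xt.1 : R)) => //.
exact: (measurableT_comp measurable_idG).
Qed.

HB.instance Definition _ n := isMeasurableFun.Build _ _ _ _ _ (@measurable_tuple_cons n).

(** Normalized Lebesgue measure on the torus, built by the same recursion on coordinates as [iint],
    so that Fubini matches them one coordinate at a time. *)
Fixpoint torus_prob n : probability (n.-tuple R) R :=
  match n with
  | 0 => dirac [tuple]
  | n'.+1 => distribution (circle_prob \x torus_prob n')%E (@tuple_cons n')
  end.

Definition torus_int n (f : n.-tuple R -> R) : R := Rintegral (torus_prob n) setT f.

(** Boundedness holds everywhere, not merely almost everywhere; essentially bounded symbols are
    replaced by truncations before they enter. *)
Definition bmf n (f : n.-tuple R -> R) :=
  measurable_fun setT f /\ exists B, forall t, `|f t| <= B.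

Section Integration.
Variable n : nat.
Implicit Types (f g : n.-tuple R -> R).

Lemma bmf_integrable f : bmf f -> (torus_prob n).-integrable setT (EFin \o f).
Proof.
move=> [mf [B hB]]; apply: measurable_bounded_integrable => //.
  by apply: (@le_lt_trans _ _ 1%E); [exact: probability_le1|exact: ltry].
exists B; split; first exact: num_real.
by move=> x Bx t _ /=; rewrite (le_trans (hB t))// ltW.
Qed.

Lemma bmf_cst a : bmf (fun _ : n.-tuple R => a).
Proof. by split; [exact: measurable_cst|exists `|a|]. Qed.

Lemma bmfD f g : bmf f -> bmf g -> bmf (fun t => f t + g t).
Proof.
move=> [mf [B hB]] [mg [B' hB']]; split; first exact: measurable_funD.
by exists (B + B') => t; apply: le_trans (ler_normD _ _) (lerD _ _).
Qed.

Lemma bmfM f g : bmf f -> bmf g -> bmf (fun t => f t * g t).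
Proof.
move=> [mf [B hB]] [mg [B' hB']]; split; first exact: measurable_funM.
by exists (B * B') => t; rewrite normrM ler_pM.
Qed.

Lemma bmfZ a f : bmf f -> bmf (fun t => a * f t).
Proof. exact/bmfM/bmf_cst. Qed.

Lemma bmfN f : bmf f -> bmf (fun t => - f t).
Proof. by move=> /(bmfZ (-1)); rewrite (_ : (fun t => _) = (fun t => - f t))//; apply/funext => t; rewrite mulN1r. Qed.

Lemma bmfB f g : bmf f -> bmf g -> bmf (fun t => f t - g t).
Proof. by move=> bf bg; apply: bmfD => //; exact: bmfN. Qed.

Lemma bmf_sum (T : Type) (r : seq T) (P : pred T) (h : T -> n.-tuple R -> R) :
  (forall i, P i -> bmf (h i)) -> bmf (fun t => \sum_(i <- r | P i) h i t).
Proof.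
move=> bh; elim: r => [|i r IH].
  by rewrite (_ : (fun t => _) = fun=> 0); [exact: bmf_cst|apply/funext => t; rewrite big_nil].
case Pi : (P i); last first.
  by rewrite (_ : (fun t => _) = (fun t => \sum_(i <- r | P i) h i t))//; apply/funext => t; rewrite big_cons Pi.
rewrite (_ : (fun t => _) = (fun t => h i t + \sum_(i <- r | P i) h i t)).
  by apply: bmfD => //; exact: bh.
by apply/funext => t; rewrite big_cons Pi.
Qed.

Lemma torus_int_cst a : torus_int (fun _ : n.-tuple R => a) = a.
Proof.
rewrite /torus_int Rintegral_cst//.
have -> : fine (torus_prob n setT) = 1 by have /(congr1 fine) := @probability_setT _ _ _ (torus_prob n).
by rewrite mulr1.
Qed.

Lemma torus_intD f g : bmf f -> bmf g -> torus_int (fun t => f t + g t) = torus_int f + torus_int g.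
Proof. by move=> bf bg; rewrite /torus_int RintegralD//; exact: bmf_integrable. Qed.

Lemma torus_intZ a f : bmf f -> torus_int (fun t => a * f t) = a * torus_int f.
Proof. by move=> bf; rewrite /torus_int RintegralZl//; exact: bmf_integrable. Qed.

Lemma torus_intB f g : bmf f -> bmf g -> torus_int (fun t => f t - g t) = torus_int f - torus_int g.
Proof. by move=> bf bg; rewrite /torus_int RintegralB//; exact: bmf_integrable. Qed.

Lemma torus_int_sum (T : Type) (r : seq T) (P : pred T) (h : T -> n.-tuple R -> R) :
  (forall i, P i -> bmf (h i)) ->
  torus_int (fun t => \sum_(i <- r | P i) h i t) = \sum_(i <- r | P i) torus_int (h i).
Proof.
move=> bh; elim: r => [|i r IH].
  rewrite big_nil (_ : (fun t => _) = fun=> 0); first exact: torus_int_cst.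
  by apply/funext => t; rewrite big_nil.
rewrite big_cons; case Pi : (P i); last first.
  rewrite -IH; congr torus_int; apply/funext => t; by rewrite big_cons Pi.
rewrite -IH -torus_intD//; [|exact: bh|exact: bmf_sum].
by congr torus_int; apply/funext => t; rewrite big_cons Pi.
Qed.

Lemma torus_int_ge0 f : (forall t, 0 <= f t) -> 0 <= torus_int f.
Proof. by move=> f0; apply: Rintegral_ge0. Qed.

Lemma torus_int_le f g : bmf f -> bmf g -> (forall t, f t <= g t) -> torus_int f <= torus_int g.
Proof. by move=> bf bg fg; apply: le_Rintegral => //; exact: bmf_integrable. Qed.

Lemma ae_eq_torus_int f g : bmf f -> bmf g -> {ae torus_prob n, forall t, f t = g t} ->
  torus_int f = torus_int g.
Proof.
move=> [mf _] [mg _] fg; congr fine; apply: ae_eq_integral => //.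
- exact/measurable_EFinP.
- exact/measurable_EFinP.
- by apply: filterS fg => t /= -> _.
Qed.

Lemma bounded_convergence (u : nat -> n.-tuple R -> R) f B :
  (forall k, measurable_fun setT (u k)) -> (forall k t, `|u k t| <= B) ->
  measurable_fun setT f ->
  {ae torus_prob n, forall t, u k t @[k --> \oo] --> f t} ->
  torus_int (u k) @[k --> \oo] --> torus_int f.
Proof.
move=> mu uB mf uf.
have [] := @dominated_convergence _ _ _ (torus_prob n) setT measurableT
   (fun k => EFin \o u k) (EFin \o f) (fun=> B%:E).
- by move=> k; exact/measurable_EFinP.
- exact/measurable_EFinP.
- by apply: filterS uf => t /= H _; apply: cvg_EFin => //; exact: nearW.
- by apply: bmf_integrable; exact: bmf_cst.
- by apply: aeW => t k _ /=; rewrite lee_fin.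
move=> intf _ H; apply: fine_cvg; rewrite fineK//.
exact: integrable_fin_num.
Qed.

End Integration.

End TorusMeasure.

Section CircleIntegral.
Variable R : realType.
Local Notation G := (measurableTypeR R).
Local Notation leb := (@lebesgue_measure R).

Definition circle_int (f : G -> R) : R := Rintegral (circle_prob R) setT f.

Definition bm1 (f : G -> R) := measurable_fun setT f /\ exists B, forall x, `|f x| <= B.

Lemma bm1_integrable f : bm1 f -> (circle_prob R).-integrable setT (EFin \o f).
Proof.
move=> [mf [B hB]]; apply: measurable_bounded_integrable => //.
  by apply: (@le_lt_trans _ _ 1%E); [exact: probability_le1|exact: ltry].
exists B; split; first exact: num_real.
by move=> x Bx t _ /=; rewrite (le_trans (hB t))// ltW.
Qed.

Let D := `[(- pi)%R, pi]%classic : set G.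

Lemma lebesgue_circle : leb D = (2 * pi)%:E.
Proof.
rewrite lebesgue_measure_itv/= lte_fin pi_lt -EFinD; congr (_%:E); ring.
Qed.

Lemma bm1_integrable_lebesgue f : bm1 f -> leb.-integrable D (EFin \o f).
Proof.
move=> [mf [B hB]]; apply: measurable_bounded_integrable => //.
- exact: measurable_itv.
- exact: (eq_ind_r (fun x => (x < +oo)%E) (ltry _) lebesgue_circle).
- exact: measurable_funTS.
exists B; split; first exact: num_real.
by move=> x Bx t _ /=; rewrite (le_trans (hB t))// ltW.
Qed.

Lemma circle_int_cst a : circle_int (fun=> a) = a.
Proof.
rewrite /circle_int Rintegral_cst//.
have -> : fine (circle_prob R setT) = 1 by have /(congr1 fine) := @probability_setT _ _ _ (circle_prob R).
by rewrite mulr1.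
Qed.

Lemma bm1_cst a : bm1 (fun=> a).
Proof. by split; [exact: measurable_cst|exists `|a|]. Qed.

Lemma circle_intE f : bm1 f -> Rintegral leb D f = 2 * pi * circle_int f.
Proof.
move=> bf; have [mf [B hB]] := bf.
have pi2 : 0 < 2 * pi :> R by rewrite mulr_gt0// pi_gt0.
(* The integral formula for the uniform law is applied to a nonnegative function, so [f] is raised
   by its bound. *)
pose g x := f x + B.
have bg : bm1 g.
  split; first by apply: measurable_funD => //; exact: measurable_cst.
  by exists (B + `|B|) => x; apply: le_trans (ler_normD _ _) (lerD _ _).
have g0 x : 0 <= g x by have := hB x; rewrite ler_norml /g; lra.
have E : circle_int g = (2 * pi)^-1 * Rintegral leb D g.
  rewrite /circle_int /Rintegral integral_uniform; last 2 first.
  - by apply/measurable_EFinP; case: bg.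
  - by move=> x; rewrite lee_fin.
  rewrite fineM//; last exact/integrable_fin_num/bm1_integrable_lebesgue.
  by congr (_^-1 * _); rewrite opprK; ring.
have E1 : circle_int g = circle_int f + B.
  rewrite /circle_int RintegralD//; [|exact: bm1_integrable|exact/bm1_integrable/bm1_cst].
  by congr (_ + _); exact: circle_int_cst.
have E2 : Rintegral leb D g = Rintegral leb D f + B * (2 * pi).
  rewrite RintegralD//; [|exact: measurable_itv|exact: bm1_integrable_lebesgue|exact/bm1_integrable_lebesgue/bm1_cst].
  congr (_ + _); rewrite Rintegral_cst//; last exact: measurable_itv.
  by congr (_ * _); exact: (congr1 fine lebesgue_circle).
move: E; rewrite E1 E2 => /(congr1 (fun x => 2 * pi * x)).
by rewrite mulrA divff ?gt_eqF// mul1r mulrDr [B * _]mulrC => /addIr.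
Qed.

Lemma circle_int_co f : bm1 f ->
  Rintegral leb [set x : R | - pi <= x < pi] f = 2 * pi * circle_int f.
Proof.
move=> bf; rewrite -circle_intE//.
have -> : [set x : R | - pi <= x < pi] = [set` Interval (BLeft (- pi)) (BLeft pi)].
  by apply/seteqP; split => x /=; rewrite in_itv.
rewrite Rintegral_itv_bndo_bndc//.
apply: integrableS (bm1_integrable_lebesgue bf) => //; first exact: measurable_itv.
by move=> x /=; rewrite !in_itv /= => /andP[a b]; apply/andP; split=> //; exact: ltW.
Qed.

Lemma circle_intN f : bm1 f -> circle_int (fun x => f (- x)) = circle_int f.
Proof.
move=> bf; have [mf [B hB]] := bf.
have pi2 : 0 < 2 * pi :> R by rewrite mulr_gt0// pi_gt0.
have mN : measurable_fun setT (fun x : G => - x : G) by exact: oppr_measurable.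
have bfN : bm1 (fun x => f (- x)).
  by split; [exact: measurableT_comp|exists B].
suff : Rintegral leb D (fun x => f (- x)) = Rintegral leb D f.
  by rewrite !circle_intE// => /(mulfI (lt0r_neq0 pi2)).
rewrite /Rintegral; congr fine.
have DN : D = (-%R : G -> G) @^-1` D.
  apply/seteqP; split => x; rewrite /D /preimage /= !in_itv /= => /andP[a b];
    apply/andP; split; (by rewrite lerN2) || (by rewrite lerNl) || (by rewrite -lerN2).
transitivity (\int[pushforward leb (-%R : G -> G)]_(y in D) (f y)%:E)%E.
  rewrite integral_pushforward//; first by rewrite -DN.
  - exact/measurable_EFinP.
  - by rewrite -DN; exact: bm1_integrable_lebesgue.
  - exact: measurable_itv.
by apply: eq_measure_integral => A mA _; exact: lebesgue_measureN.
Qed.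

Lemma bm1_trig (k : int) : bm1 (fun x => cos (k%:~R * x)) /\ bm1 (fun x => sin (k%:~R * x)).
Proof.
have mk : measurable_fun setT (fun x : G => k%:~R * x) by exact: measurable_funM.
split; split.
- by apply: measurableT_comp mk; apply: continuous_measurable_fun; exact: continuous_cos.
- by exists 1 => x; rewrite ler_norml cos_geN1 cos_le1.
- by apply: measurableT_comp mk; apply: continuous_measurable_fun; exact: continuous_sin.
- by exists 1 => x; rewrite ler_norml sin_geN1 sin_le1.
Qed.

Lemma circle_int_sin (k : int) : circle_int (fun x => sin (k%:~R * x)) = 0.
Proof.
have [_ bs] := bm1_trig k.
have := circle_intN bs.
have -> : circle_int (fun x => sin (k%:~R * - x)) = - circle_int (fun x => sin (k%:~R * x)).
  rewrite -mulN1r /circle_int -RintegralZl//; last exact: bm1_integrable.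
  by congr Rintegral; apply/funext => x; rewrite mulrN sinN mulN1r.
by move=> /eqP; rewrite eq_sym -subr_eq0 opprK -mulr2n mulrn_eq0 /= => /eqP.
Qed.

Lemma circle_int_cos (k : int) : circle_int (fun x => cos (k%:~R * x)) = (k == 0)%:R.
Proof.
have [->|k0] := eqVneq k 0.
  rewrite -[RHS](circle_int_cst 1); congr circle_int; apply/funext => x.
  by rewrite mul0r cos0.
have kR : k%:~R != 0 :> R by rewrite intr_eq0.
have [bc _] := bm1_trig k.
have pi2 : 0 < 2 * pi :> R by rewrite mulr_gt0// pi_gt0.
suff : Rintegral leb D (fun x => cos (k%:~R * x)) = 0.
  rewrite circle_intE// => /eqP; rewrite mulf_eq0 gt_eqF//= => /eqP ->//.
pose F := ((k%:~R)^-1 : R) \*: ((@sin R) \o ((k%:~R : R) \*: (@id R))).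
have dF (x : R) : is_derive x 1 F (cos (k%:~R * x)).
  apply: is_derive_eq.
  by rewrite /GRing.scale /= mulr1 mulrA mulrAC mulVf// mul1r.
have cF : continuous F by move=> x; apply: differentiable_continuous; apply/derivable1_diffP; case: (dF x).
rewrite /Rintegral (@continuous_FTC2 _ _ F)//; first last.
- by move=> x _; rewrite derive1E; case: (dF x) => _ ->.
- split.
  + by move=> x _; case: (dF x).
  + exact/cvg_at_right_filter/cF.
  + exact/cvg_at_left_filter/cF.
- apply: continuous_subspaceT => x; apply: continuous_comp; first exact: mulrl_continuous.
  exact: continuous_cos.
- exact: pi_lt.
rewrite -EFinB /= /F /GRing.scale /= /GRing.scale /= mulrN sinN.
have sin_nat n : sin (n%:R * pi) = 0 :> R.
  by elim: n => [|n IH]; rewrite ?mul0r ?sin0// -natr1 mulrDl mul1r sinDpi IH oppr0.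
have -> : sin (k%:~R * pi) = 0 :> R.
  case: (k) => n; first by rewrite -pmulrn sin_nat.
  by rewrite NegzE mulrNz mulNr sinN -pmulrn sin_nat oppr0.
by rewrite oppr0 mulr0 subrr.
Qed.

End CircleIntegral.

(** * Fubini on the torus and invariance under reflections *)

Section TorusRecursion.
Variable R : realType.
Local Notation G := (measurableTypeR R).

Lemma measurable_tuple_cons_section n (x : G) :
  measurable_fun setT (fun t : n.-tuple R => tuple_cons (x, t)).
Proof.
apply: (@measurable_cons _ _ _ _ (fun=> x : R)); [exact: measurable_cst|exact: measurable_id].
Qed.

Lemma bmf_section n (f : n.+1.-tuple R -> R) (x : G) : bmf f -> bmf (fun t => f (tuple_cons (x, t))).
Proof.
move=> [mf [B hB]]; split; last by exists B.
exact: (measurableT_comp mf (@measurable_tuple_cons_section n x)).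
Qed.

Lemma torus_int_cons n (f : n.+1.-tuple R -> R) : bmf f ->
  bm1 (fun x => torus_int (fun t => f (tuple_cons (x, t)))) /\
  torus_int f = circle_int (fun x => torus_int (fun t => f (tuple_cons (x, t)))).
Proof.
move=> bf; have [mf [B hB]] := bf.
pose h (xt : G * n.-tuple R) : \bar R := (f (tuple_cons xt))%:E.
have mh0 : measurable_fun setT (fun xt : G * n.-tuple R => f (tuple_cons xt)).
  exact: (measurableT_comp mf (@measurable_tuple_cons R n)).
have mh : measurable_fun setT h by exact/measurable_EFinP.
have ih : (circle_prob R \x torus_prob R n)%E.-integrable setT h.
  apply: measurable_bounded_integrable => //.
    by apply: (@le_lt_trans _ _ 1%E); [exact: probability_le1|exact: ltry].
  exists B; split; first exact: num_real.
  by move=> x Bx t _ /=; rewrite (le_trans (hB _))// ltW.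
have FE x : fubini_F (torus_prob R n) h x = (torus_int (fun t => f (tuple_cons (x, t))))%:E.
  rewrite /fubini_F /torus_int /Rintegral fineK//; apply: integrable_fin_num => //.
  by apply: bmf_integrable; exact: bmf_section.
split.
  split; last first.
    exists B => x; rewrite ler_norml; apply/andP; split.
      rewrite -[- B](torus_int_cst n); apply: torus_int_le; [exact: bmf_cst|exact: bmf_section|].
      by move=> t; have := hB (tuple_cons (x, t)); rewrite ler_norml => /andP[].
    rewrite -[B](torus_int_cst n); apply: torus_int_le; [exact: bmf_section|exact: bmf_cst|].
    by move=> t; have := hB (tuple_cons (x, t)); rewrite ler_norml => /andP[].
  apply/measurable_EFinP; rewrite (_ : EFin \o _ = fubini_F (torus_prob R n) h).
    by have := measurable_fubini_F ih.
  by apply/funext => x; rewrite FE.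
rewrite /torus_int /circle_int /Rintegral; congr fine.
transitivity (\int[circle_prob R \x torus_prob R n]_z h z)%E.
  rewrite (_ : torus_prob R n.+1 = distribution (circle_prob R \x torus_prob R n)%E (@tuple_cons R n))//.
  rewrite integral_distribution//; exact/measurable_EFinP.
rewrite -integral12_prod_meas1//; apply: eq_integral => x _.
by rewrite FE.
Qed.

Lemma iintE n (f : n.-tuple R -> R) : bmf f -> iint f = (2 * pi) ^+ n * torus_int f.
Proof.
elim: n f => [|n IH] f bf.
  rewrite /= mul1r /torus_int /Rintegral integral_dirac//=; last by case: bf => mf _; exact/measurable_EFinP.
  by rewrite indicE in_setT mul1r.
have [bg ->] := torus_int_cons bf.
have -> : iint f = Rintegral (@lebesgue_measure R) [set x : R | -pi <= x < pi]
    (fun x => (2 * pi) ^+ n * torus_int (fun t => f (tuple_cons (x, t)))).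
  rewrite /=; apply: eq_Rintegral => x _.
  by rewrite IH//; exact: bmf_section.
rewrite circle_int_co; last first.
  have [mg [B hB]] := bg; split; first exact: measurable_funM.
  by exists ((2 * pi) ^+ n * B) => x; rewrite normrM ler_pM// ger0_norm// exprn_ge0// mulr_ge0// pi_ge0.
rewrite /circle_int RintegralZl//; last exact: bm1_integrable.
by rewrite exprS mulrA.
Qed.

(** A common form for all reflections in the symbol: negation, [rS SL] and their composite. *)
Definition flip n (b : 'I_n -> bool) (t : n.-tuple R) : n.-tuple R :=
  [tuple (if b j then - tnth t j else tnth t j) | j < n].

Lemma flip_cons n (b : 'I_n.+1 -> bool) x (t : n.-tuple R) :
  flip b (tuple_cons (x, t)) =
  tuple_cons (if b ord0 then - x else x, flip (fun j => b (lift ord0 j)) t).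
Proof.
apply: eq_from_tnth => j; rewrite tnth_mktuple.
case: (unliftP ord0 j) => [i ->|->]; rewrite /tuple_cons /= ?tnth0//.
by rewrite !tnthS tnth_mktuple.
Qed.

Lemma measurable_flip n (b : 'I_n -> bool) : measurable_fun setT (flip b).
Proof.
apply/measurable_fun_tnthP => j.
rewrite (_ : _ \o _ = fun t => if b j then - tnth t j else tnth t j); last first.
  by apply/funext => t /=; rewrite tnth_mktuple.
case: (b j); last exact: measurable_tnth.
by apply: measurableT_comp => //; exact: measurable_tnth.
Qed.

Lemma bmf_flip n (b : 'I_n -> bool) (f : n.-tuple R -> R) : bmf f -> bmf (fun t => f (flip b t)).
Proof.
move=> [mf [B hB]]; split; last by exists B.
exact: (measurableT_comp mf (measurable_flip b)).
Qed.

Lemma torus_int_flip n (b : 'I_n -> bool) (f : n.-tuple R -> R) : bmf f ->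
  torus_int (fun t => f (flip b t)) = torus_int f.
Proof.
elim: n b f => [|n IH] b f bf.
  by congr torus_int; apply/funext => t; rewrite [flip b t]tuple0 [t]tuple0.
have [_ ->] := torus_int_cons (bmf_flip b bf).
have [bg ->] := torus_int_cons bf.
pose g x := torus_int (fun t => f (tuple_cons (x, t))).
transitivity (circle_int (fun x => g (if b ord0 then - x else x))).
  congr circle_int; apply/funext => x.
  under [X in torus_int X = _]eq_fun do rewrite flip_cons.
  by rewrite (IH (fun j => b (lift ord0 j)) (fun t => f (tuple_cons (_, t))))//; exact: bmf_section.
by case: (b ord0); [exact: circle_intN|].
Qed.

End TorusRecursion.

Section ComplexIntegral.
Variables (R : realType) (n : nat).
Local Notation C := (Cx R).
Local Notation T := (n.-tuple R).
Implicit Types (f g : T -> C).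

Definition cbmf f := bmf (fun t => complex.Re (f t)) /\ bmf (fun t => complex.Im (f t)).
Definition ctorus f : C := torus_int (fun t => complex.Re (f t)) +i* torus_int (fun t => complex.Im (f t)).

Lemma eq_bmf (f g : T -> R) : f =1 g -> bmf f -> bmf g.
Proof. by move=> /funext ->. Qed.

Lemma eq_cbmf f g : f =1 g -> cbmf f -> cbmf g.
Proof. by move=> /funext ->. Qed.

Lemma cbmf_cst c : cbmf (fun=> c).
Proof. by split; exact: bmf_cst. Qed.

Lemma cbmfD f g : cbmf f -> cbmf g -> cbmf (fun t => f t + g t).
Proof.
move=> [fr fi] [gr gi]; split.
  by apply: eq_bmf (bmfD fr gr) => t; rewrite cReD.
by apply: eq_bmf (bmfD fi gi) => t; rewrite cImD.
Qed.

Lemma cbmfM f g : cbmf f -> cbmf g -> cbmf (fun t => f t * g t).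
Proof.
move=> [fr fi] [gr gi]; split.
  by apply: eq_bmf (bmfB (bmfM fr gr) (bmfM fi gi)) => t; rewrite cReM.
by apply: eq_bmf (bmfD (bmfM fr gi) (bmfM fi gr)) => t; rewrite cImM.
Qed.

Lemma cbmfZ c f : cbmf f -> cbmf (fun t => c * f t).
Proof. exact/cbmfM/cbmf_cst. Qed.

Lemma cbmfN f : cbmf f -> cbmf (fun t => - f t).
Proof. by move=> /(cbmfZ (-1)); apply: eq_cbmf => t; rewrite mulN1r. Qed.

Lemma cbmfB f g : cbmf f -> cbmf g -> cbmf (fun t => f t - g t).
Proof. by move=> bf bg; apply: cbmfD => //; exact: cbmfN. Qed.

Lemma cbmfJ f : cbmf f -> cbmf (fun t => conjc (f t)).
Proof.
move=> [fr fi]; split; first by apply: eq_bmf fr => t; case: (f t).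
by apply: eq_bmf (bmfN fi) => t; case: (f t).
Qed.

Lemma cbmf_sum (I : Type) (r : seq I) (P : pred I) (F : I -> T -> C) :
  (forall i, P i -> cbmf (F i)) -> cbmf (fun t => \sum_(i <- r | P i) F i t).
Proof.
move=> bF; split.
  by apply: eq_bmf (bmf_sum r (fun i Pi => (bF i Pi).1)) => t; rewrite cRe_sum.
by apply: eq_bmf (bmf_sum r (fun i Pi => (bF i Pi).2)) => t; rewrite cIm_sum.
Qed.

Lemma cbmf_real (f : T -> R) : bmf f -> cbmf (fun t => (f t)%:C).
Proof. by move=> bf; split => //; exact: bmf_cst. Qed.

Lemma bmf_nrm2 f : cbmf f -> bmf (fun t => nrm (f t) ^+ 2).
Proof.
move=> [fr fi]; apply: eq_bmf (bmfD (bmfM fr fr) (bmfM fi fi)) => t.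
by rewrite sqr_nrm !expr2.
Qed.

Lemma cbmf_bound f : cbmf f -> exists2 B : R, 0 < B & forall t, nrm (f t) <= B.
Proof.
move=> [[_ [B hB]] [_ [B' hB']]]; exists (`|B| + `|B'| + 1).
  by rewrite ltr_pwDr// addr_ge0.
move=> t; apply: le_trans (ler_nrm_ReIm _) _.
have := hB t; have := hB' t; have := ler_norm B; have := ler_norm B'; lra.
Qed.

Lemma cbmfP f : measurable_fun setT (fun t => complex.Re (f t)) ->
  measurable_fun setT (fun t => complex.Im (f t)) -> (exists B : R, forall t, nrm (f t) <= B) -> cbmf f.
Proof.
move=> mr mi [B hB]; split; split=> //; exists B => t; apply: le_trans (hB t).
  exact: ler_Re.
exact: ler_Im.
Qed.

Lemma ctorus_cst c : ctorus (fun=> c) = c.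
Proof. by apply: Cext; rewrite /= torus_int_cst. Qed.

Lemma ctorusD f g : cbmf f -> cbmf g -> ctorus (fun t => f t + g t) = ctorus f + ctorus g.
Proof.
move=> [fr fi] [gr gi]; apply: Cext; rewrite ?cReD ?cImD /= -torus_intD//; congr torus_int.
  by apply/funext => t; rewrite cReD.
by apply/funext => t; rewrite cImD.
Qed.

Lemma ctorusZ c f : cbmf f -> ctorus (fun t => c * f t) = c * ctorus f.
Proof.
move=> [fr fi]; apply: Cext; rewrite ?cReM ?cImM /= -!torus_intZ//.
  rewrite -torus_intB; [|exact: bmfZ|exact: bmfZ].
  by congr torus_int; apply/funext => t; rewrite cReM.
rewrite -torus_intD; [|exact: bmfZ|exact: bmfZ].
by congr torus_int; apply/funext => t; rewrite cImM.
Qed.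

Lemma ctorusB f g : cbmf f -> cbmf g -> ctorus (fun t => f t - g t) = ctorus f - ctorus g.
Proof.
move=> bf bg; rewrite -mulN1r -ctorusZ// -ctorusD//; last exact: cbmfZ.
by congr ctorus; apply/funext => t; rewrite mulN1r.
Qed.

Lemma ctorus_sum (I : Type) (r : seq I) (P : pred I) (F : I -> T -> C) :
  (forall i, P i -> cbmf (F i)) ->
  ctorus (fun t => \sum_(i <- r | P i) F i t) = \sum_(i <- r | P i) ctorus (F i).
Proof.
move=> bF; apply: Cext; rewrite ?cRe_sum ?cIm_sum /= -torus_int_sum.
- by congr torus_int; apply/funext => t; rewrite cRe_sum.
- by move=> i /bF[].
- by congr torus_int; apply/funext => t; rewrite cIm_sum.
- by move=> i /bF[].
Qed.

Lemma ctorusJ f : cbmf f -> ctorus (fun t => conjc (f t)) = conjc (ctorus f).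
Proof.
move=> [fr fi]; apply: Cext => /=.
  by congr torus_int; apply/funext => t; case: (f t).
rewrite -mulN1r -torus_intZ//; congr torus_int; apply/funext => t.
by rewrite mulN1r; case: (f t).
Qed.

Lemma ctorus_real (f : T -> R) : ctorus (fun t => (f t)%:C) = (torus_int f)%:C.
Proof. by apply: Cext => //=; rewrite torus_int_cst. Qed.

Lemma cbmf_flip (b : 'I_n -> bool) f : cbmf f -> cbmf (fun t => f (flip b t)).
Proof. by move=> [fr fi]; split; [exact: (bmf_flip b fr)|exact: (bmf_flip b fi)]. Qed.

Lemma ctorus_flip (b : 'I_n -> bool) f : cbmf f -> ctorus (fun t => f (flip b t)) = ctorus f.
Proof.
move=> [fr fi]; apply: Cext => /=.
  exact: (torus_int_flip b fr).
exact: (torus_int_flip b fi).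
Qed.

Lemma cintE f : cbmf f -> cint f = (((2 * pi) ^+ n)%:C : C) * ctorus f.
Proof. by move=> [fr fi]; apply: Cext; rewrite ?cReZ ?cImZ /= iintE. Qed.

Lemma nrm2E (z : C) : ((nrm z ^+ 2)%:C : C) = z * conjc z.
Proof. by apply: Cext; rewrite ?cReM ?cImM sqr_nrm; case: z => a b /=; ring. Qed.

End ComplexIntegral.

Section Characters.
Variable R : realType.
Local Notation C := (Cx R).

Definition ek n (k : 'I_n -> int) (t : n.-tuple R) : C :=
  expi (\sum_j (k j)%:~R * tnth t j).

Lemma nrm_ek n (k : 'I_n -> int) t : nrm (ek k t) = 1.
Proof. exact: nrm_expi. Qed.

Lemma ekD n (k l : 'I_n -> int) t : ek (fun j => k j + l j) t = ek k t * ek l t.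
Proof.
rewrite /ek -expiD -big_split /=; congr expi; apply: eq_bigr => j _.
by rewrite rmorphD mulrDl.
Qed.

Lemma conjc_ek n (k : 'I_n -> int) t : conjc (ek k t) = ek (fun j => - k j) t.
Proof.
rewrite /ek conjc_expi -sumrN; congr expi; apply: eq_bigr => j _.
by rewrite rmorphN mulNr.
Qed.

Lemma measurable_phase n (a : 'I_n -> R) : measurable_fun setT (fun t : n.-tuple R => \sum_j a j * tnth t j).
Proof.
apply: measurable_sum => j; apply: measurable_funM; first exact: measurable_cst.
exact: measurable_tnth.
Qed.

Lemma cbmf_ek n (k : 'I_n -> int) : cbmf (ek k).
Proof.
have mp := measurable_phase (fun j => (k j)%:~R : R).
apply: cbmfP; last by exists 1 => t; rewrite nrm_ek.
  exact: (measurableT_comp (continuous_measurable_fun (@continuous_cos R)) mp).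
exact: (measurableT_comp (continuous_measurable_fun (@continuous_sin R)) mp).
Qed.

(** One coordinate is split off at a time; real and imaginary parts go together because the addition
    formulas mix them. *)
Lemma ctorus_ek n (k : 'I_n -> int) : ctorus (ek k) = [forall j, k j == 0]%:R.
Proof.
elim: n k => [|n IH] k.
  rewrite (_ : [forall j, k j == 0]); last by apply/forallP => -[].
  rewrite -[RHS](@ctorus_cst R 0); congr ctorus; apply/funext => t.
  by rewrite /ek big_ord0 expi0.
have [br bi] := cbmf_ek k.
pose k' j := k (lift ord0 j).
have [br' bi'] := cbmf_ek k'.
have ekE (x : measurableTypeR R) t : ek k (tuple_cons (x, t)) = expi ((k ord0)%:~R * x) * ek k' t.
  rewrite /ek -expiD big_ord_recl; congr (expi (_ + _)).
  by apply: eq_bigr => j _; rewrite !(tnth_nth (x : R)).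
have := IH k'.
set a := torus_int (fun t => complex.Re (ek k' t)); set b := torus_int (fun t => complex.Im (ek k' t)).
have -> : ctorus (ek k') = a +i* b by [].
move=> ab.
have [bc bs] := bm1_trig R (k ord0).
have lin (f g : measurableTypeR R -> R) (x y : R) : bm1 f -> bm1 g ->
    circle_int (fun z => f z * x + g z * y) = circle_int f * x + circle_int g * y.
  move=> bf bg; have zz (h : measurableTypeR R -> R) u : bm1 h -> bm1 (fun z => h z * u).
    move=> [mh [B hB]]; split; first by apply: measurable_funM => //; exact: measurable_cst.
    by exists (B * `|u|) => z; rewrite normrM ler_pM.
  rewrite /circle_int RintegralD//; try exact/bm1_integrable/zz.
  by rewrite !RintegralZr//; exact: bm1_integrable.
have all_k : [forall j, k j == 0] = (k ord0 == 0) && [forall j, k' j == 0].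
  apply/forallP/andP => [H|[k0 /forallP H] j]; first by split => //; apply/forallP => j; exact: H.
  by case: (unliftP ord0 j) => [i ->|->//]; exact: H.
have [Ea Eb] : a = [forall j, k' j == 0]%:R /\ b = 0.
  by move: ab => /(congr1 (fun z : C => (complex.Re z, complex.Im z))) /= [-> ->]; case: [forall _, _].
apply: Cext => /=.
  have [_ ->] := torus_int_cons br.
  transitivity (circle_int (fun x : measurableTypeR R => cos ((k ord0)%:~R * x) * a + sin ((k ord0)%:~R * x) * (- b))).
    congr circle_int; apply/funext => x.
    rewrite mulrN -!torus_intZ// -torus_intB; [|exact: bmfZ|exact: bmfZ].
    by congr torus_int; apply/funext => t; rewrite ekE cReM.
  rewrite lin// circle_int_cos circle_int_sin mul0r addr0 Ea all_k.
  by case: (k ord0 == 0); case: [forall _, _]; rewrite /= ?mulr1 ?mul1r ?mulr0 ?mul0r.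
have [_ ->] := torus_int_cons bi.
transitivity (circle_int (fun x : measurableTypeR R => cos ((k ord0)%:~R * x) * b + sin ((k ord0)%:~R * x) * a)).
  congr circle_int; apply/funext => x.
  rewrite -!torus_intZ// -torus_intD; [|exact: bmfZ|exact: bmfZ].
  by congr torus_int; apply/funext => t; rewrite ekE cImM.
rewrite lin// circle_int_sin Eb mulr0 mul0r addr0.
by case: [forall _, _].
Qed.

End Characters.

Section NullCoordinates.
Variable R : realType.
Local Notation G := (measurableTypeR R).

#[global] Instance ae_torus_filter n : Filter (nbhs (almost_everywhere (torus_prob R n))).
Proof. exact: (@ae_filter_ringOfSetsType _ _ _ (torus_prob R n)). Qed.

Lemma torus_int_tnth n (j : 'I_n) (g : G -> R) : bm1 g ->
  torus_int (fun t : n.-tuple R => g (tnth t j)) = circle_int g.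
Proof.
move=> bg; have bgt m (i : 'I_m) : bmf (fun t : m.-tuple R => g (tnth t i)).
  have [mg [B hB]] := bg; split; last by exists B.
  apply: (@measurableT_comp _ _ _ _ _ _ (g : R -> R)); last exact: measurable_tnth.
  by move=> _ A mA; have := mg measurableT A mA; rewrite !setTI.
elim: n j => [[] //|n IH] j.
have [_ ->] := torus_int_cons (bgt _ j).
case: (unliftP ord0 j) => [i ->|->].
  rewrite -(circle_int_cst (circle_int g)) -(IH i); congr circle_int; apply/funext => x.
  by congr torus_int; apply/funext => t; rewrite !(tnth_nth (x : R)).
congr circle_int; apply/funext => x; rewrite -[RHS](torus_int_cst n).
by congr torus_int.
Qed.

Lemma ae_tnth n (j : 'I_n) (N : set G) : measurable N -> circle_prob R N = 0%E ->
  {ae torus_prob R n, forall t, ~ N (tnth t j)}.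
Proof.
move=> mN N0; exists [set t : n.-tuple R | N (tnth t j)]; split.
- by have := measurable_tnth j measurableT (mN : measurable (N : set R)); rewrite setTI.
- have b1 : bm1 (\1_N : G -> R).
    by split; [exact: measurable_indic|exists 1 => x; rewrite indicE; case: (_ \in _); rewrite ?normr1 ?normr0].
  have mA : measurable [set t : n.-tuple R | N (tnth t j)].
    by have := measurable_tnth j measurableT (mN : measurable (N : set R)); rewrite setTI.
  have : torus_int (fun t : n.-tuple R => \1_N (tnth t j) : R) = 0.
    rewrite (torus_int_tnth j b1) /circle_int /Rintegral integral_indic// setIT.
    exact: (congr1 fine N0).
  have -> : (fun t : n.-tuple R => \1_N (tnth t j) : R) = \1_[set t : n.-tuple R | N (tnth t j)].
    by apply/funext => t; rewrite !indicE; congr (_%:R); congr nat_of_bool; apply/idP/idP; rewrite !inE.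
  rewrite /torus_int /Rintegral integral_indic// setIT => H.
  by rewrite -[LHS]fineK ?H// fin_num_measure.
- by move=> t /= /contrapT.
Qed.

Lemma ae_tnth_neq n (j : 'I_n) (a : R) : {ae torus_prob R n, forall t, tnth t j != a}.
Proof.
have N0 : circle_prob R [set a] = 0%E.
  have := @dominates_uniform_prob R _ _ (pi_lt R) => /null_content_dominatesP; apply => //.
  exact: lebesgue_measure_set1.
have H := @ae_tnth n j [set a] (measurable_set1 _) N0.
by apply: filterS H => t /= /eqP.
Qed.

Lemma ae_tnth_itv n : {ae torus_prob R n, forall t, forall j, - pi < tnth t j < pi}.
Proof.
pose D := `[(- pi)%R, pi]%classic : set G.
have N0 : circle_prob R (~` D) = 0%E.
  by rewrite /circle_prob /= /uniform_prob integral_uniform_pdf setICl integral_set0.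
have mD : measurable (~` D) by apply: measurableC; exact: measurable_itv.
have H (j : 'I_n) : {ae torus_prob R n, forall t, - pi < tnth t j < pi}.
  apply: filterS3 (ae_tnth j mD N0) (ae_tnth_neq j (- pi)) (ae_tnth_neq j pi) => t /= tD t1 t2.
  move: tD => /contrapT; rewrite /D /= in_itv /= => /andP[a b].
  by rewrite !lt_neqAle eq_sym t1 t2 a b.
have : \forall t \ae torus_prob R n, forall j, j \in enum 'I_n -> - pi < tnth t j < pi.
  elim: (enum 'I_n) => [|j s IH]; first by apply: filterE => t j; rewrite in_nil.
  apply: filterS2 (H j) IH => t Hj Hs i; rewrite inE => /orP[/eqP -> //|/Hs//].
by move=> H'; apply: filterS H' => t Ht j; apply: Ht; rewrite mem_enum.
Qed.

End NullCoordinates.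

(** * The L2 closure of the trigonometric polynomials *)

Section TrigDensity.
Variables (R : realType) (n : nat).
Local Notation C := (Cx R).
Local Notation T := (n.-tuple R).
Implicit Types (f g p : T -> C).

Definition trig f := exists s : seq (C * ('I_n -> int)), forall t, f t = \sum_(x <- s) x.1 * ek x.2 t.

Definition sqn f : R := torus_int (fun t => nrm (f t) ^+ 2).

(** A property of a single function: membership in the L2 closure of the trigonometric
    polynomials. *)
Definition L2dense f := forall e : R, 0 < e -> exists2 p, trig p & sqn (fun t => f t - p t) < e.

Lemma cbmf_trig p : trig p -> cbmf p.
Proof.
move=> [s ps]; apply: (@eq_cbmf _ _ (fun t => \sum_(x <- s) x.1 * ek x.2 t)); first by move=> t; rewrite ps.
by apply: cbmf_sum => x _; apply: cbmfZ; exact: cbmf_ek.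
Qed.

Lemma trig_ek c k : trig (fun t => c * ek k t).
Proof. by exists [:: (c, k)] => t; rewrite big_seq1. Qed.

Lemma trig_cst c : trig (fun=> c).
Proof.
exists [:: (c, fun=> 0)] => t; rewrite big_seq1 /= /ek big1 ?expi0 ?mulr1//.
by move=> j _; rewrite mul0r.
Qed.

Lemma trigD f g : trig f -> trig g -> trig (fun t => f t + g t).
Proof. by move=> [s Hs] [s' Hs']; exists (s ++ s') => t; rewrite big_cat Hs Hs'. Qed.

Lemma trigM f g : trig f -> trig g -> trig (fun t => f t * g t).
Proof.
move=> [s Hs] [s' Hs'].
exists [seq (z.1.1 * z.2.1, fun j => z.1.2 j + z.2.2 j) | z <- [seq (x, y) | x <- s, y <- s']] => t.
rewrite big_map big_allpairs Hs Hs' mulr_suml; apply: eq_bigr => x _.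
by rewrite mulr_sumr; apply: eq_bigr => y _; rewrite /= ekD mulrACA.
Qed.

Lemma trigZ c f : trig f -> trig (fun t => c * f t).
Proof. exact/trigM/trig_cst. Qed.

Lemma trigX f k : trig f -> trig (fun t => f t ^+ k).
Proof.
move=> tf; elim: k => [|k IH]; first exact: trig_cst.
by have [s Hs] := trigM tf IH; exists s => t; rewrite -Hs exprS.
Qed.

Lemma eq_sqn f g : f =1 g -> sqn f = sqn g.
Proof. by move=> /funext ->. Qed.

Lemma sqn_ge0 f : 0 <= sqn f.
Proof. by apply: torus_int_ge0 => t; exact: exprn_ge0 (nrm_ge0 _). Qed.

Lemma nrmD_sqr (z w : C) : nrm (z + w) ^+ 2 <= 2 * nrm z ^+ 2 + 2 * nrm w ^+ 2.
Proof.
apply: (@le_trans _ _ ((nrm z + nrm w) ^+ 2)).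
  by rewrite lerXn2r ?nnegrE ?addr_ge0 ?nrm_ge0// ler_nrmD.
have := sqr_ge0 (nrm z - nrm w); rewrite sqrrB sqrrD; lra.
Qed.

Lemma sqnD f g : cbmf f -> cbmf g -> sqn (fun t => f t + g t) <= 2 * sqn f + 2 * sqn g.
Proof.
move=> bf bg; have b1 := bmf_nrm2 bf; have b2 := bmf_nrm2 bg.
rewrite /sqn -!torus_intZ// -torus_intD; try exact: bmfZ.
apply: torus_int_le; [exact/bmf_nrm2/cbmfD|by apply: bmfD; exact: bmfZ|].
by move=> t; exact: nrmD_sqr.
Qed.

Lemma sqnM f g B : cbmf f -> cbmf g -> (forall t, nrm (g t) <= B) ->
  sqn (fun t => f t * g t) <= B ^+ 2 * sqn f.
Proof.
move=> bf bg gB; have b1 := bmf_nrm2 bf.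
rewrite /sqn -torus_intZ//; apply: torus_int_le; [exact/bmf_nrm2/cbmfM|exact: bmfZ|].
move=> t; rewrite nrmM exprMn mulrC ler_wpM2r ?sqr_ge0//.
by rewrite lerXn2r ?nnegrE ?nrm_ge0// (le_trans (nrm_ge0 (g t))).
Qed.

Lemma L2dense_trig p : trig p -> L2dense p.
Proof.
move=> tp e e0; exists p => //; rewrite (_ : sqn _ = 0)// -[RHS](torus_int_cst n).
by congr torus_int; apply/funext => t; rewrite subrr nrm0 expr0n.
Qed.

Lemma L2dense_lim f : cbmf f ->
  (forall e : R, 0 < e -> exists g, [/\ cbmf g, L2dense g & sqn (fun t => f t - g t) < e]) -> L2dense f.
Proof.
move=> bf H e e0; have e4 : 0 < e / 4 by rewrite divr_gt0.
have [g [bg dg fg]] := H _ e4; have [p tp gp] := dg _ e4.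
exists p => //; have bp := cbmf_trig tp.
rewrite (@eq_sqn _ (fun t => (f t - g t) + (g t - p t))); last by move=> t; rewrite addrA subrK.
apply: le_lt_trans (sqnD _ _) _; [exact: cbmfB|exact: cbmfB|lra].
Qed.

Lemma L2denseD f g : cbmf f -> cbmf g -> L2dense f -> L2dense g -> L2dense (fun t => f t + g t).
Proof.
move=> bf bg df dg e e0; have e4 : 0 < e / 4 by rewrite divr_gt0.
have [p tp fp] := df _ e4; have [q tq gq] := dg _ e4.
have bp := cbmf_trig tp; have bq := cbmf_trig tq.
exists (fun t => p t + q t); first exact: trigD.
rewrite (@eq_sqn _ (fun t => (f t - p t) + (g t - q t))); last by move=> t; rewrite opprD addrACA.
apply: le_lt_trans (sqnD _ _) _; [exact: cbmfB|exact: cbmfB|lra].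
Qed.

Lemma L2denseM f g : cbmf f -> cbmf g -> L2dense f -> L2dense g -> L2dense (fun t => f t * g t).
Proof.
move=> bf bg df dg e e0; have e4 : 0 < e / 4 by rewrite divr_gt0.
have [B B0 hB] := cbmf_bound bg.
have [|p tp fp] := df (e / 4 / B ^+ 2); first by rewrite divr_gt0// exprn_gt0.
have bp := cbmf_trig tp; have [B' B'0 hB'] := cbmf_bound bp.
(* [q] is chosen after [p], because its tolerance depends on the sup norm of [p], which the L2
   distance does not control. *)
have [|q tq gq] := dg (e / 4 / B' ^+ 2); first by rewrite divr_gt0// exprn_gt0.
have bq := cbmf_trig tq.
exists (fun t => p t * q t); first exact: trigM.
rewrite (@eq_sqn _ (fun t => (f t - p t) * g t + (g t - q t) * p t)); last by move=> t; ring.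
apply: le_lt_trans (sqnD _ _) _; [by apply: cbmfM => //; exact: cbmfB|by apply: cbmfM => //; exact: cbmfB|].
have s1 := sqnM (cbmfB bf bp) bg hB; have s2 := sqnM (cbmfB bg bq) bp hB'.
rewrite ltr_pdivlMr ?exprn_gt0// mulrC in fp.
rewrite ltr_pdivlMr ?exprn_gt0// mulrC in gq.
lra.
Qed.

Lemma L2denseZ c f : cbmf f -> L2dense f -> L2dense (fun t => c * f t).
Proof.
by move=> bf df; apply: L2denseM => //; [exact: cbmf_cst|exact/L2dense_trig/trig_cst].
Qed.

Lemma L2dense_sum (I : Type) (r : seq I) (P : pred I) (F : I -> T -> C) :
  (forall i, cbmf (F i)) -> (forall i, L2dense (F i)) -> L2dense (fun t => \sum_(i <- r | P i) F i t).
Proof.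
move=> bF dF; elim: r => [|i r IH].
  rewrite (_ : (fun t => _) = fun=> 0); first exact/L2dense_trig/trig_cst.
  by apply/funext => t; rewrite big_nil.
case Pi : (P i); last first.
  by rewrite (_ : (fun t => _) = (fun t => \sum_(i <- r | P i) F i t))//; apply/funext => t; rewrite big_cons Pi.
rewrite (_ : (fun t => _) = (fun t => F i t + \sum_(i <- r | P i) F i t)).
  by apply: L2denseD => //; exact: cbmf_sum.
by apply/funext => t; rewrite big_cons Pi.
Qed.

Lemma L2dense_bconv (u : nat -> T -> C) f (B : R) : (forall k, cbmf (u k)) -> cbmf f ->
  (forall k t, nrm (u k t) <= B) -> (forall k, L2dense (u k)) ->
  {ae torus_prob R n, forall t, nrm (f t - u k t) @[k --> \oo] --> (0 : R)} ->
  L2dense f.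
Proof.
move=> bu bf uB du cvu; apply: L2dense_lim => // e e0.
have [B' B'0 fB'] := cbmf_bound bf.
have b2 k : bmf (fun t => nrm (f t - u k t) ^+ 2) by exact/bmf_nrm2/cbmfB.
have := @bounded_convergence R n (fun k t => nrm (f t - u k t) ^+ 2) (fun=> 0) ((B' + B) ^+ 2).
have B0 : 0 <= B by apply: le_trans (nrm_ge0 _) (uB 0%N [tuple 0 | i < n]).
move=> H; have {H} : torus_int (fun t => nrm (f t - u k t) ^+ 2) @[k --> \oo] --> torus_int (fun _ : T => 0 : R).
  apply: H.
  - by move=> k; have [] := b2 k.
  - move=> k t; rewrite ger0_norm ?sqr_ge0// lerXn2r ?nnegrE ?nrm_ge0 ?addr_ge0 ?(ltW B'0)//.
    by apply: le_trans (ler_nrmB _ _) (lerD _ _).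
  - exact: measurable_cst.
  - apply: filterS cvu => t /= Ht.
    rewrite (_ : 0 = 0 * 0 :> R); last by rewrite mul0r.
    by under eq_fun do rewrite expr2; exact: cvgM.
rewrite torus_int_cst => /cvgrPdist_lt /(_ e e0) [k _ /(_ k (leqnn k)) /=].
rewrite sub0r normrN ger0_norm ?sqn_ge0// => Hk.
by exists (u k).
Qed.

Definition dense_set (A : set T) := measurable A /\ L2dense (fun t => ((\1_A t : R)%:C : C)).

Lemma cbmf_indic (A : set T) : measurable A -> cbmf (fun t => ((\1_A t : R)%:C : C)).
Proof.
move=> mA; apply: cbmf_real; split; first exact: measurable_indic.
by exists 1 => t; rewrite indicE; case: (_ \in _); rewrite ?normr1 ?normr0.
Qed.

Lemma dense_set_setC A : dense_set A -> dense_set (~` A).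
Proof.
move=> [mA dA]; split; first exact: measurableC.
have bA := cbmf_indic mA.
rewrite (_ : (fun t => _) = (fun t => 1 + (-1) * ((\1_A t : R)%:C : C))).
  apply: L2denseD; [exact: cbmf_cst|exact: cbmfZ|exact/L2dense_trig/trig_cst|exact: L2denseZ].
apply/funext => t; rewrite !indicE in_setC; case: (t \in A) => /=.
  by rewrite mulr1 subrr.
by rewrite mulr0 addr0.
Qed.

Lemma dense_set_setI A B : dense_set A -> dense_set B -> dense_set (A `&` B).
Proof.
move=> [mA dA] [mB dB]; split; first exact: measurableI.
rewrite (_ : (fun t => _) = (fun t => ((\1_A t : R)%:C : C) * ((\1_B t : R)%:C : C))).
  by apply: L2denseM => //; exact: cbmf_indic.
by apply/funext => t; rewrite indicI /= rmorphM.
Qed.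

Lemma dense_set_set0 : dense_set set0.
Proof.
split=> //; rewrite (_ : (fun t => _) = fun=> 0); first exact/L2dense_trig/trig_cst.
by apply/funext => t; rewrite indic0.
Qed.

Lemma dense_set_bigcup (F : (set T)^nat) : (forall i, dense_set (F i)) -> dense_set (\bigcup_i F i).
Proof.
move=> dF; have mU : measurable (\bigcup_i F i) by apply: bigcupT_measurable => i; have [] := dF i.
pose U k := \big[setU/set0]_(i < k) F i.
have dU k : dense_set (U k).
  rewrite /U; elim: k => [|k IH]; first by rewrite big_ord0; exact: dense_set_set0.
  rewrite big_ord_recr /= -[_ `|` _]setCK setCU; apply: dense_set_setC.
  by apply: dense_set_setI; exact: dense_set_setC.
have UE k : U k = \bigcup_(i in `I_k) F i by rewrite bigcup_mkord.
split => //; apply: (@L2dense_bconv (fun k t => ((\1_(U k) t : R)%:C : C)) _ 1).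
- by move=> k; apply: cbmf_indic; have [] := dU k.
- exact: cbmf_indic.
- by move=> k t; rewrite nrm_real indicE; case: (_ \in _); rewrite ?normr1 ?normr0.
- by move=> k; have [] := dU k.
- apply: aeW => t; have [[i _ Fit]|nU] := pselect ((\bigcup_i F i) t).
    apply/cvgrPdist_lt => e e0; exists i.+1 => // k ik.
    have Uk : U k t by rewrite UE; exists i.
    have Ut : (\bigcup_i F i) t by exists i.
    by rewrite !indicE (mem_set Uk) (mem_set Ut) subrr nrm0 subrr normr0.
  have nUk k : ~ U k t by rewrite UE => -[i _ Fi]; apply: nU; exists i.
  under eq_fun do rewrite !indicE memNset// memNset// subrr nrm0.
  exact: cvg_cst.
Qed.

(** Sets with approximable indicator form a sigma-algebra, so generators are enough. *)
Lemma dense_set_generated (S : set (set T)) : S `<=` dense_set -> <<s S >> `<=` dense_set.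
Proof.
move=> H; apply: smallest_sub => //; split; [exact: dense_set_set0| |exact: dense_set_bigcup].
by move=> A dA; rewrite setTD; exact: dense_set_setC.
Qed.

End TrigDensity.

(** * Density of trigonometric polynomials among bounded measurable functions *)

Section BoundedDensity.
Variables (R : realType) (n : nat).
Local Notation C := (Cx R).
Local Notation T := (n.-tuple R).

Lemma bernoulli_ge (y : R) m : -1 <= y -> 1 + m%:R * y <= (1 + y) ^+ m.
Proof.
move=> y1; elim: m => [|m IH]; first by rewrite mul0r addr0 expr0.
have m0 : 0 <= m%:R :> R by [].
rewrite exprS; apply: (@le_trans _ _ ((1 + y) * (1 + m%:R * y))); last by rewrite ler_wpM2l//; lra.
rewrite -natr1; have := mulr_ge0 m0 (sqr_ge0 y); rewrite expr2; lra.
Qed.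

(** The device of Brosowski and Deutsch: (1 - u^k)^(2^k) tends to 1 where u < 1/2 and to 0 where u >
    1/2. By Bernoulli the errors are at most (2u)^k and (2u)^(-k). *)
Lemma dense_set_threshold (u : T -> R) (A : set T) : trig (fun t => ((u t)%:C : C)) ->
  (forall t, 0 <= u t <= 1) -> measurable A ->
  {ae torus_prob R n, forall t, (A t -> u t < 1 / 2) /\ (~ A t -> 1 / 2 < u t)} -> dense_set A.
Proof.
move=> tu u01 mA Au; split=> //.
pose v k t := (1 - u t ^+ k) ^+ (2 ^ k).
have v01 k t : 0 <= v k t <= 1.
  have /andP[u0 u1] := u01 t; have uk0 := exprn_ge0 k u0; have uk1 := exprn_ile1 k u0 u1.
  by rewrite exprn_ge0 ?exprn_ile1//; lra.
have tv k : trig (fun t => ((v k t)%:C : C)).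
  have := trigX (2 ^ k) (trigD (trig_cst n (1 : C)) (trigZ (-1) (trigX k tu))).
  by rewrite (_ : (fun t => _) = (fun t => ((v k t)%:C : C)))//; apply/funext => t;
    rewrite /v !(rmorphXn, rmorphB, rmorph1) mulN1r.
apply: (@L2dense_bconv _ _ (fun k t => ((v k t)%:C : C)) _ 1).
- by move=> k; exact: cbmf_trig.
- exact: cbmf_indic.
- by move=> k t; rewrite nrm_real ger0_norm; case/andP: (v01 k t).
- by move=> k; exact: L2dense_trig.
apply: filterS Au => t /= [At nAt].
have /andP[u0 u1] := u01 t.
have geo (q : R) : 0 <= q < 1 -> (forall k, nrm (((\1_A t : R)%:C : C) - (v k t)%:C) <= q ^+ k) ->
    nrm (((\1_A t : R)%:C : C) - (v k t)%:C) @[k --> \oo] --> (0 : R).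
  move=> /andP[q0 q1] H; apply: (@squeeze_cvgr _ _ _ _ (fun=> 0) (fun k => q ^+ k)).
  - by apply: nearW => k; rewrite nrm_ge0 H.
  - exact: cvg_cst.
  - by apply: cvg_expr; rewrite ger0_norm.
have [tA|tnA] := pselect (A t).
  apply: (geo (2 * u t)); first by have := At tA; lra.
  move=> k; have -> : \1_A t = 1 :> R by rewrite indicE mem_set.
  rewrite -rmorphB nrm_real.
  have /andP[v0 v1] := v01 k t; rewrite ger0_norm; last by rewrite subr_ge0.
  have := @bernoulli_ge (- u t ^+ k) (2 ^ k).
  have := exprn_ile1 k u0 u1; rewrite -lerN2 => -> /(_ isT).
  rewrite -/(v k t) natrX exprMn mulrN; rewrite /v; lra.
have ut := nAt tnA.
apply: (geo ((2 * u t)^-1)).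
  by rewrite invr_ge0 invf_lt1; lra.
move=> k; have -> : \1_A t = 0 :> R by rewrite indicE memNset.
rewrite sub0r nrmN nrm_real.
have /andP[v0 v1] := v01 k t; rewrite ger0_norm//.
rewrite exprVn -[leRHS]mul1r ler_pdivlMr; last by rewrite exprn_gt0//; lra.
have uk0 := exprn_ge0 k u0; have uk1 := exprn_ile1 k u0 u1.
apply: (@le_trans _ _ (v k t * (1 + u t ^+ k) ^+ (2 ^ k))).
  rewrite ler_wpM2l//; have := @bernoulli_ge (u t ^+ k) (2 ^ k).
  rewrite natrX exprMn => H; have : -1 <= u t ^+ k by lra.
  by move=> /H; lra.
rewrite /v -exprMn exprn_ile1//; nra.
Qed.

Lemma trig_cos (j : 'I_n) (c : R) : trig (fun t => ((cos (tnth t j - c))%:C : C)).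
Proof.
pose d (i : 'I_n) : int := (i == j)%:Z.
have ekd t : ek d t = expi (tnth t j).
  rewrite /ek (bigD1 j)//= /d eqxx mul1r big1 ?addr0// => i /negbTE ->.
  by rewrite mul0r.
have ekNd t : ek (fun i => - d i) t = expi (- tnth t j) by rewrite -conjc_ek ekd conjc_expi.
have := trigD (trig_ek (((1 / 2)%:C : C) * expi (- c)) d) (trig_ek (((1 / 2)%:C : C) * expi c) (fun i => - d i)).
rewrite (_ : (fun t => _) = (fun t => ((cos (tnth t j - c))%:C : C)))//; apply/funext => t.
rewrite ekd ekNd -!mulrA -!expiD -mulrDr; set x := tnth t j.
have -> : - c + x = x - c by ring.
have -> : c + - x = - (x - c) by ring.
apply: Cext; rewrite ?cReZ ?cImZ ?cReD ?cImD /= ?cosN ?sinN; lra.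
Qed.

Lemma dense_set_ray (j : 'I_n) (a : R) : dense_set [set t : T | a < tnth t j].
Proof.
have mA : measurable [set t : T | a < tnth t j].
  have mI : measurable (`]a, +oo[%classic : set R) by exact: measurable_itv.
  have := measurable_tnth j measurableT mI; rewrite setTI; congr measurable.
  by apply/seteqP; split => t /=; rewrite in_itv /= andbT.
have ae := @ae_tnth_itv R n.
have [a1|a1] := ltP a (- pi).
  apply: (@dense_set_threshold (fun=> 0)) => //; first exact: trig_cst.
    by move=> t; rewrite lexx ler01.
  apply: filterS ae => t /(_ j) /= /andP[t1 t2]; split=> [_|]; first lra.
  by case; lra.
have [a2|a2] := leP pi a.
  apply: (@dense_set_threshold (fun=> 1)) => //; first exact: trig_cst.
    by move=> t; rewrite lexx ler01.
  apply: filterS ae => t /(_ j) /= /andP[t1 t2]; split=> [|_]; lra.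
(* Center and half-length of the arc from [a] to [pi]: up to endpoints, a < t_j holds exactly when
   cos(t_j - c) > cos h. *)
pose c := (a + pi) / 2; pose h := pi - c.
have p0 := pi_gt0 R.
apply: (@dense_set_threshold (fun t => 1 / 2 + (cos h - cos (tnth t j - c)) / 4)) => //.
- have := trigD (trig_cst n (((1 / 2 + cos h / 4))%:C : C)) (trigZ ((- (1 / 4))%:C : C) (trig_cos j c)).
  rewrite (_ : (fun t => _) = (fun t => ((1 / 2 + (cos h - cos (tnth t j - c)) / 4)%:C : C)))//.
  apply/funext => t; rewrite -rmorphM -rmorphD; congr (_%:C); ring.
- move=> t; have := cos_le1 h; have := cos_geN1 h.
  have := cos_le1 (tnth t j - c); have := cos_geN1 (tnth t j - c); lra.
apply: filterS2 ae (ae_tnth_neq j a) => t /(_ j) /= /andP[t1 t2] ta.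
have cosd x y : 0 <= x -> x < y -> y <= pi -> cos y < cos x.
  by move=> x0 xy ypi; rewrite ltr_cos// in_itv /=; lra.
have hc : h = pi - c by [].
have cE : c = (a + pi) / 2 by [].
split=> [at1|/negP]; last rewrite -leNgt le_eqVlt (negbTE ta) /= => ta'.
  suff : cos h < cos (tnth t j - c) by lra.
  have [tc|tc] := leP c (tnth t j); first by apply: cosd; lra.
  by rewrite -(cosN (tnth t j - c)) opprB; apply: cosd; lra.
suff : cos (tnth t j - c) < cos h by lra.
(* Far to the left of the arc the shorter way around the circle passes through [pi], so the angle is
   shifted by 2 pi. *)
rewrite -(cosN (tnth t j - c)) opprB; have [y|y] := leP (c - tnth t j) pi; first by apply: cosd; lra.
rewrite -cosN -(cosD2pi (- _)); apply: cosd; lra.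
Qed.

Lemma measurable_dense_set (A : set T) : measurable A -> dense_set A.
Proof.
apply: (@dense_set_generated R n) => B; rewrite -bigcup_seq => -[j _] [Y mY <-].
rewrite setTI.
have : <<s @RGenOInfty.G R >> Y by have := mY; rewrite /measurable /= -[X in X Y -> _]/((@ocitv R).-sigma.-measurable) RGenOInfty.measurableE.
move: Y {mY}; apply: smallest_sub.
  split.
  - by rewrite preimage_set0; exact: dense_set_set0.
  - by move=> Y dY; rewrite setTD -preimage_setC; exact: dense_set_setC.
  - by move=> F dF; rewrite preimage_bigcup; exact: dense_set_bigcup.
move=> _ [a ->]; rewrite (_ : _ @^-1` _ = [set t : T | a < tnth t j]); first exact: dense_set_ray.
by apply/seteqP; split => t /=; rewrite in_itv /= andbT.
Qed.

Import HBNNSimple.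

Lemma L2dense_real (f : T -> R) : bmf f -> L2dense (fun t => ((f t)%:C : C)).
Proof.
move=> bf; have [mf [B hB]] := bf.
pose g t := f t + B.
have bg : bmf g by apply: bmfD => //; exact: bmf_cst.
have g0 t : 0 <= g t by have := hB t; rewrite ler_norml /g; lra.
have g2B t : g t <= 2 * B by have := hB t; rewrite ler_norml /g; lra.
suff dg : L2dense (fun t => ((g t)%:C : C)).
  have := L2denseD (cbmf_real bg) (cbmf_cst n ((- B)%:C : C)) dg (L2dense_trig (trig_cst n ((- B)%:C : C))).
  rewrite (_ : (fun t => _) = (fun t => ((f t)%:C : C)))//.
  by apply/funext => t; rewrite -rmorphD /g addrK.
have mg : measurable_fun setT (EFin \o g) by apply/measurable_EFinP; case: bg.
pose h k := nnsfun_approx measurableT mg k.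
have hg k t : h k t <= g t.
  by rewrite -lee_fin /h nnsfun_approxE; apply: (@le_approx _ _ _ setT (EFin \o g)) => // x _; rewrite lee_fin.
have h0 k t : 0 <= h k t by exact: fun_ge0.
have bh k : bmf (h k).
  by split; [exact: measurable_funP|exists (2 * B) => t; rewrite ger0_norm// (le_trans (hg k t))].
apply: (@L2dense_bconv _ _ (fun k t => ((h k t)%:C : C)) _ (2 * B)).
- by move=> k; exact: cbmf_real.
- exact: cbmf_real.
- by move=> k t; rewrite nrm_real ger0_norm// (le_trans (hg k t)).
- move=> k.
  pose s := finmap.enum_fset (fset_set (range (h k))).
  rewrite (_ : (fun t => _) = (fun t => \sum_(i < size s) ((s`_i)%:C : C) * ((\1_(h k @^-1` [set s`_i]) t : R)%:C : C))).
    apply: L2dense_sum => i; first by apply/cbmfZ/cbmf_indic.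
    by apply: L2denseZ; [exact: cbmf_indic|apply: (measurable_dense_set _).2].
  apply/funext => t; rewrite (fimfunEord (h k)) rmorph_sum /=.
  by apply: eq_bigr => i _; rewrite rmorphM.
- apply: aeW => t.
  have gE x : setT x -> (0 <= (EFin \o g) x)%E by move=> _; rewrite lee_fin.
  have /fine_cvgP[_ cvh] := @cvg_nnsfun_approx _ _ _ setT measurableT _ mg gE t I.
  rewrite (_ : (fun k => _) = (fun k => `|g t - h k t|)); last first.
    by apply/funext => k; rewrite -rmorphB nrm_real.
  apply/cvgrPdist_lt => e e0; move/cvgrPdist_lt : cvh => /(_ e e0); apply: filterS => k /=.
  by rewrite sub0r normrN normr_id.
Qed.

Theorem L2dense_cbmf (f : T -> C) : cbmf f -> L2dense f.
Proof.
move=> [fr fi].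
pose i : C := 0 +i* 1.
have := L2denseD (cbmf_real fr) (cbmfZ i (cbmf_real fi)) (L2dense_real fr) (L2denseZ i (cbmf_real fi) (L2dense_real fi)).
rewrite (_ : (fun t => _) = f)//; apply/funext => t.
by case: (f t) => x y; apply: Cext; rewrite ?cReD ?cImD ?cReM ?cImM /=; ring.
Qed.

End BoundedDensity.

(** * Matrix polynomials and eigenvalues *)

Section MatrixPolynomials.
Variable R : realType.
Local Notation C := (Cx R).

Lemma expSmx m (A : 'M[C]_m) k : A ^+ k.+1 = A *m A ^+ k.
Proof. exact: exprS. Qed.

(** Written as an explicit sum so that it covers every size, including 0; [horner_mx] is used only
    at sizes [m.+1]. *)
Definition peval m (P : {poly C}) (A : 'M[C]_m) : 'M[C]_m := \sum_(i < size P) P`_i *: A ^+ i.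

Lemma peval_horner m (P : {poly C}) (A : 'M[C]_m.+1) : peval P A = horner_mx A P.
Proof.
rewrite -[in RHS](coefK P) poly_def rmorph_sum /=; apply: eq_bigr => i _.
by rewrite horner_mxZ rmorphXn /= horner_mx_X.
Qed.

Lemma pevalX m (P : {poly C}) (A : 'M[C]_m) k : peval (P ^+ k) A = peval P A ^+ k.
Proof.
case: m A => [|m] A; first by rewrite !flatmx0.
by rewrite !peval_horner rmorphXn.
Qed.

Lemma peval_Xn m (A : 'M[C]_m) k : peval 'X^k A = A ^+ k.
Proof.
case: m A => [|m] A; first by rewrite !flatmx0.
by rewrite peval_horner rmorphXn /= horner_mx_X.
Qed.

Lemma peval_conj m (P : {poly C}) (U V A : 'M[C]_m) : V *m U = 1%:M ->
  peval P (U *m A *m V) = U *m peval P A *m V.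
Proof.
move=> VU; have UV : U *m V = 1%:M by apply: mulmx1C.
rewrite /peval mulmx_sumr mulmx_suml; apply: eq_bigr => i _.
rewrite -scalemxAr -scalemxAl; congr (_ *: _).
elim: (nat_of_ord i) => [|k IH]; first by rewrite !expr0 mulmx1 UV.
by rewrite !expSmx IH !mulmxA -[U *m A *m V *m U]mulmxA VU mulmx1.
Qed.

Lemma peval_trig m (P : {poly C}) (T : 'M[C]_m) : is_trig_mx T ->
  is_trig_mx (peval P T) /\ forall i, peval P T i i = P.[T i i].
Proof.
move=> /is_trig_mxP Tt.
have key k : (forall i j : 'I_m, (i < j)%N -> (T ^+ k) i j = 0) /\ forall i, (T ^+ k) i i = T i i ^+ k.
  elim: k => [|k [IH1 IH2]]; split=> [i j ij|i].
  - by rewrite expr0 mxE -val_eqE ltn_eqF.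
  - by rewrite !expr0 mxE eqxx.
  - rewrite expSmx mxE big1// => l _; case: (ltnP i l) => [il|li]; first by rewrite Tt// mul0r.
    by rewrite IH1 ?mulr0// (leq_ltn_trans li).
  - rewrite expSmx exprS mxE (bigD1 i)//= IH2 big1 ?addr0// => l li.
    case: (ltngtP i l) => [il|il|/val_inj il]; first by rewrite Tt// mul0r.
      by rewrite IH1 ?mulr0.
    by rewrite il eqxx in li.
split=> [|i].
  apply/is_trig_mxP => i j ij; rewrite summxE big1// => k _.
  by rewrite mxE (key k).1 ?mulr0.
by rewrite summxE horner_coef; apply: eq_bigr => k _; rewrite mxE (key k).2.
Qed.

Definition adj m n (A : 'M[C]_(m, n)) : 'M[C]_(n, m) := map_mx conjc A^T.

Lemma adjM m n p (A : 'M[C]_(m, n)) (B : 'M[C]_(n, p)) : adj (A *m B) = adj B *m adj A.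
Proof. by rewrite /adj trmx_mul map_mxM. Qed.

Lemma adjK m n : cancel (@adj m n) (@adj n m).
Proof. by move=> A; apply/matrixP => i j; rewrite !mxE conjcK. Qed.

(** The square of the Hilbert-Schmidt norm. *)
Definition hs m n (A : 'M[C]_(m, n)) : R := \sum_i \sum_j nrm (A i j) ^+ 2.

Lemma hs_ge0 m n (A : 'M[C]_(m, n)) : 0 <= hs A.
Proof. by apply: sumr_ge0 => i _; apply: sumr_ge0 => j _; exact: sqr_ge0. Qed.

Lemma hs_entry m n (A : 'M[C]_(m, n)) i j : nrm (A i j) ^+ 2 <= hs A.
Proof.
rewrite /hs (bigD1 i)//= (bigD1 j)//= -addrA lerDl.
apply: addr_ge0; first by apply: sumr_ge0 => k _; exact: sqr_ge0.
by apply: sumr_ge0 => k _; apply: sumr_ge0 => l _; exact: sqr_ge0.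
Qed.

Lemma hs0 m n : hs (0 : 'M[C]_(m, n)) = 0.
Proof. by rewrite /hs big1// => i _; rewrite big1// => j _; rewrite mxE nrm0 expr0n. Qed.

Lemma hs_adj m n (A : 'M[C]_(m, n)) : hs (adj A) = hs A.
Proof.
rewrite /hs exchange_big /=; apply: eq_bigr => i _; apply: eq_bigr => j _.
by rewrite !mxE nrmJ.
Qed.

Lemma hs_tr m n (A : 'M[C]_(m, n)) : (hs A)%:C = \tr (A *m adj A).
Proof.
rewrite /hs rmorph_sum /=; apply: eq_bigr => i _; rewrite rmorph_sum mxE /=.
by apply: eq_bigr => j _; rewrite !mxE -nrm2E.
Qed.

Lemma hs_mulr_unitary m n (A : 'M[C]_(m, n)) (U : 'M[C]_n) : U *m adj U = 1%:M -> hs (A *m U) = hs A.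
Proof.
move=> UU; have : (hs (A *m U))%:C = (hs A)%:C.
  by rewrite !hs_tr adjM mulmxA -[A *m U *m _]mulmxA UU mulmx1.
by case.
Qed.

Lemma hs_mull_unitary m n (A : 'M[C]_(m, n)) (U : 'M[C]_m) : adj U *m U = 1%:M -> hs (U *m A) = hs A.
Proof. by move=> UU; rewrite -hs_adj adjM hs_mulr_unitary ?adjK// hs_adj. Qed.

Lemma hsD m n (A B : 'M[C]_(m, n)) : hs (A + B) <= 2 * (hs A + hs B).
Proof.
rewrite /hs -big_split mulr_sumr; apply: ler_sum => i _.
rewrite -big_split mulr_sumr; apply: ler_sum => j _; rewrite mxE /=.
have := ler_nrmD (A i j) (B i j); have := nrm_ge0 (A i j); have := nrm_ge0 (B i j).
have := nrm_ge0 (A i j + B i j); move: (nrm _) (nrm (A i j)) (nrm (B i j)) => c a b c0 b0 a0 cab.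
have : c ^+ 2 <= (a + b) ^+ 2 by rewrite ler_pXn2r// nnegrE addr_ge0.
have := sqr_ge0 (a - b); lra.
Qed.

Lemma char_poly_conj m (U V A : 'M[C]_m) : V *m U = 1%:M -> char_poly (U *m A *m V) = char_poly A.
Proof.
move=> VU; have UV : U *m V = 1%:M by apply: mulmx1C.
rewrite /char_poly /char_poly_mx !map_mxM.
have pc (X Y : 'M[C]_m) : X *m Y = 1%:M -> map_mx polyC X *m map_mx polyC Y = 1%:M.
  by move=> XY; rewrite -map_mxM XY map_mx1.
have -> : 'X%:M - map_mx polyC U *m map_mx polyC A *m map_mx polyC V =
  map_mx polyC U *m ('X%:M - map_mx polyC A) *m map_mx polyC V.
  by rewrite mulmxBr mulmxBl scalar_mxC -[_%:M *m _ *m _]mulmxA (pc _ _ UV) mulmx1.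
by rewrite !det_mulmx mulrAC -det_mulmx (pc _ _ UV) det1 mul1r.
Qed.

Lemma char_poly_eigs m (A : 'M[C]_m) : char_poly A = \prod_(l <- eigs A) ('X - l%:P).
Proof.
rewrite /eigs; case: closed_field_poly_normal => s /= {1}->.
by rewrite (monicP (char_poly_monic A)) scale1r.
Qed.

Lemma schur_form m (A : 'M[C]_m) : exists U T : 'M[C]_m,
  [/\ adj U *m U = 1%:M, A = U *m T *m adj U, is_trig_mx T &
      perm_eq (eigs A) [seq T i i | i <- index_enum 'I_m]].
Proof.
have [m0|m0] := posnP m.
  subst m; exists 1%:M, A; split; rewrite ?flatmx0//.
    by apply/is_trig_mxP => -[].
  apply: prod_XsubC_eq; rewrite -char_poly_eigs big_map.
  by rewrite /char_poly det_mx00 big_ord0.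
have [P /[dup] Pu /unitarymxP PP sP] := Schur A m0.
have {}PP : P *m adj P = 1%:M by [].
exists (adj P), (P *m A *m adj P).
have eA : A = adj P *m (P *m A *m adj P) *m adj (adj P).
  have PP' : adj P *m P = 1%:M by apply: mulmx1C.
  by rewrite adjK !mulmxA PP' mul1mx -mulmxA PP' mulmx1.
have tt : is_trig_mx (P *m A *m adj P) by move: sP; rewrite /similar_to conjymx.
split=> //; first by rewrite adjK.
apply: prod_XsubC_eq; rewrite -char_poly_eigs big_map -(char_poly_trig tt).
by rewrite {1}eA char_poly_conj// adjK.
Qed.

Lemma size_eigs m (A : 'M[C]_m) : size (eigs A) = m.
Proof. by have [U [T [_ _ _ /perm_size->]]] := schur_form A; rewrite size_map [index_enum _]unlock -enumT size_enum_ord. Qed.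

Lemma tr_peval m (P : {poly C}) (A : 'M[C]_m) : \tr (peval P A) = \sum_(l <- eigs A) P.[l].
Proof.
have [U [T [UU -> Tt pe]]] := schur_form A.
rewrite (perm_big _ pe) big_map peval_conj// mxtrace_mulC mulmxA UU mul1mx.
by apply: eq_bigr => i _; rewrite (peval_trig P Tt).2.
Qed.

(** Schur's inequality: after unitary triangularization the eigenvalues of [peval P A] are its
    diagonal entries, which form only part of the Hilbert-Schmidt norm. *)
Lemma sum_eigs_hs m (P : {poly C}) (A : 'M[C]_m) :
  \sum_(l <- eigs A) nrm P.[l] ^+ 2 <= hs (peval P A).
Proof.
have [U [T [UU -> Tt pe]]] := schur_form A.
have UU' : U *m adj U = 1%:M by apply: mulmx1C.
rewrite (perm_big _ pe) big_map peval_conj// hs_mulr_unitary ?adjK//.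
rewrite hs_mull_unitary//; apply: ler_sum => i _.
by rewrite -(peval_trig P Tt).2 (bigD1 i)//= lerDl; apply: sumr_ge0 => j _; exact: sqr_ge0.
Qed.

Lemma eig_hs m (P : {poly C}) (A : 'M[C]_m) l : l \in eigs A -> nrm P.[l] ^+ 2 <= hs (peval P A).
Proof.
move=> lA; apply: le_trans (sum_eigs_hs P A); rewrite (big_rem l)//= lerDl.
by apply: sumr_ge0 => j _; exact: sqr_ge0.
Qed.

(** The weights y^j amount to conjugation by a diagonal matrix. In a lower triangular matrix this
    divides the off-diagonal entries by at least y, so for large y a whole row weighs at most 2r,
    and this bound is multiplicative in powers. *)
Lemma trig_power_bound m (T : 'M[C]_m) (r B y : R) (k : nat) : is_trig_mx T -> 0 <= r -> 1 <= y -> 0 <= B ->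
  m%:R * B <= r * y -> (forall i, nrm (T i i) <= r) -> (forall i j, nrm (T i j) <= B) ->
  forall i, \sum_j nrm ((T ^+ k) i j) * y ^+ j <= (2 * r) ^+ k * y ^+ i.
Proof.
move=> /is_trig_mxP Tt r0 y1 B0 mB Td Tb; have y0 : 0 <= y by apply: le_trans y1.
have row i : \sum_j nrm (T i j) * y ^+ j <= 2 * r * y ^+ i.
  have -> : 2 * r * y ^+ i = r * y ^+ i + r * y ^+ i by ring.
  rewrite (bigD1 i)//=; apply: lerD; first by apply: ler_wpM2r; rewrite ?exprn_ge0.
  have [i0|i0] := posnP i.
    rewrite big1; first by rewrite mulr_ge0// exprn_ge0.
    move=> j ji; rewrite Tt ?nrm0 ?mul0r// i0 lt0n; apply: contraNneq ji => j0.
    by apply/eqP/val_inj; rewrite /= j0 i0.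
  apply: (@le_trans _ _ (\sum_(j < m) B * y ^+ i.-1)).
    rewrite [leRHS](bigD1 i)//= -[leLHS]add0r; apply: lerD; first by rewrite mulr_ge0// exprn_ge0.
    apply: ler_sum => j ji; case: (ltngtP i j) => [ij|ij|/val_inj ij].
    - by rewrite Tt// nrm0 mul0r mulr_ge0// exprn_ge0.
    - apply: ler_pM; rewrite ?nrm_ge0 ?exprn_ge0//.
      by apply: ler_weXn2l; rewrite // -ltnS prednK.
    - by rewrite ij eqxx in ji.
  rewrite sumr_const card_ord -[_ *+ m]mulr_natl mulrA.
  have -> : r * y ^+ i = r * y * y ^+ i.-1 by rewrite -mulrA -exprS prednK.
  by apply: ler_wpM2r; rewrite ?exprn_ge0.
elim: k => [|k IH] i.
  rewrite !expr0 mul1r (bigD1 i)//= mxE eqxx nrm1 mul1r big1 ?addr0// => j ji.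
  by rewrite mxE eq_sym (negbTE ji) nrm0 mul0r.
apply: (@le_trans _ _ (\sum_l nrm (T i l) * \sum_j nrm ((T ^+ k) l j) * y ^+ j)).
  under [leRHS]eq_bigr do rewrite mulr_sumr.
  rewrite exchange_big /=; apply: ler_sum => j _.
  rewrite expSmx mxE; under [leRHS]eq_bigr do rewrite mulrA.
  rewrite -mulr_suml; apply: ler_wpM2r; first exact: exprn_ge0.
  by apply: le_trans (ler_nrm_sum _ _ _) _; apply: ler_sum => l _; rewrite nrmM.
apply: (@le_trans _ _ (\sum_l nrm (T i l) * ((2 * r) ^+ k * y ^+ l))).
  by apply: ler_sum => l _; apply: ler_wpM2l; rewrite ?nrm_ge0.
under eq_bigr do rewrite mulrCA.
rewrite -mulr_sumr exprSr -[in leRHS]mulrA; apply: ler_wpM2l; first by rewrite exprn_ge0// mulr_ge0.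
exact: row.
Qed.

(** [K] depends only on the size, [B] and [r], so the decay is uniform over all values of a bounded
    symbol. The factor 2 in front of [r] pays for non-normality. *)
Lemma power_bound m (B r : R) : 0 < r -> 0 <= B -> exists2 K : R, 0 <= K &
  forall (A : 'M[C]_m), hs A <= B ^+ 2 -> (forall l, l \in eigs A -> nrm l <= r) ->
  forall k, hs (A ^+ k) <= K * (2 * r) ^+ (2 * k).
Proof.
move=> r0 B0; pose y := Num.max 1 (m%:R * B / r).
have y1 : 1 <= y by rewrite le_max lexx.
have y0 : 0 <= y by apply: le_trans y1.
exists (\sum_(i < m) \sum_(j < m) (y ^+ i) ^+ 2) => [|A hA eA k].
  by apply: sumr_ge0 => i _; apply: sumr_ge0 => j _; exact: sqr_ge0.
have [U [T [UU eT Tt pe]]] := schur_form A.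
have UU' : U *m adj U = 1%:M by apply: mulmx1C.
have hsk j : hs (A ^+ j) = hs (T ^+ j).
  by rewrite -!peval_Xn eT peval_conj// hs_mulr_unitary ?adjK// hs_mull_unitary.
have Tb i j : nrm (T i j) <= B.
  rewrite -(@ler_pXn2r _ 2)// ?nnegrE ?nrm_ge0//; apply: le_trans (hs_entry _ _ _) _.
  by have := hsk 1%N; rewrite !expr1 => <-.
have Td i : nrm (T i i) <= r by apply: eA; rewrite (perm_mem pe); apply/mapP; exists i; rewrite ?mem_index_enum.
have mB : m%:R * B <= r * y.
  by rewrite [r * y]mulrC -ler_pdivrMr// le_max lexx orbT.
have key := trig_power_bound k Tt (ltW r0) y1 B0 mB Td Tb.
rewrite hsk /hs mulr_suml; apply: ler_sum => i _; rewrite mulr_suml; apply: ler_sum => j _.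
rewrite mulnC exprM -exprMn ler_pXn2r// ?nnegrE ?nrm_ge0 ?mulr_ge0 ?exprn_ge0 ?mulr_ge0 ?(ltW r0)//.
rewrite mulrC; apply: le_trans (key i); rewrite (bigD1 j)//=.
apply: (@le_trans _ _ (nrm ((T ^+ k) i j) * y ^+ j)); last first.
  by rewrite lerDl; apply: sumr_ge0 => l _; rewrite mulr_ge0 ?nrm_ge0 ?exprn_ge0.
by apply: ler_peMr; rewrite ?nrm_ge0// exprn_ege1.
Qed.

(** The assumption is an operator norm bound, iterated to |l|^(2k) <= M^(2k) hs(1). The factor
    hs(1), which depends on the dimension, is beaten by large k. *)
Lemma eig_op_bound m (A : 'M[C]_m) (M : R) : 0 <= M -> (forall X : 'M[C]_m, hs (A *m X) <= M ^+ 2 * hs X) ->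
  forall l, l \in eigs A -> nrm l <= M.
Proof.
move=> M0 hM l lA.
have hk k : hs (A ^+ k) <= (M ^+ 2) ^+ k * hs (1%:M : 'M[C]_m).
  elim: k => [|k IH]; first by rewrite !expr0 mul1r.
  by rewrite expSmx; apply: le_trans (hM _) _; rewrite [_ ^+ k.+1]exprS -mulrA; apply: ler_wpM2l; rewrite ?sqr_ge0.
have lk k : (nrm l ^+ 2) ^+ k <= (M ^+ 2) ^+ k * hs (1%:M : 'M[C]_m).
  apply: le_trans (hk k); have := eig_hs 'X^k lA.
  by rewrite hornerXn peval_Xn nrmX -!exprM mulnC.
rewrite -(@ler_pXn2r _ 2)// ?nnegrE ?nrm_ge0// leNgt; apply/negP => Ml.
have M20 : 0 <= M ^+ 2 by exact: sqr_ge0.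
have l0 : 0 < nrm l ^+ 2 by apply: le_lt_trans Ml.
have q01 : 0 <= M ^+ 2 / nrm l ^+ 2 < 1.
  by rewrite divr_ge0 ?(ltW l0)//= ltr_pdivrMr// mul1r.
set H := hs _ in lk *; have H0 : 0 <= H by exact: hs_ge0.
have iH : 0 < (H + 1)^-1 by rewrite invr_gt0; lra.
have [k hk'] := exists_expr_lt q01 iH.
have := lk k; rewrite leNgt => /negP; apply.
have lk0 : 0 < (nrm l ^+ 2) ^+ k by exact: exprn_gt0.
have mk0 : 0 <= (M ^+ 2) ^+ k by exact: exprn_ge0.
have : (M ^+ 2) ^+ k * (H + 1) < (nrm l ^+ 2) ^+ k.
  rewrite -ltr_pdivlMr; last by lra.
  by rewrite mulrC -ltr_pdivrMr// -expr_div_n.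
apply: le_lt_trans; apply: ler_wpM2l => //; lra.
Qed.
End MatrixPolynomials.

Lemma floor_grid_dist (R : realType) (k : nat) (x : R) :
  `|x - (Num.floor (k.+1%:R * x))%:~R / k.+1%:R| <= k.+1%:R^-1.
Proof.
have k0 : 0 < k.+1%:R :> R by [].
have /andP[a] := floor_itv (k.+1%:R * x); rewrite intrD => /ltW b.
rewrite ler_norml lerNl opprB; apply/andP; split.
  by rewrite lerBlDr ler_pdivrMr// mulrDl mulVf ?gt_eqF// [x * _]mulrC; apply: le_trans a _; rewrite lerDr.
by rewrite lerBlDr addrC -[X in _ + X]mul1r -mulrDl ler_pdivlMr// mulrC.
Qed.

(** * Continuity and measurability of symmetric functions of the eigenvalues *)

Section EigenvalueContinuity.
Variable R : realType.
Local Notation C := (Cx R).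

Lemma interpolation (s : seq C) (f : C -> C) : exists P : {poly C}, forall l, l \in s -> P.[l] = f l.
Proof.
elim: s => [|l s [P HP]]; first by exists 0.
have [ls|ls] := boolP (l \in s).
  by exists P => x; rewrite inE => /predU1P[->|]; exact: HP.
pose q : {poly C} := \prod_(x <- s) ('X - x%:P).
have ql : q.[l] != 0 by have := root_prod_XsubC s l; rewrite (negbTE ls) => /negbT.
exists (P + ((f l - P.[l]) / q.[l]) *: q) => x; rewrite inE !hornerE.
move=> /predU1P[->|xs]; first by rewrite divfK// addrC subrK.
have -> : q.[x] = 0 by apply/rootP; rewrite root_prod_XsubC.
by rewrite mulr0 addr0 HP.
Qed.

(** A small product has a small factor, so [w] is close to one of the listed zeros of [h]. *)
Lemma small_near_roots (s : seq C) (h : C -> R) (e : R) : ccont h -> (forall l, l \in s -> h l = 0) ->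
  0 < e -> exists2 r : R, 0 < r & forall w, nrm (\prod_(l <- s) (w - l)) <= r -> `|h w| <= e.
Proof.
move=> ch; elim: s => [|l s IH] hs0 e0.
  exists (2^-1) => [|w]; first by rewrite invr_gt0.
  by rewrite big_nil nrm1; lra.
have [x xs||r r0 Hr] := IH; rewrite ?hs0 ?inE ?xs ?orbT//.
have [d d0 Hd] := ch l e e0.
exists (d * r) => [|w]; first by rewrite mulr_gt0.
rewrite big_cons nrmM => H; have [wl|wl] := ltrP (nrm (w - l)) d.
  by have := Hd w wl; rewrite (hs0 l) ?mem_head// subr0 => /ltW.
apply: Hr; rewrite -(ler_pM2l d0); apply: le_trans H.
by apply: ler_wpM2r; rewrite ?nrm_ge0.
Qed.

Section Convergence.
Variables (I : Type) (F : set_system I).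
Context {FF : Filter F}.

Definition mtends m (An : I -> 'M[C]_m) (A : 'M[C]_m) :=
  forall i j, tends0 F (fun n => nrm (An n i j - A i j)).

Lemma tends0M (a b : I -> R) : tends0 F a -> tends0 F b -> tends0 F (fun n => a n * b n).
Proof.
move=> ta tb e e0; apply: filterS2 (ta _ e0) (tb _ ltr01) => n an bn.
by rewrite normrM -[e]mulr1; apply: ler_pM.
Qed.

Lemma mtends_cst m (A : 'M[C]_m) : mtends (fun=> A) A.
Proof.
move=> i j; apply: tends0_le (tends0_cst0 (F := F)) => n.
by rewrite subrr nrm0 normr0.
Qed.

Lemma mtendsM m (An Bn : I -> 'M[C]_m) (A B : 'M[C]_m) : mtends An A -> mtends Bn B ->
  mtends (fun n => An n *m Bn n) (A *m B).
Proof.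
move=> tA tB i j.
apply: (@tends0_le _ _ _ _ _ (fun n => \sum_k (nrm (An n i k - A i k) * nrm (Bn n k j - B k j) +
   (nrm (B k j) * nrm (An n i k - A i k) + nrm (A i k) * nrm (Bn n k j - B k j))))) => [n|].
  rewrite ger0_norm ?nrm_ge0// !mxE -sumrB; apply: le_trans (ler_nrm_sum _ _ _) _.
  apply: ler_sum => k _; rewrite -!nrmM.
  have -> : An n i k * Bn n k j - A i k * B k j = (An n i k - A i k) * (Bn n k j - B k j) +
    (B k j * (An n i k - A i k) + A i k * (Bn n k j - B k j)) by ring.
  apply: le_trans (ler_nrmD _ _) _; rewrite lerD2l; exact: ler_nrmD.
apply: tends0_sum => k _; apply: tends0D; first exact: tends0M.
by apply: tends0D; apply: tends0Z.
Qed.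

Lemma mtends_sum m p (An : 'I_p -> I -> 'M[C]_m) (A : 'I_p -> 'M[C]_m) (c : 'I_p -> C) :
  (forall i, mtends (An i) (A i)) ->
  mtends (fun n => \sum_i c i *: An i n) (\sum_i c i *: A i).
Proof.
move=> tA i j; apply: (@tends0_le _ _ _ _ _ (fun n => \sum_k nrm (c k) * nrm (An k n i j - A k i j))) => [n|].
  rewrite ger0_norm ?nrm_ge0// !summxE -sumrB; apply: le_trans (ler_nrm_sum _ _ _) _.
  by apply: ler_sum => k _; rewrite !mxE -nrmM mulrBr.
by apply: tends0_sum => k _; apply: tends0Z; exact: tA.
Qed.

Lemma mtends_peval m (P : {poly C}) (An : I -> 'M[C]_m) (A : 'M[C]_m) : mtends An A ->
  mtends (fun n => peval P (An n)) (peval P A).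
Proof.
move=> tA; apply: mtends_sum => k; elim: (nat_of_ord k) => [|j IH]; first exact: mtends_cst.
rewrite (_ : (fun n => _) = (fun n => An n *m An n ^+ j)); last by apply/funext => n; rewrite expSmx.
by rewrite expSmx; exact: mtendsM.
Qed.

Lemma mtends_hs m (An : I -> 'M[C]_m) : mtends An 0 -> tends0 F (fun n => hs (An n)).
Proof.
move=> tA; apply: tends0_sum => i _; apply: tends0_sum => j _.
rewrite (_ : (fun n => _) = (fun n => nrm (An n i j - 0) * nrm (An n i j - 0))).
  by have := tA i j; rewrite mxE => t; exact: tends0M.
by apply/funext => n; rewrite subr0 expr2.
Qed.

Lemma mtends_tr m (An : I -> 'M[C]_m) (A : 'M[C]_m) : mtends An A ->
  tends0 F (fun n => complex.Re (\tr (An n)) - complex.Re (\tr A)).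
Proof.
move=> tA; apply: (@tends0_le _ _ _ _ _ (fun n => \sum_i nrm (An n i i - A i i))) => [n|].
  rewrite -cReB; apply: le_trans (ler_Re _) _; rewrite /mxtrace -sumrB; exact: ler_nrm_sum.
by apply: tends0_sum => i _; exact: tA.
Qed.

(* On the eigenvalues of A a real function agrees with an interpolation polynomial P, whose sums over
   eigenvalues are traces; the eigenvalues of A_n are nearly roots of the characteristic polynomial of A. *)
Lemma mtends_eigs m (An : I -> 'M[C]_m) (A : 'M[C]_m) (f : C -> R) : ccont f -> mtends An A ->
  tends0 F (fun n => \sum_(l <- eigs (An n)) f l - \sum_(l <- eigs A) f l).
Proof.
move=> cf tA.
have [P HP] := interpolation (eigs A) (fun l => (f l)%:C).
pose h w := f w - complex.Re P.[w].
have ch : ccont h by apply: ccontB => //; exact: (ccont_poly_ReIm P).1.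
have h0 l : l \in eigs A -> h l = 0 by move=> lA; rewrite /h HP// subrr.
have eh (B : 'M[C]_m) : \sum_(l <- eigs B) f l = \sum_(l <- eigs B) h l + complex.Re (\tr (peval P B)).
  by rewrite tr_peval cRe_sum -big_split; apply: eq_bigr => l _; rewrite /= subrK.
have hA : \sum_(l <- eigs A) h l = 0 by rewrite big_seq big1.
rewrite (_ : (fun n => _) = fun n => \sum_(l <- eigs (An n)) h l +
    (complex.Re (\tr (peval P (An n))) - complex.Re (\tr (peval P A)))); last first.
  have aux (a b c u v w : R) : a = c + u -> b = w + v -> w = 0 -> a - b = c + (u - v).
    by move=> -> -> ->; rewrite add0r addrA.
  by apply/funext => n; exact: aux (eh (An n)) (eh A) hA.
apply: tends0D; last exact/mtends_tr/mtends_peval.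
move=> e e0; have em : 0 < e / (m%:R + 1) by rewrite divr_gt0// ltr_wpDl.
have [r r0 Hr] := small_near_roots ch h0 em.
(* By Cayley-Hamilton the characteristic polynomial of [A], evaluated at [An n], tends to 0; its
   Hilbert-Schmidt norm bounds its value at each eigenvalue of [An n]. *)
have CH : peval (char_poly A) A = 0.
  case: (m) A {tA HP h0 Hr eh hA} => [|k] A; first by apply/matrixP => -[].
  by rewrite peval_horner; exact: Cayley_Hamilton.
have : mtends (fun n => peval (char_poly A) (An n)) 0 by rewrite -CH; exact: mtends_peval.
move=> /mtends_hs /(_ (r ^+ 2)); rewrite exprn_gt0// => /(_ isT); apply: filterS => n.
rewrite ger0_norm ?hs_ge0// => H.
apply: le_trans (ler_norm_sum _ _ _) _.
apply: (@le_trans _ _ (\sum_(l <- eigs (An n)) e / (m%:R + 1))).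
  rewrite !big_seq; apply: ler_sum => l ln; apply: Hr.
  rewrite -(@ler_pXn2r _ 2) ?nnegrE ?nrm_ge0 ?(ltW r0)//; apply: le_trans H.
  apply: le_trans (eig_hs _ ln); rewrite char_poly_eigs horner_prod.
  by under eq_bigr do rewrite -[_ - _]hornerXsubC.
rewrite big_const_seq count_predT size_eigs iter_addr_0 -[_ *+ m]mulr_natl mulrC mulrAC.
rewrite ler_pdivrMr ?ltr_wpDl//; apply: ler_wpM2l; first exact: ltW.
by rewrite lerDl.
Qed.
End Convergence.

Section Measurability.
Context (d : measure_display) (T : measurableType d).

Lemma measurable_countable_comp (J : countType) (v : T -> J) (phi : J -> R) :
  (forall j, measurable [set t | v t = j]) -> measurable_fun setT (fun t => phi (v t)).
Proof.
move=> mv _ Y _; rewrite setTI.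
rewrite (_ : _ @^-1` _ = \bigcup_j [set t | v t = j /\ Y (phi j)]).
  apply: countable_bigcupT_measurable => // j; have [Yj|Yj] := EM (Y (phi j)).
    by rewrite (_ : [set t | _] = [set t | v t = j])//; apply/seteqP; split=> t //= -[].
  by rewrite (_ : [set t | _] = set0)//; apply/seteqP; split=> t //= -[].
by apply/seteqP; split=> [t /= Yt|t [j _ [<-]]//]; exists (v t).
Qed.

Lemma measurable_floor_fiber (x : T -> R) (z : int) : measurable_fun setT x ->
  measurable [set t | Num.floor (x t) = z].
Proof.
move=> mx; rewrite (_ : [set t | _] = setT `&` x @^-1` `[z%:~R, (z + 1)%:~R[).
  exact: (mx measurableT _ (measurable_itv _)).
rewrite setTI; apply/seteqP; split=> t /=; rewrite in_itv /=; first by move=> <-; exact: floor_itv.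
exact: floor_def.
Qed.

(** [eigs] lists the roots in an arbitrary order, so measurability comes from continuity of
    symmetric sums: rounding the entries to a grid gives functions with countably many values, and
    these converge pointwise. *)
Lemma measurable_eigs_sum m (G : T -> 'M[C]_m) (f : C -> R) : ccont f ->
  (forall i j, measurable_fun setT (fun t => complex.Re (G t i j)) /\
               measurable_fun setT (fun t => complex.Im (G t i j))) ->
  measurable_fun setT (fun t => \sum_(l <- eigs (G t)) f l).
Proof.
move=> cf mG.
pose fl (k : nat) (x : R) : int := Num.floor (k.+1%:R * x).
pose v k t : 'M[int * int]_m := \matrix_(i, j) (fl k (complex.Re (G t i j)), fl k (complex.Im (G t i j))).
pose mat k (V : 'M[int * int]_m) : 'M[C]_m :=
  \matrix_(i, j) ((V i j).1%:~R / k.+1%:R +i* ((V i j).2%:~R / k.+1%:R)).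
apply: (@measurable_fun_cvg _ _ _ _ (fun k t => \sum_(l <- eigs (mat k (v k t))) f l)).
  move=> k; apply: (@measurable_countable_comp _ (v k) (fun V => \sum_(l <- eigs (mat k V)) f l)) => V.
  rewrite (_ : [set t | _] = \bigcap_(p in [set: 'I_m * 'I_m])
     ([set t | fl k (complex.Re (G t p.1 p.2)) = (V p.1 p.2).1] `&`
      [set t | fl k (complex.Im (G t p.1 p.2)) = (V p.1 p.2).2])).
    apply: fin_bigcap_measurable; first exact: finite_finset.
    move=> p _; apply: measurableI; apply: measurable_floor_fiber; apply: measurable_funM => //.
      by have [] := mG p.1 p.2.
    by have [] := mG p.1 p.2.
  apply/seteqP; split=> [t /= tV [i j] _ /=|t H /=]; first by rewrite -tV !mxE.
  apply/matrixP => i j; rewrite mxE; have [/= -> ->] := H (i, j) Logic.I.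
  by case: (V i j).
move=> t _; have flk k x : `|(fl k x)%:~R / k.+1%:R - x| <= k.+1%:R^-1.
  by rewrite distrC; exact: floor_grid_dist.
have : mtends \oo (fun k => mat k (v k t)) (G t).
  move=> i j; apply: (@tends0_le _ _ _ _ _ (fun k => k.+1%:R^-1 + k.+1%:R^-1)) => [k|].
    rewrite ger0_norm ?nrm_ge0//; apply: le_trans (ler_nrm_ReIm _) _.
    by rewrite cReB cImB !mxE /=; apply: lerD; exact: flk.
  have h : tends0 \oo (fun k : nat => k.+1%:R^-1 : R).
    move=> e e0; have [N HN] := exists_natr_gt e^-1.
    near=> k; rewrite ger0_norm ?invr_ge0// invf_ple ?posrE//.
    apply: le_trans (ltW HN) _; rewrite ler_nat; apply: leqW; near: k; exact: nbhs_infty_ge.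
  exact: tends0D.
by move=> /(mtends_eigs cf) H; apply/cvgrPdistC_le.
Unshelve. all: by end_near. Qed.
End Measurability.
End EigenvalueContinuity.

(** * Block Toeplitz matrices *)

Section Fourier.
Variables (R : realType) (d : nat).
Local Notation C := (Cx R).
Local Notation T := (d.-tuple R).
Local Notation freq := {ffun 'I_d -> int}.
Implicit Types (f g : T -> C) (k l : freq).

Definition fhat f k : C := ctorus (fun t => f t * conjc (ek k t)).

Lemma cbmf_fhat f k : cbmf f -> cbmf (fun t => f t * conjc (ek k t)).
Proof. by move=> bf; apply: cbmfM => //; apply: cbmfJ; exact: cbmf_ek. Qed.

Lemma sqnE f : (sqn f)%:C = ctorus (fun t => f t * conjc (f t)).
Proof. by rewrite -ctorus_real; congr ctorus; apply/funext => t; rewrite nrm2E. Qed.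

Lemma fhat_ek k l : fhat (ek k) l = (k == l)%:R.
Proof.
rewrite /fhat (_ : (fun t => _) = ek (fun j => k j - l j)); last first.
  by apply/funext => t; rewrite conjc_ek -ekD.
rewrite ctorus_ek; congr (_%:R); congr nat_of_bool.
by apply/forallP/eqP => [H|-> j]; [apply/ffunP => j; apply/eqP; rewrite -subr_eq0|rewrite subrr].
Qed.

Lemma fhatZ c f k : cbmf f -> fhat (fun t => c * f t) k = c * fhat f k.
Proof.
move=> bf; rewrite /fhat -ctorusZ; last exact: cbmf_fhat.
by congr ctorus; apply/funext => t; rewrite mulrA.
Qed.

Lemma fhat_sum (I : Type) (r : seq I) (P : pred I) (F : I -> T -> C) k :
  (forall i, P i -> cbmf (F i)) ->
  fhat (fun t => \sum_(i <- r | P i) F i t) k = \sum_(i <- r | P i) fhat (F i) k.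
Proof.
move=> bF; rewrite /fhat -ctorus_sum; last by move=> i /bF /cbmf_fhat.
by congr ctorus; apply/funext => t; rewrite mulr_suml.
Qed.

Lemma fhatB f g k : cbmf f -> cbmf g -> fhat (fun t => f t - g t) k = fhat f k - fhat g k.
Proof.
move=> bf bg; rewrite /fhat -ctorusB; [|exact: cbmf_fhat..].
by congr ctorus; apply/funext => t; rewrite mulrBl.
Qed.

Section TrigSums.
Variables (U : finType) (P : pred U) (fr : U -> freq).
Hypothesis fr_inj : forall u v, P u -> P v -> fr u = fr v -> u = v.

Definition tsum (x : U -> C) (t : T) : C := \sum_(u | P u) x u * ek (fr u) t.

Lemma cbmf_tsum x : cbmf (tsum x).
Proof. by apply: cbmf_sum => u _; apply: cbmfZ; exact: cbmf_ek. Qed.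

Lemma fhat_tsum x v : P v -> fhat (tsum x) (fr v) = x v.
Proof.
move=> Pv; rewrite fhat_sum; last by move=> u _; apply: cbmfZ; exact: cbmf_ek.
rewrite (bigD1 v)//= fhatZ; last exact: cbmf_ek.
rewrite fhat_ek eqxx mulr1 big1 ?addr0// => u /andP[Pu uv].
rewrite fhatZ; last exact: cbmf_ek.
rewrite fhat_ek; case: eqP => [/(fr_inj Pu Pv) e|]; last by rewrite mulr0.
by rewrite e eqxx in uv.
Qed.

Lemma ctorus_mul_conj_tsum f x : cbmf f ->
  ctorus (fun t => f t * conjc (tsum x t)) = \sum_(u | P u) conjc (x u) * fhat f (fr u).
Proof.
move=> bf; rewrite (_ : (fun t => _) = fun t => \sum_(u | P u) conjc (x u) * (f t * conjc (ek (fr u) t))).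
  rewrite ctorus_sum; last by move=> u _; apply: cbmfZ; exact: cbmf_fhat.
  by apply: eq_bigr => u _; rewrite ctorusZ//; exact: cbmf_fhat.
apply/funext => t; rewrite /tsum rmorph_sum mulr_sumr; apply: eq_bigr => u _.
by rewrite rmorphM mulrCA.
Qed.

Lemma sqn_tsum x : sqn (tsum x) = \sum_(u | P u) nrm (x u) ^+ 2.
Proof.
suff : (sqn (tsum x))%:C = (\sum_(u | P u) nrm (x u) ^+ 2)%:C by case.
rewrite sqnE ctorus_mul_conj_tsum; last exact: cbmf_tsum.
rewrite rmorph_sum; apply: eq_bigr => u Pu.
by rewrite fhat_tsum// mulrC -nrm2E.
Qed.

Lemma bessel f : cbmf f -> \sum_(u | P u) nrm (fhat f (fr u)) ^+ 2 <= sqn f.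
Proof.
move=> bf; pose S := tsum (fun u => fhat f (fr u)); have bS : cbmf S := cbmf_tsum _.
have : 0 <= sqn (fun t => f t - S t) := sqn_ge0 _.
suff -> : sqn (fun t => f t - S t) = sqn f - \sum_(u | P u) nrm (fhat f (fr u)) ^+ 2 by rewrite subr_ge0.
have bfS := cbmfB bf bS.
suff : (sqn (fun t => f t - S t))%:C = (sqn f)%:C - (\sum_(u | P u) nrm (fhat f (fr u)) ^+ 2)%:C.
  by rewrite -rmorphB => -[].
rewrite !sqnE (_ : (fun t => _) = fun t => (f t - S t) * conjc (f t) - (f t - S t) * conjc (S t)); last first.
  by apply/funext => t; rewrite rmorphB mulrBr.
rewrite ctorusB; [|by apply: cbmfM => //; exact: cbmfJ..].
rewrite ctorus_mul_conj_tsum// [X in _ - X]big1 ?subr0; last first.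
  by move=> u Pu; rewrite fhatB// fhat_tsum// subrr mulr0.
rewrite (_ : (fun t => _) = fun t => f t * conjc (f t) - conjc (f t * conjc (S t))); last first.
  by apply/funext => t; rewrite mulrBl rmorphM /= conjcK [S t * _]mulrC.
rewrite ctorusB; [|by apply: cbmfM => //; exact: cbmfJ|by apply/cbmfJ/cbmfM => //; exact: cbmfJ].
rewrite ctorusJ; last by apply: cbmfM => //; exact: cbmfJ.
congr (_ - _); rewrite ctorus_mul_conj_tsum// !rmorph_sum; apply: eq_bigr => u _.
by rewrite mulrC -nrm2E; apply: Cext; rewrite /= ?oppr0.
Qed.
End TrigSums.
End Fourier.

(** * Block Toeplitz matrices as compressions of multiplication operators *)

Section BlockToeplitz.
Variables (R : realType) (d m D : nat).
Local Notation C := (Cx R).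
Local Notation T := (d.-tuple R).
Local Notation freq := {ffun 'I_d -> int}.
Variables (fr : 'I_D -> freq) (cp : 'I_D -> 'I_m).
Hypothesis fr_cp_inj : forall u v, cp u = cp v -> fr u = fr v -> u = v.
Implicit Types (H K : T -> 'M[C]_m).

Definition mcbmf H := forall i j, cbmf (fun t => H t i j).

(** The compression of multiplication by [H] to the span of the functions [ek (fr v)] times the
    [cp v]-th basis vector, orthonormal by [fr_cp_inj]. Rows and columns are identified by their
    labels, so any ordering of the indices is covered and no permutation matrix is needed. *)
Definition BT H : 'M[C]_D := \matrix_(u, v) fhat (fun t => H t (cp u) (cp v) * ek (fr v) t) (fr u).

Definition ihs H : R := torus_int (fun t => hs (H t)).

Lemma bmf_hs H : mcbmf H -> bmf (fun t => hs (H t)).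
Proof. by move=> bH; apply: bmf_sum => i _; apply: bmf_sum => j _; exact: bmf_nrm2. Qed.

Lemma ihsE H : mcbmf H -> ihs H = \sum_p \sum_q sqn (fun t => H t p q).
Proof.
move=> bH; rewrite /ihs torus_int_sum; last by move=> i _; apply: bmf_sum => j _; exact: bmf_nrm2.
by apply: eq_bigr => i _; rewrite torus_int_sum// => j _; exact: bmf_nrm2.
Qed.

Lemma ihs_ge0 H : 0 <= ihs H.
Proof. by apply: torus_int_ge0 => t; exact: hs_ge0. Qed.

Lemma cbmf_entry_ek H p q (k : freq) : mcbmf H -> cbmf (fun t => H t p q * ek k t).
Proof. by move=> bH; apply: cbmfM => //; exact: cbmf_ek. Qed.

Lemma block_bessel (g : 'I_m -> T -> C) : (forall p, cbmf (g p)) ->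
  \sum_u nrm (fhat (g (cp u)) (fr u)) ^+ 2 <= \sum_p sqn (g p).
Proof.
move=> bg; rewrite (partition_big cp predT)//=; apply: ler_sum => p _.
rewrite (eq_bigr (fun u => nrm (fhat (g p) (fr u)) ^+ 2)); last by move=> u /eqP->.
by apply: bessel => // u v /eqP cu /eqP cv; apply: fr_cp_inj; rewrite cu.
Qed.

Lemma BT_col_hs H v : mcbmf H ->
  \sum_u nrm (BT H u v) ^+ 2 <= \sum_p sqn (fun t => H t p (cp v)).
Proof.
move=> bH; under eq_bigr do rewrite mxE.
apply: le_trans (block_bessel (fun p => cbmf_entry_ek p (cp v) (fr v) bH)) _.
apply: ler_sum => p _; rewrite [leRHS](_ : _ = sqn (fun t => H t p (cp v) * ek (fr v) t))//.
by congr torus_int; apply/funext => t; rewrite nrmM nrm_ek mulr1.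
Qed.

Lemma hs_BT H : mcbmf H -> hs (BT H) <= D%:R * ihs H.
Proof.
move=> bH; rewrite /hs exchange_big /= -[D in D%:R]card_ord -sum1_card natr_sum mulr_suml.
apply: ler_sum => v _; rewrite mul1r; apply: le_trans (BT_col_hs v bH) _.
rewrite ihsE// exchange_big /= [leRHS](bigD1 (cp v))//= lerDl.
by apply: sumr_ge0 => q _; apply: sumr_ge0 => p _; exact: sqn_ge0.
Qed.

Lemma cauchy_schwarz_sum (I : finType) (a b : I -> C) :
  nrm (\sum_i a i * b i) ^+ 2 <= (\sum_i nrm (a i) ^+ 2) * (\sum_i nrm (b i) ^+ 2).
Proof.
have key : (\sum_i nrm (a i) * nrm (b i)) ^+ 2 <= (\sum_i nrm (a i) ^+ 2) * (\sum_i nrm (b i) ^+ 2).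
  rewrite expr2 !big_distrlr /= -(ler_pM2l (ltr0Sn R 1)).
  rewrite [leRHS]mulr_natl mulr2n [X in _ <= _ + X]exchange_big /= -big_split mulr_sumr.
  apply: ler_sum => i _; rewrite -big_split mulr_sumr; apply: ler_sum => j _ /=.
  have := sqr_ge0 (nrm (a i) * nrm (b j) - nrm (a j) * nrm (b i)).
  move: (nrm (a i)) (nrm (b i)) (nrm (a j)) (nrm (b j)) => x y z w; lra.
apply: le_trans key; rewrite ler_pXn2r// ?nnegrE ?nrm_ge0//; last first.
  by apply: sumr_ge0 => i _; rewrite mulr_ge0 ?nrm_ge0.
by apply: le_trans (ler_nrm_sum _ _ _) _; apply: ler_sum => i _; rewrite nrmM.
Qed.

(** A column of [X] encodes a vector of trigonometric polynomials [x]; the column of the product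
    lists Fourier coefficients of [H x]. Bessel removes the truncation and Cauchy-Schwarz bounds
    [H x] pointwise. *)
Lemma BT_op_bound H B c (X : 'M[C]_(D, c)) : mcbmf H -> (forall t, hs (H t) <= B) ->
  hs (BT H *m X) <= B * hs X.
Proof.
move=> bH HB; rewrite /hs exchange_big [in leRHS]exchange_big mulr_sumr /=; apply: ler_sum => j _.
pose x q := tsum (fun v => cp v == q) fr (fun v => X v j).
have bx q : cbmf (x q) by exact: cbmf_tsum.
pose g p t := \sum_q H t p q * x q t.
have bg p : cbmf (g p) by apply: cbmf_sum => q _; exact: cbmfM.
have eg u : (BT H *m X) u j = fhat (g (cp u)) (fr u).
  have -> : g (cp u) = fun t => \sum_v X v j * (H t (cp u) (cp v) * ek (fr v) t).
    apply/funext => t; rewrite /g /x /tsum [RHS](partition_big cp predT)//=; apply: eq_bigr => q _.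
    by rewrite mulr_sumr; apply: eq_bigr => v /eqP->; rewrite mulrCA.
  rewrite fhat_sum; last by move=> v _; apply/cbmfZ/cbmf_entry_ek.
  rewrite mxE; apply: eq_bigr => v _; rewrite fhatZ ?mxE 1?mulrC//; exact: cbmf_entry_ek.
under eq_bigr do rewrite eg.
apply: le_trans (block_bessel bg) _.
have -> : \sum_v nrm (X v j) ^+ 2 = \sum_q sqn (x q).
  rewrite (partition_big cp predT)//=; apply: eq_bigr => q _; rewrite sqn_tsum// => u v /eqP cu /eqP cv.
  by apply: fr_cp_inj; rewrite cu.
rewrite /sqn -!torus_int_sum; [|by move=> i _; exact: bmf_nrm2..].
rewrite -torus_intZ; last by apply: bmf_sum => q _; exact: bmf_nrm2.
apply: torus_int_le; [by apply: bmf_sum => q _; exact: bmf_nrm2| |].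
  by apply: bmfZ; apply: bmf_sum => q _; exact: bmf_nrm2.
move=> t; apply: (@le_trans _ _ (hs (H t) * \sum_q nrm (x q t) ^+ 2)); last first.
  by apply: ler_wpM2r => //; apply: sumr_ge0 => q _; exact: sqr_ge0.
by rewrite /hs mulr_suml; apply: ler_sum => p _; exact: cauchy_schwarz_sum.
Qed.

Lemma BTD H K : mcbmf H -> mcbmf K -> BT (fun t => H t + K t) = BT H + BT K.
Proof.
move=> bH bK; apply/matrixP => u v; rewrite !mxE /fhat -ctorusD.
- by congr ctorus; apply/funext => t; rewrite mxE mulrDl mulrDl.
- by apply: cbmf_fhat; exact: cbmf_entry_ek.
- by apply: cbmf_fhat; exact: cbmf_entry_ek.
Qed.

Lemma BTZ c H : mcbmf H -> BT (fun t => c *: H t) = c *: BT H.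
Proof.
move=> bH; apply/matrixP => u v; rewrite !mxE -fhatZ; last exact: cbmf_entry_ek.
by congr fhat; apply/funext => t; rewrite mxE mulrA.
Qed.

Lemma BT1 : BT (fun=> 1%:M) = 1%:M.
Proof.
apply/matrixP => u v; rewrite !mxE.
rewrite (_ : (fun t => _) = fun t => (cp u == cp v)%:R * ek (fr v) t); last by apply/funext => t; rewrite ?mxE.
rewrite fhatZ; last exact: cbmf_ek.
rewrite fhat_ek -natrM mulnb; congr (_%:R); congr nat_of_bool.
by apply/andP/eqP => [[/eqP c /eqP f]|->//]; exact: fr_cp_inj.
Qed.

Lemma tr_BT H (N : nat) : mcbmf H -> (forall p, #|[pred u | cp u == p]| = N) ->
  \tr (BT H) = N%:R * ctorus (fun t => \tr (H t)).
Proof.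
move=> bH HN; rewrite /mxtrace ctorus_sum; last by move=> i _; exact: bH.
rewrite mulr_sumr (partition_big cp predT)//=; apply: eq_bigr => p _.
rewrite (eq_bigr (fun=> ctorus (fun t => H t p p))); last first.
  move=> u /eqP <-; rewrite mxE /fhat; congr ctorus; apply/funext => t.
  by rewrite -mulrA -nrm2E nrm_ek expr1n mulr1.
by rewrite sumr_const -[_ *+ _]mulr_natl HN.
Qed.

(** The boundary indices of the frequency set in direction [k]; the asymptotic calculus rests on
    their being a vanishing share. *)
Definition bad (q : 'I_m) (k : freq) : pred 'I_D :=
  fun v => ~~ [exists w, (cp w == q) && (fr w == fr v + k)].

Definition defect H K := BT H *m BT K - BT (fun t => H t *m K t).

Definition monom (c : C) (k : freq) (q r : 'I_m) (t : T) : 'M[C]_m := (c * ek k t) *: delta_mx q r.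

Lemma mcbmf_monom c k q r : mcbmf (monom c k q r).
Proof.
move=> i j; apply: (@eq_cbmf _ _ (fun t => ((i == q) && (j == r))%:R * (c * ek k t))).
  by move=> t; rewrite !mxE mulrC.
by do 2 apply: cbmfZ; exact: cbmf_ek.
Qed.

Lemma ek_add (k l : freq) t : ek (k + l) t = ek k t * ek l t :> C.
Proof.
by rewrite -ekD; congr ek; apply/funext => j; rewrite ffunE.
Qed.

Lemma BT_monom c k q r w v :
  BT (monom c k q r) w v = c * [&& cp w == q, cp v == r & fr w == fr v + k]%:R.
Proof.
rewrite mxE (_ : (fun t => _) = fun t => (c * ((cp w == q) && (cp v == r))%:R) * ek (fr v + k) t).
  rewrite fhatZ; last exact: cbmf_ek.
  by rewrite fhat_ek -mulrA -natrM mulnb andbA eq_sym [fr w == _]eq_sym.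
by apply/funext => t; rewrite !mxE ek_add; ring.
Qed.

(* Column v of the defect vanishes unless the frequency of v, shifted by k, leaves the index set. *)
Lemma defect_monom H c k q r : mcbmf H ->
  hs (defect H (monom c k q r)) <= #|bad q k|%:R * (nrm c ^+ 2 * ihs H).
Proof.
move=> bH.
have eB u v : BT (fun t => H t *m monom c k q r t) u v =
    c * (cp v == r)%:R * fhat (fun t => H t (cp u) q * ek (fr v + k) t) (fr u).
  rewrite mxE -fhatZ; last exact: cbmf_entry_ek.
  congr fhat; apply/funext => t; rewrite mxE (bigD1 q)//= big1 ?addr0.
    by rewrite !mxE eqxx ek_add /=; ring.
  by move=> i iq; rewrite !mxE (negbTE iq) /=; ring.
have eM u v : (BT H *m BT (monom c k q r)) u v = if bad q k v then 0 else
    c * (cp v == r)%:R * fhat (fun t => H t (cp u) q * ek (fr v + k) t) (fr u).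
  rewrite mxE; case: ifP => [|/negbFE/existsP[w /andP[/eqP cw /eqP fw]]].
    rewrite /bad negb_exists => /forallP bv; apply: big1 => w _; rewrite [X in _ * X]BT_monom.
    by case: (cp w == q) (bv w) => /= [/negbTE ->|_]; rewrite ?andbF !mulr0.
  rewrite (bigD1 w)//= big1 ?addr0 => [|w' ww'].
    by rewrite [X in _ * X = _]BT_monom cw fw !eqxx andbT mxE cw fw mulrC.
  rewrite [X in _ * X]BT_monom; case: (cp w' =P q) => [cw'|]; last by rewrite !mulr0.
  case: (fr w' =P _) => [fw'|]; last by rewrite andbF !mulr0.
  by case/eqP: ww'; apply: fr_cp_inj; rewrite ?cw' ?fw'.
rewrite /hs exchange_big (bigID (bad q k)) /= [X in _ + X]big1 ?addr0; last first.
  move=> v /negbTE gv; apply: big1 => u _; rewrite mxE eM gv mxE eB subrr nrm0 expr0n //.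
rewrite -sum1_card natr_sum mulr_suml; apply: ler_sum => v bv; rewrite mul1r.
apply: (@le_trans _ _ (nrm c ^+ 2 * \sum_u nrm (fhat (fun t => H t (cp u) q * ek (fr v + k) t) (fr u)) ^+ 2)).
  rewrite mulr_sumr; apply: ler_sum => u _.
  rewrite mxE eM bv mxE eB add0r nrmN !nrmM !exprMn -mulrA; apply: ler_wpM2l; first exact: sqr_ge0.
  by case: (cp v == r); rewrite ?nrm1 ?nrm0 ?expr1n ?expr0n /= ?mul1r// mul0r sqr_ge0.
apply: ler_wpM2l; first exact: sqr_ge0.
apply: le_trans (block_bessel (fun p => cbmf_entry_ek p q (fr v + k) bH)) _.
rewrite ihsE// exchange_big /= [leRHS](bigD1 q)//= -[leLHS]addr0; apply: lerD.
  apply: ler_sum => p _; rewrite [leRHS](_ : _ = sqn (fun t => H t p q * ek (fr v + k) t))//.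
  by congr torus_int; apply/funext => t; rewrite nrmM nrm_ek mulr1.
by apply: sumr_ge0 => i _; apply: sumr_ge0 => p _; exact: sqn_ge0.
Qed.
End BlockToeplitz.

(** * Lexicographic indices as mixed-radix digits *)

Section MixedRadix.
Variables (d : nat) (n : 'I_d -> nat).
Local Open Scope nat_scope.

Lemma NN_gt0P i l : i < NN n -> 0 < n l.
Proof. by move=> iN; have : 0 < NN n by [exact: leq_ltn_trans iN]; rewrite /NN (bigD1 l)//= muln_gt0 => /andP[]. Qed.

Lemma alpha_lt i l : i < NN n -> alpha n i l < n l.
Proof. by move=> iN; rewrite /alpha ltn_mod (NN_gt0P l iN). Qed.

(** The last k digits determine an index modulo the product of the last k sizes; induction on k
    recovers the whole index. *)
Lemma alpha_inj i j : i < NN n -> j < NN n -> (forall l, alpha n i l = alpha n j l) -> i = j.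
Proof.
move=> iN jN aij; pose P k := \prod_(l < d | k <= l) n l.
have key k : k <= d -> i = j %[mod P (d - k)].
  elim: k => [|k IH] kd.
    by rewrite subn0 /P big_pred0 ?modn1// => l; rewrite leqNgt ltn_ord.
  have dk : d - k.+1 < d by lia.
  pose l0 := Ordinal dk.
  have PE : P (d - k.+1) = n l0 * P (d - k).
    rewrite /P (bigD1 l0)//=; congr (_ * _); apply: eq_bigl => l.
    by rewrite -val_eqE /=; lia.
  have PE' : \prod_(l' < d | l0 < l') n l' = P (d - k) by apply: eq_bigl => l /=; lia.
  have H := IH (ltnW kd).
  have eqm x : x %% P (d - k.+1) = alpha n x l0 * P (d - k) + x %% P (d - k).
    rewrite /alpha PE' {1}PE (divn_eq (x %% _) (P (d - k))) -modn_divl.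
    by rewrite modn_dvdm// dvdn_mull.
  by rewrite !eqm aij H.
have := key d (leqnn d); rewrite subnn (_ : P 0 = NN n); last by apply: eq_bigl.
by rewrite !modn_small.
Qed.

Definition digits (i : 'I_(NN n)) : {dffun forall l, 'I_(n l)} :=
  [ffun l => Ordinal (alpha_lt l (ltn_ord i))].

Lemma digits_bij : bijective digits.
Proof.
apply: inj_card_bij => [i j ij|].
  apply: val_inj; apply: alpha_inj (ltn_ord i) (ltn_ord j) _ => l.
  by have := congr1 (fun f : {dffun forall l, 'I_(n l)} => val (f l)) ij; rewrite !ffunE.
rewrite card_dep_ffun foldrE big_map big_enum card_ord /=.
by apply: eq_leq; apply: eq_bigr => l _; rewrite card_ord.
Qed.

Lemma alpha_surj (b : 'I_d -> nat) : (forall l, b l < n l) ->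
  exists2 i, i < NN n & forall l, alpha n i l = b l.
Proof.
move=> bn; have [g gK Kg] := digits_bij.
exists (g [ffun l => Ordinal (bn l)]) => // l.
have := congr1 (fun f : {dffun forall l, 'I_(n l)} => val (f l)) (Kg [ffun l => Ordinal (bn l)]).
by rewrite !ffunE.
Qed.

(** Digits are equidistributed; the comparison of proportions is cross-multiplied to stay in the
    natural numbers. *)
Lemma card_alpha l (A : pred nat) :
  #|[pred i : 'I_(NN n) | A (alpha n i l)]| * n l <= #|[pred c : 'I_(n l) | A c]| * NN n.
Proof.
pose S l' : {set 'I_(n l')} := [set c | (l' == l) ==> A (val c)]%SET.
have -> : #|[pred i : 'I_(NN n) | A (alpha n i l)]| = #|finset.setXn S|.
  rewrite -(on_card_preimset (f := digits)); last exact/onW_bij/digits_bij.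
  apply: eq_card => i; rewrite !inE; apply/idP/forallP => [Ai l'|/(_ l)].
    by rewrite inE ffunE; apply/implyP => /eqP->.
  by rewrite inE ffunE eqxx.
rewrite finset.cardsXn /NN (bigD1 l)//= [X in _ <= _ * X](bigD1 l)//=.
rewrite mulnAC mulnA; apply: leq_mul.
  rewrite leq_mul2r; apply/orP; right; apply: subset_leq_card.
  by apply/fintype.subsetP => c; rewrite !inE eqxx.
by apply: leq_prod => l' _; rewrite -[X in _ <= X]card_ord; exact: max_card.
Qed.

Lemma card_shift_out p (k : int) :
  #|[pred c : 'I_p | ~~ (0 <= (val c)%:Z + k < p%:Z)%R]| <= absz k.
Proof.
case: p => [|p]; first by rewrite eq_card0// => -[].
(* The escaping digits are among the top [absz k] ones when [k] is nonnegative and among the bottom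
   ones otherwise. *)
pose f (c : 'I_(absz k)) : 'I_p.+1 := if (0 <= k)%R then inord (p - c) else inord c.
apply: (@leq_trans #|codom f|); last by apply: leq_trans (leq_image_card _ _) _; rewrite card_ord.
apply: subset_leq_card; apply/fintype.subsetP => c; rewrite inE /= => H; have cp := ltn_ord c.
have [k0|k0] := lerP 0%R k.
  have ck : p - c < absz k by lia.
  by apply/codomP; exists (Ordinal ck); apply: val_inj; rewrite /f k0 /= inordK; lia.
have ck : c < absz k by lia.
by apply/codomP; exists (Ordinal ck); apply: val_inj; rewrite /f leNgt k0 /= inordK.
Qed.

Lemma card_alpha_out l (k : int) :
  #|[pred i : 'I_(NN n) | ~~ (0 <= (alpha n i l)%:Z + k < (n l)%:Z)%R]| * n l <= absz k * NN n.
Proof.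
apply: leq_trans (card_alpha l (fun a => ~~ (0 <= a%:Z + k < (n l)%:Z)%R)) _.
by rewrite leq_mul2r card_shift_out orbT.
Qed.
End MixedRadix.

Section HilbertSchmidt.
Variable R : realType.
Local Notation C := (Cx R).

Lemma hsM m n p (A : 'M[C]_(m, n)) (B : 'M[C]_(n, p)) : hs (A *m B) <= hs A * hs B.
Proof.
rewrite {1 2}/hs mulr_suml; apply: ler_sum => i _.
rewrite /hs exchange_big /= mulr_sumr; apply: ler_sum => j _.
by rewrite mxE; exact: cauchy_schwarz_sum.
Qed.

Lemma hsZ m n c (A : 'M[C]_(m, n)) : hs (c *: A) = nrm c ^+ 2 * hs A.
Proof.
rewrite /hs mulr_sumr; apply: eq_bigr => i _; rewrite mulr_sumr; apply: eq_bigr => j _.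
by rewrite mxE nrmM exprMn.
Qed.

Lemma tr_hs m (A : 'M[C]_m) : nrm (\tr A) ^+ 2 <= m%:R * hs A.
Proof.
have := cauchy_schwarz_sum (fun=> 1 : C) (fun i => A i i).
under eq_bigr do rewrite mul1r.
rewrite -/(\tr A) => H; apply: le_trans H _.
rewrite (eq_bigr (fun=> 1)); last by move=> i _; rewrite nrm1 expr1n.
rewrite sumr_const card_ord; apply: ler_wpM2l; first exact: ler0n.
apply: ler_sum => i _; rewrite (bigD1 i)//= lerDl.
by apply: sumr_ge0 => j _; exact: sqr_ge0.
Qed.
End HilbertSchmidt.

Lemma ratio_norm (R : realType) (x : R) (k : nat) : 0 <= x -> `|x / k%:R| = x / k%:R.
Proof. by move=> x0; rewrite ger0_norm// divr_ge0. Qed.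

Lemma ratio_le (R : realType) (x a : R) (k : nat) : 0 <= a -> x <= k%:R * a -> x / k%:R <= a.
Proof.
move=> a0 xa; have [k0|k0] := posnP k; first by rewrite k0 invr0 mulr0.
by rewrite ler_pdivrMr ?ltr0n// mulrC.
Qed.

Lemma defect_const_le (R : realType) (B M : R) : 0 <= B -> 0 <= M ->
  4 * (B * M) <= 2^-1 * (2^-1 * (16 * ((B + 1) * (M + 1)))).
Proof. by move=> B0 M0; have := mulr_ge0 B0 M0; lra. Qed.

Lemma halves_le (R : realType) (e : R) : 2 * (e * (2^-1 * 2^-1) + e / 4) <= e.
Proof. by lra. Qed.

Lemma cRe_natM (R : realType) (k : nat) (z : Cx R) : complex.Re (k%:R * z) = k%:R * complex.Re z.
Proof.
elim: k => [|k IH]; first by rewrite !mul0r.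
by rewrite !mulrSr !mulrDl cReD IH !mul1r.
Qed.

(** * Block Toeplitz calculus modulo small Hilbert-Schmidt errors *)

Section SymbolCalculus.
Variables (R : realType) (d m : nat).
Local Notation C := (Cx R).
Local Notation T := (d.-tuple R).
Local Notation freq := {ffun 'I_d -> int}.
Implicit Types (H K : T -> 'M[C]_m).

Lemma mcbmfD H K : mcbmf H -> mcbmf K -> mcbmf (fun t => H t + K t).
Proof.
by move=> bH bK i j; apply: eq_cbmf (cbmfD (bH i j) (bK i j)) => t; rewrite mxE.
Qed.

Lemma mcbmfB H K : mcbmf H -> mcbmf K -> mcbmf (fun t => H t - K t).
Proof.
by move=> bH bK i j; apply: eq_cbmf (cbmfB (bH i j) (bK i j)) => t; rewrite !mxE.
Qed.

Lemma mcbmfM H K : mcbmf H -> mcbmf K -> mcbmf (fun t => H t *m K t).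
Proof.
move=> bH bK i j; apply: (@eq_cbmf _ _ (fun t => \sum_k H t i k * K t k j)).
  by move=> t; rewrite mxE.
by apply: cbmf_sum => k _; exact: cbmfM.
Qed.

Lemma mcbmf_cst (A : 'M[C]_m) : mcbmf (fun _ : T => A).
Proof. by move=> i j; exact: cbmf_cst. Qed.

Lemma mcbmfX H k : mcbmf H -> mcbmf (fun t => H t ^+ k).
Proof.
move=> bH; elim: k => [|k IH]; first exact: mcbmf_cst.
rewrite (_ : (fun t => _) = fun t => H t *m H t ^+ k); first exact: mcbmfM.
by apply/funext => t; rewrite expSmx.
Qed.

Lemma mcbmf_sum p (c : 'I_p -> C) (K : 'I_p -> T -> 'M[C]_m) : (forall i, mcbmf (K i)) ->
  mcbmf (fun t => \sum_i c i *: K i t).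
Proof.
move=> bK i j; apply: (@eq_cbmf _ _ (fun t => \sum_k c k * K k t i j)).
  by move=> t; rewrite summxE; apply: eq_bigr => k _; rewrite mxE.
by apply: cbmf_sum => k _; apply: cbmfZ; exact: bK.
Qed.

Lemma mcbmf_peval P H : mcbmf H -> mcbmf (fun t => peval P (H t)).
Proof. by move=> bH; apply: mcbmf_sum => i; exact: mcbmfX. Qed.

Lemma mcbmf_hs_bound H : mcbmf H -> exists2 B : R, 0 <= B & forall t, hs (H t) <= B.
Proof.
move=> /bmf_hs [_ [B HB]]; exists `|B| => // t; apply: le_trans (ler_norm B).
exact: le_trans (ler_norm _) (HB t).
Qed.

Lemma ihsM H K B : mcbmf H -> mcbmf K -> (forall t, hs (H t) <= B) ->
  ihs (fun t => H t *m K t) <= B * ihs K.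
Proof.
move=> bH bK HB; rewrite /ihs -torus_intZ; last exact: bmf_hs.
apply: torus_int_le; [exact/bmf_hs/mcbmfM|by apply: bmfZ; exact: bmf_hs|].
move=> t; apply: le_trans (hsM _ _) _; apply: ler_wpM2r; [exact: hs_ge0|exact: HB].
Qed.

Section Families.
Variables (I : Type) (F : set_system I).
Context {FF : Filter F}.
Variables (D N : I -> nat) (fr : forall n, 'I_(D n) -> freq) (cp : forall n, 'I_(D n) -> 'I_m).
Hypothesis fr_cp_inj : forall n (u v : 'I_(D n)), cp u = cp v -> fr u = fr v -> u = v.
Hypothesis bad_null : forall q k, tends0 F (fun n => #|bad (@fr n) (@cp n) q k|%:R / (D n)%:R : R).
Hypothesis cp_card : forall n p, #|[pred u | @cp n u == p]| = N n.
Hypothesis D_N : forall n, D n = (N n * m)%N.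

Local Notation BTn n := (BT (@fr n) (@cp n)).

Definition negligible_mx (X : forall n, 'M[C]_(D n)) := tends0 F (fun n => hs (X n) / (D n)%:R).

Lemma negligible_lin (X Y Z : forall n, 'M[C]_(D n)) (a b : R) :
  (forall n, hs (X n) <= a * hs (Y n) + b * hs (Z n)) ->
  negligible_mx Y -> negligible_mx Z -> negligible_mx X.
Proof.
move=> XYZ nY nZ; apply: tends0_le (tends0D (tends0Z a nY) (tends0Z b nZ)) => n.
rewrite ger0_norm ?divr_ge0 ?hs_ge0// !mulrA -mulrDl.
by apply: ler_wpM2r; rewrite ?invr_ge0.
Qed.

Lemma eq_negligible (X Y : forall n, 'M[C]_(D n)) : (forall n, X n = Y n) ->
  negligible_mx X -> negligible_mx Y.
Proof. by move=> XY; rewrite /negligible_mx (_ : (fun n => _) = fun n => hs (Y n) / (D n)%:R)//; apply/funext => n; rewrite XY. Qed.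

Lemma negligible_eq0 (X : forall n, 'M[C]_(D n)) : (forall n, X n = 0) -> negligible_mx X.
Proof. by move=> X0; apply: tends0_le (@tends0_cst0 R _ F _) => n; rewrite X0 hs0 mul0r normr0. Qed.

Lemma defectD n H K K' : mcbmf H -> mcbmf K -> mcbmf K' -> defect (@fr n) (@cp n) H (fun t => K t + K' t) =
  defect (@fr n) (@cp n) H K + defect (@fr n) (@cp n) H K'.
Proof.
move=> bH bK bK'.
rewrite /defect BTD// mulmxDr (_ : (fun t => _) = fun t => H t *m K t + H t *m K' t).
  by rewrite BTD; [rewrite opprD addrACA|exact: mcbmfM..].
by apply/funext => t; rewrite mulmxDr.
Qed.

Lemma negligible_defectD H K K' : mcbmf H -> mcbmf K -> mcbmf K' ->
  negligible_mx (fun n => defect (@fr n) (@cp n) H K) ->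
  negligible_mx (fun n => defect (@fr n) (@cp n) H K') ->
  negligible_mx (fun n => defect (@fr n) (@cp n) H (fun t => K t + K' t)).
Proof.
move=> bH bK bK'; apply: (@negligible_lin _ _ _ 2 2) => n.
by rewrite defectD// -mulrDr; exact: hsD.
Qed.

Lemma negligible_defect_monom H c k q r : mcbmf H ->
  negligible_mx (fun n => defect (@fr n) (@cp n) H (monom c k q r)).
Proof.
move=> bH; apply: tends0_le (tends0Z (nrm c ^+ 2 * ihs H) (bad_null q k)) => n.
rewrite ger0_norm ?divr_ge0 ?hs_ge0// mulrA; apply: ler_wpM2r; rewrite ?invr_ge0//.
by rewrite mulrC; apply: defect_monom => //; exact: fr_cp_inj.
Qed.

(** The defect is additive in its second symbol, so everything reduces to single characters times
    matrix units. *)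
Lemma negligible_defect_trig H (P : T -> 'M[C]_m) : mcbmf H -> (forall i j, trig (fun t => P t i j)) ->
  negligible_mx (fun n => defect (@fr n) (@cp n) H P).
Proof.
move=> bH tP.
pose good (K : T -> 'M[C]_m) := mcbmf K /\ negligible_mx (fun n => defect (@fr n) (@cp n) H K).
have good0 : good (fun=> 0).
  split; first exact: mcbmf_cst.
  apply: negligible_eq0 => n; rewrite /defect.
  have e0 : BTn n (fun=> 0 : 'M[C]_m) = 0.
    rewrite -[RHS](scale0r (BTn n (fun=> 0))) -BTZ; last exact: mcbmf_cst.
    by congr BT; apply/funext => t; rewrite scaler0.
  rewrite e0 mulmx0 sub0r (_ : (fun t => _) = fun=> 0) ?e0 ?oppr0//.
  by apply/funext => t; rewrite mulmx0.
have goodD K K' : good K -> good K' -> good (fun t => K t + K' t).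
  by move=> [b1 n1] [b2 n2]; split; [exact: mcbmfD|exact: negligible_defectD].
have good_sum (J : Type) (s : seq J) (K : J -> T -> 'M[C]_m) :
    (forall j, good (K j)) -> good (fun t => \sum_(j <- s) K j t).
  move=> gK; elim: s => [|j s IH].
    by rewrite (_ : (fun t => _) = fun=> 0)//; apply/funext => t; rewrite big_nil.
  have := goodD _ _ (gK j) IH; rewrite (_ : (fun t => _) = fun t => \sum_(j <- j :: s) K j t)//.
  by apply/funext => t; rewrite big_cons.
have good_entry i j : good (fun t => P t i j *: delta_mx i j).
  have [s Hs] := tP i j.
  pose K (x : C * ('I_d -> int)) := monom x.1 [ffun l => x.2 l] i j : T -> 'M[C]_m.
  have : good (fun t => \sum_(x <- s) K x t).
    by apply: good_sum => x; split; [exact: mcbmf_monom|exact: negligible_defect_monom].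
  congr good; apply/funext => t; rewrite Hs scaler_suml; apply: eq_bigr => x _.
  by rewrite /K /monom; congr ((_ * _) *: _); rewrite /ek; congr expi; apply: eq_bigr => l _; rewrite ffunE.
suff -> : P = fun t => \sum_i \sum_j P t i j *: delta_mx i j.
  suff [] : good (fun t => \sum_i \sum_j P t i j *: delta_mx i j) by [].
  by apply: (good_sum) => i; apply: (good_sum) => j; exact: good_entry.
by apply/funext => t; rewrite {1}[P t]matrix_sum_delta.
Qed.

(** The roles of the symbols differ: [H] acts through its sup bound, while the remainder [X] of [K]
    need only be small in L2. The defect of [X] is then at most 4 B ihs(X) times the dimension,
    uniformly in [n]. *)
Lemma negligible_defect H K : mcbmf H -> mcbmf K ->
  negligible_mx (fun n => defect (@fr n) (@cp n) H K).
Proof.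
move=> bH bK e e0; have [B B0 HB] := mcbmf_hs_bound bH.
(* Chosen so that 4 B m^2 e/c <= e/4, with m^2 counting the entries; the summands 1 keep [c]
   positive. *)
pose c := 16 * (B + 1) * (m%:R * m%:R + 1).
have c0 : 0 < c by rewrite !mulr_gt0// ?ltr_wpDl// mulr_ge0.
have ec : 0 < e / c by exact: divr_gt0.
have /choice[P HP] : forall ij : 'I_m * 'I_m, exists p : T -> C, trig p /\
    sqn (fun t => K t ij.1 ij.2 - p t) < e / c.
  by move=> [i j]; have [p tp hp] := L2dense_cbmf (bK i j) ec; exists p.
pose PM t : 'M[C]_m := \matrix_(i, j) P (i, j) t.
have tPM i j : trig (fun t => PM t i j).
  by have [[s Hs] _] := HP (i, j); exists s => t; rewrite mxE Hs.
have bPM : mcbmf PM by move=> i j; exact: cbmf_trig.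
pose X t := K t - PM t; have bX : mcbmf X by exact: mcbmfB.
have iX : ihs X <= m%:R * m%:R * (e / c).
  rewrite ihsE//; apply: (@le_trans _ _ (\sum_(p < m) \sum_(q < m) e / c)).
    apply: ler_sum => p _; apply: ler_sum => q _; apply: ltW.
    have [_] := HP (p, q); congr (_ < _); congr torus_int; apply/funext => t.
    by rewrite !mxE.
  by rewrite !sumr_const !card_ord -mulrnA -[_ *+ _]mulr_natl natrM.
have hX n : hs (defect (@fr n) (@cp n) H X) <= (D n)%:R * (4 * B * ihs X).
  apply: le_trans (hsD _ _) _; rewrite -scaleN1r hsZ nrmN nrm1 expr1n mul1r.
  have h1 : hs (BTn n H *m BTn n X) <= B * ((D n)%:R * ihs X).
    apply: le_trans (BT_op_bound (@fr_cp_inj n) _ bH HB) _.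
    by apply: ler_wpM2l => //; apply: hs_BT => //; exact: fr_cp_inj.
  have h2 : hs (BTn n (fun t => H t *m X t)) <= (D n)%:R * (B * ihs X).
    apply: le_trans (hs_BT (@fr_cp_inj n) _) _; first exact: mcbmfM.
    by apply: ler_wpM2l => //; exact: ihsM.
  lra.
have e4 : 0 < e / 4 by exact: divr_gt0.
have := negligible_defect_trig bH tPM e4; apply: filterS => n.
move=> /(le_trans (ler_norm _)) h; rewrite ratio_norm; last exact: hs_ge0.
have -> : defect (@fr n) (@cp n) H K = defect (@fr n) (@cp n) H X + defect (@fr n) (@cp n) H PM.
  have eK : K = fun t => X t + PM t by apply/funext => t; rewrite /X subrK.
  by rewrite {1}eK defectD.
have hx : hs (defect (@fr n) (@cp n) H X) / (D n)%:R <= 4 * B * ihs X.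
  by apply: ratio_le (hX n); rewrite !mulr_ge0// ihs_ge0.
have hD := hsD (defect (@fr n) (@cp n) H X) (defect (@fr n) (@cp n) H PM).
have D0 : 0 <= (D n)%:R^-1 :> R by rewrite invr_ge0.
have := ler_wpM2r D0 hD; rewrite -mulrA [(hs _ + hs _) / _]mulrDl => /le_trans; apply.
have hB : 4 * B * ihs X <= e / 2 / 2.
  apply: (@le_trans _ _ (4 * B * (m%:R * m%:R * (e / c)))); first by apply: ler_wpM2l => //; rewrite mulr_ge0.
  have -> : 4 * B * (m%:R * m%:R * (e / c)) = e * (4 * B * (m%:R * m%:R)) / c by ring.
  rewrite ler_pdivrMr// /c -!mulrA; apply: ler_wpM2l; first exact: ltW.
  have M0 : 0 <= m%:R * m%:R :> R by rewrite mulr_ge0.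
  move: (m%:R * m%:R) M0 => M M0; exact: defect_const_le.
apply: le_trans (ler_wpM2l (ler0n R 2) (lerD (le_trans hx hB) h)) _.
by rewrite -[e / 2 / 2]mulrA; exact: halves_le.
Qed.

(** A product with one more factor splits into [BTn n H] times the previous error, controlled by the
    operator bound, plus one new defect. *)
Lemma negligible_pow H k : mcbmf H ->
  negligible_mx (fun n => BTn n H ^+ k - BTn n (fun t => H t ^+ k)).
Proof.
move=> bH; have [B B0 HB] := mcbmf_hs_bound bH; elim: k => [|k IH].
  apply: negligible_eq0 => n; have -> : (fun t => H t ^+ 0) = fun=> 1%:M by [].
  by rewrite BT1 ?subrr//; exact: fr_cp_inj.
apply: (negligible_lin (a := 2 * B) (b := 2) _ IH (negligible_defect bH (mcbmfX k bH))) => n.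
have -> : BTn n H ^+ k.+1 - BTn n (fun t => H t ^+ k.+1) =
  BTn n H *m (BTn n H ^+ k - BTn n (fun t => H t ^+ k)) + defect (@fr n) (@cp n) H (fun t => H t ^+ k).
  rewrite mulmxBr addrA subrK -expSmx; congr (_ - BTn n _).
  by apply/funext => t; rewrite expSmx.
apply: le_trans (hsD _ _) _; rewrite -mulrA -mulrDr; apply: ler_wpM2l => //; apply: lerD => //.
by apply: BT_op_bound => //; exact: fr_cp_inj.
Qed.

Lemma BT_sum n p (c : 'I_p -> C) (K : 'I_p -> T -> 'M[C]_m) : (forall i, mcbmf (K i)) ->
  BTn n (fun t => \sum_i c i *: K i t) = \sum_i c i *: BTn n (K i).
Proof.
move=> bK; apply/matrixP => u v; rewrite mxE summxE.
rewrite (_ : (fun t => _) = fun t => \sum_i c i * (K i t (cp u) (cp v) * ek (fr v) t)).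
  rewrite fhat_sum; last by move=> i _; apply: cbmfZ; exact: cbmf_entry_ek.
  by apply: eq_bigr => i _; rewrite fhatZ ?mxE//; exact: cbmf_entry_ek.
apply/funext => t; rewrite summxE mulr_suml; apply: eq_bigr => i _.
by rewrite mxE mulrA.
Qed.

Lemma negligible_sum (J : Type) (s : seq J) (c : J -> C) (X : J -> forall n, 'M[C]_(D n)) :
  (forall j, negligible_mx (X j)) -> negligible_mx (fun n => \sum_(j <- s) c j *: X j n).
Proof.
move=> nX; elim: s => [|j s IH]; first by apply: negligible_eq0 => n; rewrite big_nil.
apply: (negligible_lin (a := 2 * nrm (c j) ^+ 2) (b := 2) _ (nX j) IH) => n.
by rewrite big_cons -mulrA -hsZ -mulrDr; exact: hsD.
Qed.

Lemma negligible_peval H P : mcbmf H ->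
  negligible_mx (fun n => peval P (BTn n H) - BTn n (fun t => peval P (H t))).
Proof.
move=> bH.
have := negligible_sum (index_enum 'I_(size P)) (fun i => P`_i) (fun i => negligible_pow i bH).
apply: eq_negligible => n; rewrite /peval BT_sum; last by move=> i; exact: mcbmfX.
by rewrite -sumrB; apply: eq_bigr => i _; rewrite scalerBr.
Qed.

Hypothesis N_gt0 : \forall n \near F, (0 < N n)%N.

Lemma tends0_sqr (a : I -> R) : tends0 F (fun n => a n ^+ 2) -> tends0 F a.
Proof.
move=> ta e e0; have e2 : 0 < e ^+ 2 by exact: exprn_gt0.
apply: filterS (ta _ e2) => n; rewrite normrX ler_pXn2r// nnegrE//; exact: ltW.
Qed.

Lemma tends0_eq (a b : I -> R) : (\forall n \near F, a n = b n) -> tends0 F a -> tends0 F b.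
Proof. by move=> ab ta e /ta; apply: filterS2 ab => n ->. Qed.

Lemma trace_limit H P : mcbmf H ->
  tends0 F (fun n => complex.Re (\tr (peval P (BTn n H))) / (D n)%:R -
                     complex.Re (ctorus (fun t => \tr (peval P (H t)))) / m%:R).
Proof.
move=> bH; have bP := mcbmf_peval P bH.
set X := fun n => peval P (BTn n H) - BTn n (fun t => peval P (H t)).
have trB p (A A' : 'M[C]_p) : \tr (A - A') = \tr A - \tr A' by exact: linearB.
apply: (@tends0_eq (fun n => complex.Re (\tr (X n)) / (D n)%:R)).
  apply: filterS N_gt0 => n N0; rewrite /X trB (tr_BT _ bP (@cp_card n)) cReB mulrBl; congr (_ - _).
  move: (ctorus _) => z; rewrite D_N cRe_natM natrM invfM mulrACA divff ?mul1r//.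
  by rewrite pnatr_eq0 -lt0n.
(* Cauchy-Schwarz on the diagonal gives |tr X|^2 <= D hs(X), so the squared normalized trace is at
   most hs(X)/D. *)
apply: tends0_sqr; apply: tends0_le (negligible_peval P bH) => n.
rewrite ger0_norm ?sqr_ge0// expr_div_n.
rewrite expr2 [X in _ / X]expr2 invfM mulrA; apply: ler_wpM2r; first by rewrite invr_ge0.
rewrite -expr2; apply: ratio_le; first exact: hs_ge0.
apply: le_trans (tr_hs _); rewrite sqr_nrm lerDl; exact: sqr_ge0.
Qed.

End Families.
End SymbolCalculus.

(** * Labelling the rows of the complex adjoint matrix *)

Section BlockIndex.
Variables (d s : nat) (n : 'I_d -> nat).
Local Notation S := (\sum_(i < NN n) s)%N.

(** A row of [Phi] of a Toeplitz matrix is addressed by its half, then the multi-index, then the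
    entry inside the block. Joining the half with the inner entry yields the component of the
    symbol; this is the reindexing from [Phi] to block Toeplitz form. *)
Definition block_index (i : 'I_(NN n)) (p : 'I_(s + s)) : 'I_(S + S) :=
  match fintype.split p with
  | inl q => lshift S (@tagnat.Rank _ (fun=> s) i q)
  | inr q => rshift S (@tagnat.Rank _ (fun=> s) i q)
  end.

Definition block_point (u : 'I_(S + S)) : 'I_(NN n) :=
  match fintype.split u with inl a => tagnat.sig1 a | inr a => tagnat.sig1 a end.

Definition block_comp (u : 'I_(S + S)) : 'I_(s + s) :=
  match fintype.split u with inl a => lshift s (tagnat.sig2 a) | inr a => rshift s (tagnat.sig2 a) end.

Definition block_freq (u : 'I_(S + S)) : {ffun 'I_d -> int} :=
  [ffun l => (alpha n (block_point u) l)%:Z].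

Lemma block_indexK u : block_index (block_point u) (block_comp u) = u.
Proof.
rewrite /block_index /block_point /block_comp -[RHS]splitK; case: (fintype.split u) => a.
  by rewrite (unsplitK (inl _ : 'I_s + 'I_s)) tagnat.sig2K.
by rewrite (unsplitK (inr _ : 'I_s + 'I_s)) tagnat.sig2K.
Qed.

Lemma block_pointK i p : block_point (block_index i p) = i.
Proof.
rewrite /block_index /block_point; case: (fintype.split p) => q.
  by rewrite (unsplitK (inl _ : 'I_S + 'I_S)) tagnat.Rank1K.
by rewrite (unsplitK (inr _ : 'I_S + 'I_S)) tagnat.Rank1K.
Qed.

Lemma block_compK i p : block_comp (block_index i p) = p.
Proof.
rewrite /block_index /block_comp -[RHS]splitK; case: (fintype.split p) => q.
  rewrite (unsplitK (inl _ : 'I_S + 'I_S)); congr lshift.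
  by rewrite tagnat.Rank2K; apply: val_inj.
rewrite (unsplitK (inr _ : 'I_S + 'I_S)); congr rshift.
by rewrite tagnat.Rank2K; apply: val_inj.
Qed.

Lemma block_freq_inj u v : block_comp u = block_comp v -> block_freq u = block_freq v -> u = v.
Proof.
move=> cuv fuv; rewrite -[u]block_indexK -[v]block_indexK cuv; congr block_index.
apply/val_inj/(@alpha_inj _ n); rewrite ?ltn_ord// => l.
by have := congr1 (fun f : {ffun _} => f l) fuv; rewrite !ffunE => -[].
Qed.

Lemma card_block_comp p : #|[pred u | block_comp u == p]| = NN n.
Proof.
rewrite -[RHS]card_ord -(card_codom (f := fun i => block_index i p)) => [|i j ij].
  apply: eq_card => u; rewrite inE; apply/eqP/codomP => [<-|[i ->]]; last exact: block_compK.
  by exists (block_point u); rewrite block_indexK.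
by rewrite -(block_pointK i p) ij block_pointK.
Qed.

Lemma block_dim : (S + S)%N = (NN n * (s + s))%N.
Proof. by rewrite sum_nat_const card_ord mulnDr. Qed.

(** A shifted multi-index leaves the box only if some coordinate leaves its range, and in direction
    [l] this happens for a share of at most |k l| / n l. *)
Lemma block_bad_ratio (R : realType) (q : 'I_(s + s)) (k : {ffun 'I_d -> int}) : (forall l, (0 < n l)%N) ->
  #|bad block_freq block_comp q k|%:R / (S + S)%:R <= \sum_l (absz (k l))%:R / (n l)%:R :> R.
Proof.
move=> n0; pose out l := [pred i : 'I_(NN n) | ~~ (0 <= (alpha n i l)%:Z + k l < (n l)%:Z)].
have sub : (#|bad block_freq block_comp q k| <= \sum_l #|out l| * (s + s))%N.
  pose Y l : {pred 'I_(S + S)} := [pred u | out l (block_point u)].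
  have cY l : #|Y l| = (#|out l| * (s + s))%N.
    rewrite -[(s + s)%N in RHS]card_ord -cardX.
    have inj : {in [predX out l & predT] &, injective (fun ip : 'I_(NN n) * 'I_(s + s) => block_index ip.1 ip.2)}.
      move=> [i p] [j r] _ _ /= e; congr (_, _).
        by rewrite -(block_pointK i p) e block_pointK.
      by rewrite -(block_compK i p) e block_compK.
    rewrite -(card_in_image inj); apply: eq_card => u; apply/idP/fintype.imageP => [Yu|[[i p]]].
      by exists (block_point u, block_comp u); rewrite ?inE ?block_indexK //= andbT.
    by rewrite !inE /= andbT => io ->; rewrite block_pointK.
  apply: (@leq_trans (\sum_l #|Y l|)); last by apply: leq_sum => l _; rewrite cY.
  rewrite -sum1_card.
  apply: (@leq_trans (\sum_(u in bad block_freq block_comp q k) \sum_l (u \in Y l))); last first.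
    rewrite exchange_big; apply: leq_sum => l _ /=.
    rewrite -sum1_card big_mkcond [X in (_ <= X)%N]big_mkcond; apply: leq_sum => u _ /=.
    by case: ifP => // _; case: (u \in Y l).
  apply: leq_sum => u ub.
  suff [l lY] : exists l, u \in Y l by rewrite (bigD1 l)//= lY.
  apply: contrapT => H; move: ub; rewrite /bad unfold_in negb_exists => /forallP ub.
  have hl l : 0 <= (alpha n (block_point u) l)%:Z + k l < (n l)%:Z.
    by apply: contrapT => hl; apply: H; exists l; rewrite inE /=; apply/negP.
  have [i iN Hi] := @alpha_surj _ n (fun l => absz ((alpha n (block_point u) l)%:Z + k l)) (ltac:(move=> l; have := hl l; lia)).
  have := ub (block_index (Ordinal iN) q); rewrite block_compK eqxx /= => /eqP; apply.
  apply/ffunP => l; rewrite !ffunE block_pointK /= Hi; have := hl l; lia.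
have NN0 : (0 < NN n)%N by rewrite /NN prodn_gt0.
have s0 : (0 < s + s)%N by exact: leq_ltn_trans (ltn_ord q).
have D0 : 0 < (S + S)%:R :> R by rewrite ltr0n block_dim muln_gt0 NN0.
rewrite ler_pdivrMr//; apply: (@le_trans _ _ (\sum_l #|out l| * (s + s))%:R); first by rewrite ler_nat.
rewrite natr_sum mulr_suml; apply: ler_sum => l _.
have nl0 : 0 < (n l)%:R :> R by rewrite ltr0n.
rewrite mulrAC ler_pdivlMr// block_dim -!natrM ler_nat.
have := card_alpha_out n l (k l); rewrite -/(out l) => H.
by rewrite mulnAC [X in (_ <= X)%N]mulnA leq_mul2r H orbT.
Qed.
End BlockIndex.

Section MultiIndexFilter.
Variable d : nat.

Definition multi_infty : set_system ('I_d -> nat) :=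
  [set P | exists N : nat, forall n, (forall l, (N <= n l)%N) -> P n].

Global Instance multi_infty_filter : Filter multi_infty.
Proof.
split; first by exists 0%N.
  move=> P Q [N HP] [M HQ]; exists (maxn N M) => n Hn; split; [apply: HP|apply: HQ] => l.
    by apply: leq_trans (Hn l); rewrite leq_maxl.
  by apply: leq_trans (Hn l); rewrite leq_maxr.
by move=> P Q PQ [N HP]; exists N => n /HP /PQ.
Qed.

Lemma multi_infty_gt0 : \forall n \near multi_infty, forall l, (0 < n l)%N.
Proof. by exists 1%N => n. Qed.

Lemma block_bad_null (R : realType) s (q : 'I_(s + s)) (k : {ffun 'I_d -> int}) :
  tends0 multi_infty (fun n => #|bad (@block_freq d s n) (@block_comp d s n) q k|%:R /
     ((\sum_(i < NN n) s) + (\sum_(i < NN n) s))%N%:R : R).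
Proof.
have ts : tends0 multi_infty (fun n => \sum_l (absz (k l))%:R / (n l)%:R : R).
  apply: tends0_sum => l _; apply: tends0Z => e e0.
  have [N HN] := exists_natr_gt e^-1; exists N.+1 => n Hn.
  rewrite ger0_norm ?invr_ge0// invf_ple ?posrE ?ltr0n//; last exact: leq_ltn_trans (Hn l).
  by apply: le_trans (ltW HN) _; rewrite ler_nat; apply: leq_trans (Hn l).
move=> e /ts; apply: filterS2 multi_infty_gt0 => n n0.
rewrite !ger0_norm ?divr_ge0//; last by apply: sumr_ge0 => l _; rewrite divr_ge0.
by apply: le_trans; exact: block_bad_ratio.
Qed.
End MultiIndexFilter.

(** * Integrals of possibly nonmeasurable functions off a null set *)

Section IntegralOffNull.
Context (dd : measure_display) (T : measurableType dd) (R : realType) (mu : {measure set T -> \bar R}).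
Import HBNNSimple.

(** The integral is a supremum over simple minorants. Cutting a minorant of [f] to zero on [N] keeps
    its integral and makes it a minorant of [g]; measurability of [f] and [g] never enters. *)
Lemma ge0_integral_le_off_null (N : set T) (f g : T -> \bar R) : measurable N -> mu N = 0%E ->
  (forall x, (0 <= f x)%E) -> (forall x, (0 <= g x)%E) -> (forall x, ~ N x -> f x = g x) ->
  (\int[mu]_x f x <= \int[mu]_x g x)%E.
Proof.
move=> mN N0 f0 g0 fg; rewrite !ge0_integralTE//; apply: ge_ereal_sup => _ [h hf <-].
pose h' : {nnsfun T >-> R} := mul_nnsfun h (indic_nnsfun R (measurableC mN)).
have hE x : h' x = h x * \1_(~` N) x by [].
apply: ereal_sup_ubound; exists h' => [x|].
  rewrite hE indicE; have [Nx|Nx] := EM (N x).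
    by rewrite memNset ?mulr0// => /(_ Nx).
  by rewrite mem_set// mulr1 -fg.
rewrite -!integralT_nnsfun; apply: ge0_ae_eq_integral => //.
- exact/measurable_EFinP.
- exact/measurable_EFinP.
- by move=> x _; rewrite lee_fin.
- by move=> x _; rewrite lee_fin.
exists N; split=> // x H; apply: contrapT => Nx; apply: H => _.
by rewrite hE indicE mem_set// mulr1.
Qed.

Lemma integral_off_null (N D : set T) (f g : T -> \bar R) : measurable N -> mu N = 0%E ->
  (forall x, D x -> ~ N x -> f x = g x) -> (\int[mu]_(x in D) f x = \int[mu]_(x in D) g x)%E.
Proof.
move=> mN N0 fg.
have key (u v : T -> \bar R) : (forall x, (0 <= u x)%E) -> (forall x, (0 <= v x)%E) ->
    (forall x, ~ N x -> u x = v x) -> (\int[mu]_x u x = \int[mu]_x v x)%E.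
  move=> u0 v0 uv; apply/eqP; rewrite eq_le !(@ge0_integral_le_off_null N)//.
  by move=> x /uv.
have fgD x : ~ N x -> (f \_ D) x = (g \_ D) x.
  by move=> Nx; rewrite !patchE; case: ifPn => // /set_mem Dx; exact: fg.
rewrite integral_mkcond [RHS]integral_mkcond integralE [RHS]integralE.
congr (_ - _)%E; apply: key => x; rewrite ?funepos_ge0 ?funeneg_ge0//.
  by move=> /fgD H; rewrite !funepos.unlock H.
by move=> /fgD H; rewrite !funeneg.unlock H.
Qed.
End IntegralOffNull.

Section TorusNull.
Variable R : realType.
Local Notation C := (Cx R).
Local Notation G := (measurableTypeR R).

Lemma bmf_indic n (B : set (n.-tuple R)) : measurable B -> bmf (\1_B : n.-tuple R -> R).
Proof.
move=> mB; split; first exact: measurable_indic.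
by exists 1 => t; rewrite ger0_norm// indicE; case: (_ \in _).
Qed.

Lemma torus_int_indic n (B : set (n.-tuple R)) : measurable B ->
  torus_int (\1_B : n.-tuple R -> R) = fine (torus_prob R n B).
Proof. by move=> mB; rewrite /torus_int /Rintegral integral_indic// setIT. Qed.

Lemma iint_indic_eq0 n (B : set (n.-tuple R)) : measurable B ->
  iint (\1_B : n.-tuple R -> R) = 0 <-> torus_prob R n B = 0%E.
Proof.
move=> mB; rewrite iintE; last exact: bmf_indic.
rewrite torus_int_indic//; split=> [/eqP|->]; last by rewrite mulr0.
rewrite mulf_eq0 expf_eq0 gt_eqF ?mulr_gt0 ?pi_gt0// andbF /= => /eqP f0.
by rewrite -(fineK (fin_num_measure (torus_prob R n) _ mB)) f0.
Qed.

Lemma torus_nullP n (B : set (n.-tuple R)) : torus_null B <-> (torus_prob R n).-negligible B.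
Proof.
split=> [[E [mE BE /(iint_indic_eq0 mE) E0]]|[E [mE E0 BE]]]; exists E; split=> //.
exact/iint_indic_eq0.
Qed.

(* No measurability of f and g: the components of the symbol are bounded only almost everywhere. *)
Lemma iint_off_null n (f g : n.-tuple R -> R) (B : set (n.-tuple R)) : measurable B ->
  iint (\1_B : n.-tuple R -> R) = 0 -> (forall t, ~ B t -> f t = g t) -> iint f = iint g.
Proof.
elim: n f g B => [|n IH] f g B mB B0 fg.
  apply: fg => BT; move: B0; rewrite /= indicE mem_set// => /eqP; by rewrite oner_eq0.
pose Bx (x : G) : set (n.-tuple R) := [set t | B (tuple_cons (x, t))].
have mBx x : measurable (Bx x).
  by rewrite -[Bx x]setTI; exact: (measurable_tuple_cons_section x measurableT mB).
pose phi (x : G) := iint (\1_(Bx x) : n.-tuple R -> R).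
have bB := bmf_indic mB.
have phiE x : phi x = (2 * pi) ^+ n * torus_int (fun t => \1_B (tuple_cons (x, t)) : R).
  by rewrite /phi iintE//; exact: bmf_indic.
have [[mI [K HK]] _] := torus_int_cons bB.
have mphi : measurable_fun setT phi.
  rewrite (_ : phi = fun x => (2 * pi) ^+ n * torus_int (fun t => \1_B (tuple_cons (x, t)) : R)).
    by apply: measurable_funM => //; exact: measurable_cst.
  by apply/funext => x; rewrite phiE.
have phi0 x : 0 <= phi x.
  rewrite phiE mulr_ge0 ?exprn_ge0 ?mulr_ge0 ?pi_ge0//; apply: torus_int_ge0 => t.
  by rewrite indicE; case: (_ \in _).
pose Dx := [set x : R | - pi <= x < pi].
have mD : measurable (Dx : set G).
  by rewrite (_ : Dx = `[(- pi)%R, pi[%classic); [exact: measurable_itv|apply/seteqP; split=> x; rewrite /= in_itv].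
have iphi : (\int[@lebesgue_measure R]_(x in Dx) `|(phi x)%:E| = 0)%E.
  have bphi : (\int[@lebesgue_measure R]_(x in Dx) `|(phi x)%:E| < +oo)%E.
    apply: (@le_lt_trans _ _ (\int[@lebesgue_measure R]_(x in Dx) ((2 * pi) ^+ n * `|K|)%:E)%E).
      apply: ge0_le_integral => //.
      - by do 2 apply: measurableT_comp => //; exact: measurable_funTS.
      - move=> x _ /=; rewrite lee_fin ger0_norm ?phi0// phiE.
        apply: ler_wpM2l; first by rewrite exprn_ge0 ?mulr_ge0 ?pi_ge0.
        apply: le_trans (ler_norm _) _; apply: le_trans (HK x) _; exact: ler_norm.
    rewrite integral_cst//= (_ : Dx = `[(- pi)%R, pi[%classic); last first.
      by apply/seteqP; split=> x; rewrite /= in_itv.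
    by rewrite lebesgue_measure_itv /= lte_fin; case: ifP => _; rewrite -?EFinD -EFinM ltry.
  have e : (\int[@lebesgue_measure R]_(x in Dx) `|(phi x)%:E| = \int[@lebesgue_measure R]_(x in Dx) (phi x)%:E)%E.
    by apply: eq_integral => x _; rewrite gee0_abs// lee_fin.
  have B0' : fine (\int[@lebesgue_measure R]_(x in Dx) (phi x)%:E) = 0 by exact: B0.
  have p0 : (0 <= \int[@lebesgue_measure R]_(x in Dx) `|(phi x)%:E|)%E by exact: integral_ge0.
  rewrite -[LHS]fineK; first by rewrite e B0'.
  by rewrite ge0_fin_numE.
(* The slice masses [phi] are nonnegative with integral zero, so almost every slice of [B] is null
   and the induction hypothesis applies to it. *)
have [N [mN N0 HN]] : ae_eq (@lebesgue_measure R) Dx (fun x => (phi x)%:E) (cst 0%E).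
  apply/ae_eq_integral_abs => //; apply/measurable_EFinP; exact: measurable_funTS.
rewrite /= /Rintegral; congr fine; apply: (@integral_off_null _ _ _ _ N) => // x Dxx Nx.
congr EFin; apply: (IH _ _ (Bx x)) => [||t Bt]; [exact: mBx| |exact: fg].
have : (phi x)%:E = 0%E by apply: contrapT => H; apply: Nx; apply: HN => /= /(_ Dxx).
by case.
Qed.

Lemma cint_ae n (f g : n.-tuple R -> C) : {ae torus_prob R n, forall t, f t = g t} -> cint f = cint g.
Proof.
move=> [B [mB /(iint_indic_eq0 mB) B0 HB]].
have fg t : ~ B t -> f t = g t by move=> Bt; apply: contrapT => H; apply: Bt; exact: HB.
by congr (_ +i* _); apply: (iint_off_null mB B0) => t /fg ->.
Qed.

Lemma ae_flip n (b : 'I_n -> bool) (P : n.-tuple R -> Prop) :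
  {ae torus_prob R n, forall t, P t} -> {ae torus_prob R n, forall t, P (flip b t)}.
Proof.
move=> [B [mB B0 HB]]; exists (flip b @^-1` B).
have mB' : measurable (flip b @^-1` B) by rewrite -[X in measurable X]setTI; exact: measurable_flip.
split=> //; last by move=> t H; apply: HB.
apply/iint_indic_eq0 => //; rewrite iintE; last exact: bmf_indic.
rewrite (_ : torus_int _ = torus_int (\1_B : n.-tuple R -> R)).
  by rewrite torus_int_indic// B0 mulr0.
by rewrite -(torus_int_flip b (bmf_indic mB)).
Qed.

Lemma ae_inT n : {ae torus_prob R n, forall t, inT t}.
Proof.
have := @ae_tnth_itv R n; apply: filterS => t H j.
by have /andP[/ltW -> ->] := H j.
Qed.
End TorusNull.

(** * Symbols and their spectral range *)

Section SpectralRange.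
Variables (R : realType) (d m : nat).
Local Notation C := (Cx R).
Local Notation T := (d.-tuple R).
Variable H : T -> 'M[C]_m.

Lemma specRange_compl z : ~ specRange H z ->
  exists2 e : R, 0 < e & {ae torus_prob R d, forall t, forall l, l \in eigs (H t) -> e <= nrm (l - z)}.
Proof.
move=> /existsNP[e] /not_implyP[e0] /contrapT /torus_nullP nB; exists e => //.
have aB : {ae torus_prob R d, forall t, ~ (inT t /\ exists2 l, l \in eigs (H t) & nrm (l - z) < e)}.
  by apply: negligibleS nB => t /= /contrapT.
apply: filterS2 (@ae_inT R d) aB => t iT aB l lt; rewrite leNgt; apply/negP => ll.
by apply: aB; split=> //; exists l.
Qed.

Lemma specRange_compl_intro z (e : R) : 0 < e ->
  {ae torus_prob R d, forall t, forall l, l \in eigs (H t) -> e <= nrm (l - z)} -> ~ specRange H z.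
Proof.
move=> e0 Hae /(_ e e0); apply; apply/torus_nullP.
apply: negligibleS Hae => t [_ [l lt le]] /= /(_ l lt).
by rewrite leNgt le.
Qed.

Let grid (p : int * int * nat) : C := p.1.1%:~R / p.2.+1%:R +i* (p.1.2%:~R / p.2.+1%:R).
Let mesh (p : int * int * nat) : R := 2 / p.2.+1%:R.

Lemma grid_near z (e : R) : 0 < e -> exists2 p, nrm (z - grid p) <= mesh p & 2 * mesh p < e.
Proof.
move=> e0; have [N HN] := exists_natr_gt (4 / e).
exists (Num.floor (N.+1%:R * complex.Re z), Num.floor (N.+1%:R * complex.Im z), N).
  apply: le_trans (ler_nrm_ReIm _) _; rewrite cReB cImB /= /mesh /=.
  have -> : 2 / N.+1%:R = N.+1%:R^-1 + N.+1%:R^-1 :> R by rewrite -mulr2n mulr_natl.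
  by apply: lerD; exact: floor_grid_dist.
rewrite /mesh /= mulrA ltr_pdivrMr// [e * _]mulrC -ltr_pdivrMr//.
have -> : 2 * 2 / e = 4 / e by congr (_ / _); rewrite -natrM.
by apply: lt_le_trans HN _; rewrite ler_nat.
Qed.

(** A Lindelof argument: every point off the range lies in one of countably many grid discs that
    almost surely contain no eigenvalue, so one null set serves all points at once. *)
Lemma ae_eigs_specRange : {ae torus_prob R d, forall t, forall l, l \in eigs (H t) -> specRange H l}.
Proof.
(* Whether a disc is null does not depend on [t]; as a premise inside the almost-everywhere
   statement it lets all discs be enumerated together. *)
pose null p := {ae torus_prob R d, forall t, forall l, l \in eigs (H t) -> mesh p < nrm (l - grid p)}.
have key p : {ae torus_prob R d, forall t, null p -> forall l, l \in eigs (H t) -> mesh p < nrm (l - grid p)}.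
  have [np|np] := EM (null p); first by apply: filterS np => t.
  by apply: aeW => t /np.
have key' n : {ae torus_prob R d, forall t, if unpickle n is Some p then null p ->
   forall l, l \in eigs (H t) -> mesh p < nrm (l - grid p) else True}.
  by case: (unpickle n) => [p|]; [exact: key|exact: aeW].
have := @ae_foralln _ _ _ (torus_prob R d) (fun n t => if unpickle n is Some p then null p ->
   forall l, l \in eigs (H t) -> mesh p < nrm (l - grid p) else True).
move=> /(_ key'); apply: filterS => t Ht l lt; apply: contrapT => /specRange_compl[e e0 He].
have [p zp pe] := grid_near l e0.
have np : null p.
  apply: filterS He => t' He l' /He el.
  have : nrm (l' - l) <= nrm (l' - grid p) + nrm (l - grid p).
    have -> : l' - l = (l' - grid p) - (l - grid p) by ring.
    exact: ler_nrmB.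
  lra.
have := Ht (pickle p); rewrite pickleK => /(_ np l lt); lra.
Qed.

Lemma specRange_closed z : ~ specRange H z ->
  exists2 r : R, 0 < r & forall w, specRange H w -> r <= nrm (w - z).
Proof.
move=> /specRange_compl[e e0 He]; exists (e / 2) => [|w Sw]; first by rewrite divr_gt0.
rewrite leNgt; apply/negP => wz; move: Sw; apply: (@specRange_compl_intro w (e / 2)).
  by rewrite divr_gt0.
apply: filterS He => t He l /He el.
have : nrm (l - z) <= nrm (l - w) + nrm (w - z).
  have -> : l - z = (l - w) + (w - z) by ring.
  exact: ler_nrmD.
lra.
Qed.

Lemma specRange_bounded (M : R) :
  {ae torus_prob R d, forall t, forall l, l \in eigs (H t) -> nrm l <= M} ->
  forall w, specRange H w -> nrm w <= M + 1.
Proof.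
move=> HM w Sw; rewrite leNgt; apply/negP => wM; move: Sw.
apply: (@specRange_compl_intro w 1) => //; apply: filterS HM => t HM l /HM lM.
have : nrm w <= nrm (l - w) + nrm l.
  have -> : nrm w = nrm (l - (l - w)) by congr nrm; ring.
  by rewrite [_ + nrm l]addrC; exact: ler_nrmB.
lra.
Qed.

Lemma specRange_nowhere_dense : interior (specRange H) = set0 ->
  forall z (r : R), 0 < r -> exists2 w, ~ specRange H w & nrm (w - z) < r.
Proof.
move=> S0 z r r0; apply: contrapT => Hn.
have : interior (specRange H) z.
  rewrite /interior; apply/nbhs_nrmP; exists r => // w wz; apply: contrapT => Sw.
  by apply: Hn; exists w.
by rewrite S0.
Qed.
End SpectralRange.

(** * The symbol of the sandwich Toeplitz matrices *)

Section Symbols.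
Variables (R : realType) (d s : nat).
Local Notation C := (Cx R).
Local Notation T := (d.-tuple R).
Implicit Types (Z W : T -> 'M[C]_s).

Definition mx_measurable m (Z : T -> 'M[C]_m) := forall i j,
  measurable_fun setT (fun t => complex.Re (Z t i j)) /\ measurable_fun setT (fun t => complex.Im (Z t i j)).

(** Squared moduli are compared, since their measurability is immediate from real and imaginary
    parts. *)
Definition trunc (M : R) Z (t : T) : 'M[C]_s :=
  \matrix_(i, j) if nrm (Z t i j) ^+ 2 <= M ^+ 2 then Z t i j else 0.

Lemma mcbmf_trunc M Z : 0 <= M -> mx_measurable Z -> mcbmf (trunc M Z).
Proof.
move=> M0 mZ i j; have [mr mi] := mZ i j.
have mc : measurable_fun setT (fun t => nrm (Z t i j) ^+ 2 <= M ^+ 2).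
  apply: measurable_fun_ler; last exact: measurable_cst.
  rewrite (_ : (fun t => _) = fun t => complex.Re (Z t i j) ^+ 2 + complex.Im (Z t i j) ^+ 2).
    by apply: measurable_funD; exact: measurable_funX.
  by apply/funext => t; rewrite sqr_nrm.
apply: cbmfP.
- rewrite (_ : (fun t => _) = fun t => if nrm (Z t i j) ^+ 2 <= M ^+ 2 then complex.Re (Z t i j) else 0).
    by apply: measurable_fun_ifT => //; exact: measurable_cst.
  by apply/funext => t; rewrite mxE; case: ifP.
- rewrite (_ : (fun t => _) = fun t => if nrm (Z t i j) ^+ 2 <= M ^+ 2 then complex.Im (Z t i j) else 0).
    by apply: measurable_fun_ifT => //; exact: measurable_cst.
  by apply/funext => t; rewrite mxE; case: ifP.
exists M => t; rewrite mxE; case: ifP => [|_]; last by rewrite nrm0.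
by rewrite ler_pXn2r// nnegrE nrm_ge0.
Qed.

Lemma Linf_trunc Z : Linf_mx Z -> exists2 Z', mcbmf Z' & {ae torus_prob R d, forall t, Z t = Z' t}.
Proof.
move=> [mZ [M /torus_nullP nM]]; exists (trunc (Num.max 0 M) Z).
  by apply: mcbmf_trunc => //; rewrite le_max lexx.
have aM : {ae torus_prob R d, forall t, ~ (inT t /\ exists i j, M < nrm (Z t i j))}.
  by apply: negligibleS nM => t /= /contrapT.
apply: filterS2 (@ae_inT R d) aM => t iT aM; apply/matrixP => i j; rewrite mxE ifT//.
have M0 : 0 <= Num.max 0 M by rewrite le_max lexx.
rewrite ler_pXn2r// ?nnegrE ?nrm_ge0// le_max; apply/orP; right; rewrite leNgt; apply/negP => H.
by apply: aM; split=> //; exists i, j.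
Qed.

Lemma tnegE (t : T) : tneg t = flip (fun=> true) t.
Proof. by apply: eq_from_tnth => j; rewrite !tnth_mktuple. Qed.

Lemma rSE (SL : {set 'I_d}) (t : T) : rS SL t = flip (fun j => j \in SL) t.
Proof. by apply: eq_from_tnth => j; rewrite !tnth_mktuple. Qed.

Lemma rS_tnegE (SL : {set 'I_d}) (t : T) : rS SL (tneg t) = flip (fun j => j \notin SL) t.
Proof. by apply: eq_from_tnth => j; rewrite !tnth_mktuple; case: (j \in SL); rewrite ?opprK. Qed.

Lemma block_entry_closed (Q : (T -> C) -> Prop) (A1 A2 A3 A4 : T -> 'M[C]_s) :
  (forall i j, Q (fun t => A1 t i j)) -> (forall i j, Q (fun t => A2 t i j)) ->
  (forall i j, Q (fun t => A3 t i j)) -> (forall i j, Q (fun t => A4 t i j)) ->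
  forall i j, Q (fun t => block_mx (A1 t) (A2 t) (A3 t) (A4 t) i j).
Proof.
move=> Q1 Q2 Q3 Q4 i j; rewrite -(splitK i) -(splitK j).
case: (fintype.split i) => i'; case: (fintype.split j) => j' /=.
- by rewrite (_ : (fun t => _) = fun t => A1 t i' j')//; apply/funext => t; rewrite block_mxEul.
- by rewrite (_ : (fun t => _) = fun t => A2 t i' j')//; apply/funext => t; rewrite block_mxEur.
- by rewrite (_ : (fun t => _) = fun t => A3 t i' j')//; apply/funext => t; rewrite block_mxEdl.
- by rewrite (_ : (fun t => _) = fun t => A4 t i' j')//; apply/funext => t; rewrite block_mxEdr.
Qed.

Lemma mcbmf_Gsym SL Z W : mcbmf Z -> mcbmf W -> mcbmf (Gsym SL Z W).
Proof.
move=> bZ bW; rewrite /mcbmf /Gsym; apply: (@block_entry_closed (@cbmf R d)) => i j.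
- exact: bZ.
- by apply: eq_cbmf (cbmf_flip (fun k => k \notin SL) (bW i j)) => t; rewrite rS_tnegE.
- apply: eq_cbmf (cbmfN (cbmfJ (cbmf_flip (fun k => k \in SL) (bW i j)))) => t.
  by rewrite !mxE rSE.
- by apply: eq_cbmf (cbmfJ (cbmf_flip (fun=> true) (bZ i j))) => t; rewrite !mxE tnegE.
Qed.

Lemma ae_Gsym SL Z W Z' W' : {ae torus_prob R d, forall t, Z t = Z' t} ->
  {ae torus_prob R d, forall t, W t = W' t} ->
  {ae torus_prob R d, forall t, Gsym SL Z W t = Gsym SL Z' W' t}.
Proof.
move=> aZ aW.
have a1 := ae_flip (fun=> true) aZ.
have a2 := ae_flip (fun k => k \in SL) aW.
have a3 := ae_flip (fun k => k \notin SL) aW.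
apply: filterS2 (filterI aZ a1) (filterI a2 a3) => t [h1 h2] [h3 h4].
by rewrite /Gsym rS_tnegE rSE tnegE h1 h2 h3 h4.
Qed.

Section Sandwich.
Variables (SL : {set 'I_d}) (Z W Z' W' : T -> 'M[C]_s).
Hypotheses (bZ : mcbmf Z') (bW : mcbmf W').
Hypotheses (aZ : {ae torus_prob R d, forall t, Z t = Z' t}) (aW : {ae torus_prob R d, forall t, W t = W' t}).

Lemma normalized_cint (f : T -> C) : cbmf f -> (((2 * pi) ^- d)%:C : C) * cint f = ctorus f.
Proof.
move=> bf; rewrite cintE// mulrA -rmorphM /= mulVf ?rmorph1 ?mul1r//.
by rewrite expf_eq0 gt_eqF ?andbF// mulr_gt0// pi_gt0.
Qed.

Lemma ipS_phase (k : 'I_d -> int) (t : T) :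
  expi (- ipS SL k t) * expi (- ipS (~: SL)%SET k t) = conjc (ek k t) :> C.
Proof.
rewrite -expiD /ek conjc_expi; congr expi; rewrite -opprD; congr (- _).
rewrite /ipS [RHS](bigID (fun j => j \in SL)) /=; congr (_ + _).
by apply: eq_bigl => j; rewrite finset.in_setC.
Qed.

(** Moving the right exponential past j conjugates it, so on the W part the coordinates of S_R enter
    with the opposite sign. Undoing this by a reflection produces the argument of [W] in the upper
    right block. *)
Lemma ipS_phase_flip (k : 'I_d -> int) (t : T) :
  expi (- ipS SL k t) * conjc (expi (- ipS (~: SL)%SET k t)) = conjc (ek k (flip (fun j => j \notin SL) t)) :> C.
Proof.
rewrite conjc_expi -expiD /ek conjc_expi; congr expi; rewrite opprK -[X in _ + X]opprK -opprD; congr (- _).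
rewrite /ipS [RHS](bigID (fun j => j \in SL)) /= -sumrN; congr (_ + _).
  by apply: eq_bigr => j jS; rewrite tnth_mktuple jS.
rewrite (eq_bigl (fun j => j \notin SL)); last by move=> j; rewrite finset.in_setC.
by apply: eq_bigr => j /negbTE jS; rewrite tnth_mktuple jS /= mulrN.
Qed.

Lemma qmul_sandwich (a b z w : C) : qmul (qmul (a, 0) (z, w)) (b, 0) = (a * b * z, a * conjc b * w).
Proof.
have c0 : conjc (0 : C) = 0 by apply: Cext => //=; rewrite oppr0.
rewrite /qmul; cbn [fst snd]; rewrite !c0 !(mulr0, mul0r, subr0, add0r, addr0).
by congr (_, _); rewrite mulrAC.
Qed.

Lemma sandwich_fst (k : 'I_d -> int) p q :
  (sandwich SL (Fq Z W) k p q).1 = ctorus (fun t => Z' t p q * conjc (ek k t)).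
Proof.
rewrite mxE -[RHS]normalized_cint; last by apply: cbmfM; [exact: bZ|apply: cbmfJ; exact: cbmf_ek].
congr (_ * _); apply: cint_ae; apply: filterS aZ => t Zt.
by rewrite mxE qmul_sandwich ipS_phase Zt mulrC.
Qed.

Lemma sandwich_snd (k : 'I_d -> int) p q :
  (sandwich SL (Fq Z W) k p q).2 = ctorus (fun t => W' (rS SL (tneg t)) p q * conjc (ek k t)).
Proof.
pose b := fun j : 'I_d => j \notin SL.
have bf : cbmf (fun t => W' t p q * conjc (ek k (flip b t))).
  by apply: cbmfM; [exact: bW|apply: cbmfJ; apply: (cbmf_flip b); exact: cbmf_ek].
rewrite mxE; transitivity (ctorus (fun t => W' t p q * conjc (ek k (flip b t)))).
  rewrite -[RHS]normalized_cint//; congr (_ * _); apply: cint_ae; apply: filterS aW => t Wt.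
  by rewrite mxE qmul_sandwich ipS_phase_flip Wt; exact: mulrC.
rewrite -(ctorus_flip b bf); congr ctorus; apply/funext => t; rewrite rS_tnegE -/b.
congr (_ * conjc (ek k _)); apply: eq_from_tnth => j; rewrite !tnth_mktuple.
by case: (b j); rewrite ?opprK.
Qed.

Lemma ek_shift (n : 'I_d -> nat) u v (t : T) :
  ek (block_freq v) t * conjc (ek (block_freq u) t) =
  conjc (ek (fun l => (alpha n (@block_point d s n u) l)%:Z - (alpha n (@block_point d s n v) l)%:Z) t) :> C.
Proof.
rewrite !conjc_ek -ekD; congr ek; apply/funext => l; rewrite !ffunE opprB addrC; ring.
Qed.

(** Conjugating a Fourier coefficient conjugates the function and reflects its argument; this
    accounts for the lower blocks of the symbol. *)
Lemma conj_flip_coef (f : T -> C) (k : 'I_d -> int) : cbmf f ->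
  conjc (ctorus (fun t => f t * conjc (ek k t))) =
  ctorus (fun t => conjc (f (flip (fun=> true) t)) * conjc (ek k t)).
Proof.
move=> bf; have bg : cbmf (fun t => f t * conjc (ek k t)).
  by apply: cbmfM => //; apply: cbmfJ; exact: cbmf_ek.
rewrite -ctorusJ// -(ctorus_flip (fun=> true) (cbmfJ bg)); congr ctorus; apply/funext => t.
rewrite rmorphM; congr (_ * _); rewrite -[LHS]/(conjc (conjc _)) conjcK conjc_ek /ek; congr expi.
apply: eq_bigr => j _.
by rewrite tnth_mktuple mulrN rmorphN mulNr.
Qed.

Lemma Toeplitz_entry (n : 'I_d -> nat) F (a b : 'I_(\sum_(i < NN n) s)) :
  Toeplitz SL n F a b = sandwich SL F (fun l => (alpha n (@tagnat.sig1 _ (fun=> s) a) l)%:Z -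
    (alpha n (@tagnat.sig1 _ (fun=> s) b) l)%:Z) (tagnat.sig2 a) (tagnat.sig2 b) :> quat R.
Proof. by rewrite mxE. Qed.

Lemma Phi_Toeplitz (n : 'I_d -> nat) :
  Phi (Toeplitz SL n (Fq Z W)) = BT (@block_freq d s n) (@block_comp d s n) (Gsym SL Z' W').
Proof.
apply/matrixP => u v; rewrite [RHS]mxE /fhat.
transitivity (ctorus (fun t => Gsym SL Z' W' t (block_comp u) (block_comp v) * conjc (ek
    (fun l => (alpha n (block_point u) l)%:Z - (alpha n (block_point v) l)%:Z) t))); last first.
  by congr ctorus; apply/funext => t; rewrite -mulrA ek_shift.
rewrite /Phi /block_comp /block_point -[in LHS](splitK u) -[in LHS](splitK v).
have bWf p q : cbmf (fun t => W' (rS SL (tneg t)) p q).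
  by apply: eq_cbmf (cbmf_flip (fun k => k \notin SL) (bW p q)) => t; rewrite rS_tnegE.
case: (fintype.split u) => a; case: (fintype.split v) => b.
- rewrite block_mxEul mxE Toeplitz_entry sandwich_fst; congr ctorus; apply/funext => t.
  by rewrite /Gsym block_mxEul.
- rewrite block_mxEur mxE Toeplitz_entry sandwich_snd; congr ctorus; apply/funext => t.
  by rewrite /Gsym block_mxEur.
- rewrite block_mxEdl mxE [X in - X]mxE Toeplitz_entry sandwich_snd conj_flip_coef; last exact: bWf.
  rewrite -[LHS]mulN1r -ctorusZ; last first.
    apply: cbmfM; last by apply: cbmfJ; exact: cbmf_ek.
    by apply: cbmfJ; exact: (cbmf_flip (fun=> true) (bWf _ _)).
  congr ctorus; apply/funext => t; rewrite /Gsym block_mxEdl !mxE mulN1r mulNr; congr (- (conjc (W' _ _ _) * _)).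
  by apply: eq_from_tnth => j; rewrite !tnth_mktuple; case: (j \in SL); rewrite ?opprK.
- rewrite block_mxEdr mxE Toeplitz_entry sandwich_fst conj_flip_coef//; congr ctorus; apply/funext => t.
  by rewrite /Gsym block_mxEdr !mxE tnegE.
Qed.
End Sandwich.
End Symbols.

Lemma pow_bump_le (R : realType) (q x : R) (k : nat) : 0 <= x <= 1 -> (x != 0 -> 2^-1 <= q) ->
  x <= 4 ^+ k * q ^+ (2 * k).
Proof.
move=> /andP[x0 x1] xq; rewrite exprM -exprMn; have [->|xn0] := eqVneq x 0.
  by rewrite exprn_ge0// mulr_ge0// sqr_ge0.
apply: le_trans x1 _; apply: exprn_ege1; have := xq xn0 => q2.
have : 2^-1 * 2^-1 <= q ^+ 2 by rewrite expr2 ler_pM.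
lra.
Qed.

Lemma torus_int_le_cst_ae (R : realType) (n : nat) (f : n.-tuple R -> R) (c : R) : bmf f ->
  {ae torus_prob R n, forall t, f t <= c} -> torus_int f <= c.
Proof.
move=> bf fc; have [mf [B HB]] := bf.
have bg : bmf (fun t => Num.min (f t) c).
  split; first exact: measurable_minr mf (measurable_cst c).
  exists (Num.max B `|c|) => t; rewrite le_max /Num.min; case: ifP => _; first by rewrite HB.
  by rewrite lexx orbT.
rewrite (ae_eq_torus_int bf bg); last by apply: filterS fc => t /min_idPl ->.
rewrite -[leRHS](torus_int_cst n); apply: torus_int_le => //; first exact: bmf_cst.
by move=> t; rewrite ge_min lexx orbT.
Qed.

Lemma eigs_peval (R : realType) (m : nat) (P : {poly Cx R}) (A : 'M[Cx R]_m) :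
  perm_eq (eigs (peval P A)) [seq P.[l] | l <- eigs A].
Proof.
have [U [V [UU eA Vt pe]]] := schur_form A; have [PVt PV] := peval_trig P Vt.
rewrite perm_sym (perm_trans (perm_map _ pe))// -map_comp; apply: prod_XsubC_eq.
rewrite -char_poly_eigs big_map eA peval_conj// char_poly_conj// char_poly_trig//.
by apply: eq_bigr => i _; rewrite /= PV.
Qed.

(** * Empirical and limiting eigenvalue functionals *)

Section Distribution.
Variables (R : realType) (d m : nat).
Local Notation C := (Cx R).
Local Notation T := (d.-tuple R).
Local Notation freq := {ffun 'I_d -> int}.
Variables (I : Type) (F : set_system I).
Context {FF : Filter F}.
Variables (D N : I -> nat) (fr : forall n, 'I_(D n) -> freq) (cp : forall n, 'I_(D n) -> 'I_m).
Hypothesis fr_cp_inj : forall n (u v : 'I_(D n)), cp u = cp v -> fr u = fr v -> u = v.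
Hypothesis bad_null : forall q k, tends0 F (fun n => #|bad (@fr n) (@cp n) q k|%:R / (D n)%:R : R).
Hypothesis cp_card : forall n p, #|[pred u | @cp n u == p]| = N n.
Hypothesis D_N : forall n, D n = (N n * m)%N.
Hypothesis N_gt0 : \forall n \near F, (0 < N n)%N.
Variables (H : T -> 'M[C]_m) (bH : mcbmf H).

Local Notation BTn n := (BT (@fr n) (@cp n)).

Definition empirical n (f : C -> R) : R := (\sum_(l <- eigs (BTn n H)) f l) / (D n)%:R.
Definition limit_functional (f : C -> R) : R := torus_int (fun t => \sum_(l <- eigs (H t)) f l) / m%:R.

Lemma eigs_bound : exists M : R, [/\ 0 <= M, forall t l, l \in eigs (H t) -> nrm l <= M &
  forall n l, l \in eigs (BTn n H) -> nrm l <= M].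
Proof.
have [B B0 HB] := mcbmf_hs_bound bH.
(* [B] bounds a squared norm; [B + 1] then bounds the norm without a square root. *)
have BM : B <= (B + 1) ^+ 2 by have := sqr_ge0 B; lra.
have M0 : 0 <= B + 1 by rewrite addr_ge0.
exists (B + 1); split=> // [t l lt|n].
  rewrite -(@ler_pXn2r _ 2)// ?nnegrE ?nrm_ge0//; apply: le_trans BM; apply: le_trans (HB t).
  by have := eig_hs 'X^1 lt; rewrite hornerXn expr1 peval_Xn expr1.
apply: eig_op_bound => // X; apply: BT_op_bound => //; first exact: fr_cp_inj.
by move=> t; exact: le_trans (HB t) BM.
Qed.

Lemma mx_measurable_mcbmf : mx_measurable H.
Proof. by move=> i j; have [[mr _] [mi _]] := bH i j. Qed.

Lemma bmf_eigs f : ccont f -> bmf (fun t => \sum_(l <- eigs (H t)) f l).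
Proof.
move=> cf; split; first exact: measurable_eigs_sum cf mx_measurable_mcbmf.
have [M [M0 HM _]] := eigs_bound; have [B B0 HB] := ccont_bounded M cf.
exists (m%:R * B) => t; apply: le_trans (ler_norm_sum _ _ _) _.
apply: (@le_trans _ _ (\sum_(l <- eigs (H t)) B)).
  by rewrite !big_seq; apply: ler_sum => l /HM /HB.
by rewrite big_const_seq count_predT size_eigs iter_addr_0 mulr_natl.
Qed.

Lemma empirical_positive M n : (forall l, l \in eigs (BTn n H) -> nrm l <= M) -> positive_on M (empirical n).
Proof.
move=> HM; split=> [f g _ _|a f _|f _ f0|].
- by rewrite /empirical big_split mulrDl.
- by rewrite /empirical -mulr_sumr mulrA.
- rewrite /empirical divr_ge0// big_seq; apply: sumr_ge0 => l ln; exact/f0/HM.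
rewrite /empirical big_const_seq count_predT size_eigs iter_addr_0.
by apply: ratio_le; rewrite ?mulr1.
Qed.

Lemma limit_positive M : (forall t l, l \in eigs (H t) -> nrm l <= M) -> positive_on M limit_functional.
Proof.
move=> HM; split=> [f g cf cg|a f cf|f _ f0|].
- rewrite /limit_functional -mulrDl -torus_intD; [|exact: bmf_eigs..].
  by congr (_ / _); congr torus_int; apply/funext => t; rewrite big_split.
- rewrite /limit_functional mulrA -torus_intZ; last exact: bmf_eigs.
  by congr (_ / _); congr torus_int; apply/funext => t; rewrite mulr_sumr.
- rewrite /limit_functional divr_ge0//; apply: torus_int_ge0 => t.
  by rewrite big_seq; apply: sumr_ge0 => l ln; exact/f0/(HM t).
rewrite /limit_functional (_ : torus_int _ = m%:R).
  by apply: ratio_le; rewrite ?mulr1.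
rewrite -[RHS](torus_int_cst d); congr torus_int; apply/funext => t.
by rewrite big_const_seq count_predT size_eigs iter_addr_0.
Qed.

Lemma empirical_poly (P : {poly C}) :
  tends0 F (fun n => empirical n (fun w => complex.Re P.[w]) - limit_functional (fun w => complex.Re P.[w])).
Proof.
apply: tends0_eq (trace_limit fr_cp_inj bad_null cp_card D_N N_gt0 P bH).
apply: nearW => n; rewrite /empirical /limit_functional; congr (_ / _ - _ / _).
  by rewrite tr_peval cRe_sum.
by congr torus_int; apply/funext => t; rewrite tr_peval cRe_sum.
Qed.

Section Support.
Variable S : set C.
Hypothesis ae_eigs : {ae torus_prob R d, forall t, forall l, l \in eigs (H t) -> S l}.

Lemma limit_locally_null z (r : R) : 0 < r -> (forall w, S w -> r <= nrm (w - z)) ->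
  locally_null F (fun=> limit_functional) z.
Proof.
move=> r0 Sr; exists r => // f cf _ fr0.
rewrite (_ : (fun _ : I => limit_functional f) = fun=> 0); first exact: tends0_cst0.
apply/funext => _; rewrite /limit_functional (_ : torus_int _ = 0) ?mul0r//.
rewrite -[RHS](torus_int_cst d); apply: ae_eq_torus_int; [exact: bmf_eigs|exact: bmf_cst|].
by apply: filterS ae_eigs => t St; rewrite big_seq big1// => l /St /Sr /fr0.
Qed.

(* If |Q| <= 1/8 on S and Q(z) = 1, the mass near z is at most 4^k hs(Q(A_n)^k) / D_n, and hs(Q(H)^k) decays
   like 16^-k uniformly in t. *)
Lemma empirical_locally_null z (Q : {poly C}) : Q.[z] = 1 -> (forall w, S w -> nrm Q.[w] <= 8^-1) ->
  locally_null F empirical z.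
Proof.
(* On this ball |Q| > 1/2, so 4^k |Q|^(2k) dominates a test function supported there. *)
move=> Qz QS; have [r r0 Hr] := ccont_nrm_poly Q z (ltac:(rewrite invr_gt0; lra) : 0 < 2^-1 :> R).
exists r => // f cf f01 fr0 e e0.
have bump w k : f w <= 4 ^+ k * nrm Q.[w] ^+ (2 * k).
  apply: pow_bump_le => // fw; have [rw|/Hr] := lerP r (nrm (w - z)); first by rewrite fr0 ?eqxx in fw.
  rewrite Qz nrm1 ltr_norml => /andP[h _]; lra.
have bQ := mcbmf_peval Q bH; have [B B0 HB] := mcbmf_hs_bound bQ.
have r8 : 0 < 8^-1 :> R by rewrite invr_gt0.
have [K K0 HK] := @power_bound R m (B + 1) 8^-1 r8 (addr_ge0 B0 ler01).
have ihsQ k : ihs (fun t => peval (Q ^+ k) (H t)) <= K * (2 * 8^-1) ^+ (2 * k).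
  apply: torus_int_le_cst_ae; first exact/bmf_hs/mcbmf_peval.
  apply: filterS ae_eigs => t St; rewrite pevalX; apply: HK.
    by apply: le_trans (HB t) _; have := sqr_ge0 B; lra.
  by move=> l; rewrite (perm_mem (eigs_peval Q (H t))) => /mapP[x /St Sx ->]; exact: QS.
have empk n k : empirical n f <= 4 ^+ k * (2 * (hs (peval (Q ^+ k) (BTn n H) - BTn n (fun t => peval (Q ^+ k) (H t))) / (D n)%:R) +
   2 * ihs (fun t => peval (Q ^+ k) (H t))).
  rewrite /empirical; apply: (@le_trans _ _ (4 ^+ k * (hs (peval (Q ^+ k) (BTn n H)) / (D n)%:R))).
    rewrite mulrA; apply: ler_wpM2r; first by rewrite invr_ge0.
    apply: (@le_trans _ _ (4 ^+ k * \sum_(l <- eigs (BTn n H)) nrm (Q ^+ k).[l] ^+ 2)).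
      rewrite mulr_sumr; apply: ler_sum => l _; rewrite horner_exp nrmX -exprM mulnC; exact: bump.
    by apply: ler_wpM2l; [exact: exprn_ge0|exact: sum_eigs_hs].
  apply: ler_wpM2l; first exact: exprn_ge0.
  have K0' := ihs_ge0 (fun t => peval (Q ^+ k) (H t)).
  set Y := BTn n (fun t => peval (Q ^+ k) (H t)).
  have hY : hs Y / (D n)%:R <= ihs (fun t => peval (Q ^+ k) (H t)).
    by apply: ratio_le => //; apply: hs_BT; [exact: fr_cp_inj|exact: mcbmf_peval].
  have := hsD (peval (Q ^+ k) (BTn n H) - Y) Y; rewrite subrK => h.
  have D0 : 0 <= (D n)%:R^-1 :> R by rewrite invr_ge0.
  apply: le_trans (ler_wpM2r D0 h) _; rewrite mulrDr mulrDl -mulrA -[2 * hs Y / _]mulrA lerD2l.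
  by apply: ler_wpM2l.
have q01 : 0 <= (4^-1 : R) < 1 by rewrite invr_ge0 ler0n /= invf_lt1//; lra.
have eK : 0 < e / 2 / (2 * K + 1) by rewrite !divr_gt0//; lra.
(* [k] is fixed before [n]: the symbol part contributes at most 2 K 4^k (2/8)^(2k) = 2 K 4^-k, and
   for this fixed [k] the Toeplitz error then vanishes along [F]. *)
have [k Hk] := exists_expr_lt q01 eK.
have e4 : 0 < e / 2 / (2 * 4 ^+ k) by rewrite !divr_gt0// mulr_gt0// exprn_gt0.
have neg := negligible_peval fr_cp_inj bad_null (Q ^+ k) bH.
have := neg FF _ e4; apply: filterS => n; rewrite ger0_norm ?divr_ge0 ?hs_ge0// => h.
rewrite ger0_norm; last first.
  by rewrite /empirical divr_ge0//; apply: sumr_ge0 => l _; have /andP[] := f01 l.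
apply: le_trans (empk n k) _; rewrite mulrDr (splitr e); apply: lerD.
  have p0 : 0 < 2 * 4 ^+ k :> R by rewrite mulr_gt0// exprn_gt0.
  move: h; rewrite ler_pdivlMr//; set x := hs _ / _; move=> h; apply: le_trans h.
  by rewrite (_ : 4 ^+ k * (2 * x) = x * (2 * 4 ^+ k))//; ring.
have : 4 ^+ k * (2 * ihs (fun t => peval (Q ^+ k) (H t))) <= 2 * K * 4^-1 ^+ k.
  have -> : 2 * K * 4^-1 ^+ k = 4 ^+ k * (2 * (K * (2 * 8^-1) ^+ (2 * k))).
    have -> : (2 * 8^-1) ^+ (2 * k) = 4^-1 ^+ k * 4^-1 ^+ k :> R.
      have -> : 2 * 8^-1 = 4^-1 :> R by lra.
      by rewrite mulnC muln2 -addnn exprD.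
    have : 4 ^+ k * 4^-1 ^+ k = 1 :> R by rewrite -exprMn divff// expr1n.
    move: (4 ^+ k) (4^-1 ^+ k) => a b ab.
    have -> : a * (2 * (K * (b * b))) = 2 * K * (a * b) * b by ring.
    by rewrite ab mulr1.
  by rewrite ler_wpM2l ?exprn_ge0// ler_wpM2l.
move/le_trans; apply; move: Hk; rewrite ltr_pdivlMr; last lra.
move: (4^-1 ^+ k) => b Hk; have [b0|b0] := lerP 0 b; first lra.
by have := mulr_ge0_le0 K0 (ltW b0); lra.
Qed.
End Support.
End Distribution.

Section EigenvalueAverages.
Variable R : realType.
Local Notation C := (Cx R).

Lemma continuous_ccont (Psi : C -> C) : continuous Psi ->
  ccont (fun w => complex.Re (Psi w)) /\ ccont (fun w => complex.Im (Psi w)).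
Proof.
move=> cP; have key z (e : R) : 0 < e -> exists2 r : R, 0 < r & forall w, nrm (w - z) < r -> nrm (Psi w - Psi z) < e.
  move=> e0; have : nbhs (Psi z) [set v | nrm (v - Psi z) < e] by apply/nbhs_nrmP; exists e.
  by move=> /(cP z) /nbhs_nrmP.
split=> z e e0; have [r r0 Hr] := key z e e0; exists r => // w /Hr; apply: le_lt_trans.
  by rewrite -cReB; exact: ler_Re.
by rewrite -cImB; exact: ler_Im.
Qed.

Lemma eig_avgE m (A : 'M[C]_m) (Psi : C -> C) :
  eig_avg A Psi = ((\sum_(l <- eigs A) complex.Re (Psi l)) / m%:R) +i* ((\sum_(l <- eigs A) complex.Im (Psi l)) / m%:R).
Proof.
have -> : eig_avg A Psi = (m%:R^-1)%:C * \sum_(l <- eigs A) Psi l.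
  by rewrite /eig_avg; congr (_ * _); rewrite fmorphV rmorph_nat.
by apply: Cext; rewrite ?cReM ?cImM /= ?mul0r ?subr0 ?addr0 ?cRe_sum ?cIm_sum mulrC.
Qed.
End EigenvalueAverages.

Theorem mainTheorem12 (R : realType) (d s : nat)
  (Z W : d.-tuple R -> 'M[Cx R]_s) (SL : {set 'I_d}) :
  Linf_mx Z -> Linf_mx W -> tor_periodic Z -> tor_periodic W ->
  interior (specRange (Gsym SL Z W)) = set0 ->
  connected (~` specRange (Gsym SL Z W)) ->
  lambda_dist (fun n => Toeplitz SL n (Fq Z W)) (Gsym SL Z W).
Proof.
move=> /Linf_trunc[Z' bZ aZ] /Linf_trunc[W' bW aW] _ _ S0 Scon Psi [cPsi _].
set G := Gsym SL Z W in S0 Scon *; pose H := Gsym SL Z' W'.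
have bH : mcbmf H by exact: mcbmf_Gsym.
have aGH : {ae torus_prob R d, forall t, G t = H t} by exact: ae_Gsym.
(* The topological hypotheses concern [G] while the calculus needs the bounded [H]; almost
   everywhere equality places the eigenvalues of [H] in the range of [G]. *)
have aS : {ae torus_prob R d, forall t, forall l, l \in eigs (H t) -> specRange G l}.
  by apply: filterS2 aGH (ae_eigs_specRange G) => t ->.
pose D (n : 'I_d -> nat) := ((\sum_(i < NN n) s) + (\sum_(i < NN n) s))%N.
pose fr n : 'I_(D n) -> {ffun 'I_d -> int} := @block_freq d s n.
pose cp n : 'I_(D n) -> 'I_(s + s) := @block_comp d s n.
have inj n : forall u v, cp n u = cp n v -> fr n u = fr n v -> u = v by exact: block_freq_inj.
have bad0 q k : tends0 (@multi_infty d) (fun n => #|bad (fr n) (cp n) q k|%:R / (D n)%:R) := @block_bad_null d R s q k.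
have [M [M0 HMt HMn]] := eigs_bound inj bH.
have Gb : forall w, specRange G w -> nrm w <= M + 1.
  apply: specRange_bounded; apply: filterS aGH => t -> l; exact: HMt.
have M1 : M <= M + 1 by rewrite lerDl.
have pe n : positive_on (M + 1) (empirical fr cp H n).
  by apply: empirical_positive => l ln; exact: le_trans (HMn n l ln) M1.
have pl : positive_on (M + 1) (limit_functional H).
  by apply: (limit_positive inj bH) => t l lt; exact: le_trans (HMt t l lt) M1.
have conv := functional_convergence Gb (@specRange_closed _ _ _ G) (specRange_nowhere_dense S0) Scon pe pl.
have {}conv f : ccont f -> tends0 (@multi_infty d) (fun n => empirical fr cp H n f - limit_functional H f).
  apply: conv => [z Sz|z Sz|P].
  (* The relative error polynomial of a pole at [z] equals 1 at [z] and is small on the range, so it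
     is the separating polynomial required. *)
  - have [p Hp] := pole_approx_all Gb (@specRange_closed _ _ _ G) Scon Sz (ltac:(by rewrite invr_gt0) : 0 < 8^-1 :> R).
    apply: (empirical_locally_null inj bad0 bH aS (z := z) (Q := 1 - (z%:P - 'X) * p)).
      by rewrite !hornerE subrr mul0r subr0.
    by move=> w Sw; rewrite !hornerE; exact: Hp.
  - by have [r r0 Hr] := specRange_closed Sz; exact: (limit_locally_null inj bH aS r0 Hr).
  - apply: empirical_poly => //; [exact: card_block_comp|exact: block_dim|].
    by apply: filterS (@multi_infty_gt0 d) => n n0; rewrite /NN prodn_gt0.
have [cr ci] := continuous_ccont cPsi.
have lim : (((2 * pi) ^- d)%:C : Cx R) * cint (fun t => eig_avg (G t) Psi) =
    limit_functional H (fun w => complex.Re (Psi w)) +i* limit_functional H (fun w => complex.Im (Psi w)).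
  rewrite (@cint_ae _ _ _ (fun t => eig_avg (H t) Psi)); last by apply: filterS aGH => t ->.
  have bf f : ccont f -> bmf (fun t => (\sum_(l <- eigs (H t)) f l) / (s + s)%:R).
    by move=> cf; apply: eq_bmf (bmfZ (s + s)%:R^-1 (bmf_eigs inj bH cf)) => t; rewrite mulrC.
  rewrite normalized_cint; last first.
    by split; [apply: eq_bmf (bf _ cr)|apply: eq_bmf (bf _ ci)] => t; rewrite eig_avgE.
  rewrite /ctorus /limit_functional; congr (_ +i* _).
    rewrite mulrC -torus_intZ; last exact: (bmf_eigs inj bH).
    by congr torus_int; apply/funext => t; rewrite eig_avgE; exact: mulrC.
  rewrite mulrC -torus_intZ; last exact: (bmf_eigs inj bH).
  by congr torus_int; apply/funext => t; rewrite eig_avgE; exact: mulrC.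
(* Real and imaginary parts cost e/3 each; the remaining third makes the inequality strict. *)
move=> e e0; rewrite lim; have e3 : 0 < e / 3 by exact: divr_gt0.
have [N HN] := filterI (conv _ cr _ e3) (conv _ ci _ e3).
exists N => n /HN [hr hi]; rewrite (Phi_Toeplitz SL bZ bW aZ aW) eig_avgE.
apply: le_lt_trans (ler_nrm_ReIm _) _; rewrite cReB cImB; apply: le_lt_trans (lerD hr hi) _.
lra.
Qed.
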